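(* For any initial data $u_{in}\in L^2(\mathbb{T})$, any $T>0$ and any non-empty open domain $\omega\subset\mathbb{T}$, there exists a source term $f\in C^0([0,T];L^2(\mathbb{T}))$ (possibly complex-valued) such that the unique solution $u$ to $$\partial_tu+iLu=\mathbf{1}_\omega f,\qquad u|_{t=0}=u_{in},$$ satisfies $u|_{t=T}=0$.
   Context: $\mathbb{T}=\mathbb{R}/(2\pi\mathbb{Z})$; functions are complex-valued; $\mathbf{1}_\omega$ is the indicator function of $\omega$. $g>0$ and $b>0$ are fixed constants. $L$ is the Fourier multiplier $L=\bigl((g-\partial_x^2)G(0)\bigr)^{1/2}$ with $G(0)=|D_x|\tanh(b|D_x|)$, i.e. $L e^{inx}=\ell(n)e^{inx}$ for $n\in\mathbb{Z}$ with $\ell(n)=\bigl((g+n^2)|n|\tanh(b|n|)\bigr)^{1/2}$. *)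

(* Defs.v *)
From mathcomp Require Import all_boot all_order all_algebra complex.
From mathcomp Require Import all_classical all_reals all_analysis.

Set Implicit Arguments.
Unset Strict Implicit.
Unset Printing Implicit Defensive.
Import Order.TTheory GRing.Theory Num.Theory.
Import numFieldNormedType.Exports.
Local Open Scope classical_set_scope.
Local Open Scope ring_scope.

(* A function on the circle R/(2 pi Z) is a 2 pi-periodic function on R, a subset
   of the circle is a 2 pi-periodic subset of R (open for the quotient topology
   iff open in R), and [0, 2 pi] is the fundamental domain for integration.
   A periodic distribution is identified with the sequence of its Fourier
   coefficients, of type int -> R[i]. *)

Section torus.
Context {R : realType}.
Implicit Types (u v : R -> R[i]) (a : int -> R[i]) (A : set R).

Definition periodic_fun u := periodic u (2 * pi).

Definition periodic_set A := forall x, A (x + 2 * pi) <-> A x.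

Definition Cintegral A u : R[i] :=
  Complex (\int[lebesgue_measure]_(x in A) complex.Re (u x))
          (\int[lebesgue_measure]_(x in A) complex.Im (u x)).

Definition expi (theta : R) : R[i] := Complex (cos theta) (sin theta).

Definition fourier u (n : int) : R[i] :=
  ((2 * pi)^-1)%:C%C *
  Cintegral `[0, 2 * pi] (fun x => u x * expi (- (n%:~R * x))).

Definition L2norm u : \bar R :=
  ((\int[lebesgue_measure]_(x in `[0%R, (2 * pi)%R])
      (Normc.normc (u x) ^+ 2)%:E) `^ 2^-1)%E.

(* Representatives are Borel functions; almost everywhere equal ones are not
   identified, so equality in L^2 is stated as equality almost everywhere. *)
Definition L2 : set (R -> R[i]) := [set u |
  [/\ periodic_fun u,
      measurable_fun setT (fun x => complex.Re (u x)),
      measurable_fun setT (fun x => complex.Im (u x)) &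
      (L2norm u < +oo)%E]].

Definition C0L2 (T : R) (u : R -> R -> R[i]) :=
  (forall t : R, t \in `[0, T] -> L2 (u t)) /\
  (forall t : R, t \in `[0, T] ->
    L2norm (fun x => u s x - u t x) @[s --> within `[0, T] (nbhs t)] --> 0%E).

Definition Hnorm (r : R) a : \bar R :=
  ((\esum_(n in [set: int])
      ((1 + n%:~R ^+ 2) `^ r * Normc.normc (a n) ^+ 2)%:E) `^ 2^-1)%E.

(* The derivative at t, relative to [0, T] (hence one-sided at 0 and T), of a
   curve of distributions w, in the norm of H^r. *)
Definition is_derive_Hs (r T : R) (w : R -> int -> R[i]) (t : R) a :=
  Hnorm r (fun n => ((s - t)^-1)%:C%C * (w s n - w t n) - a n)
    @[s --> within `[0, T] t^'] --> 0%E.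

Definition tanh (x : R) : R := (expR x - expR (- x)) / (expR x + expR (- x)).

Definition ell (g b : R) (n : int) : R :=
  Num.sqrt ((g + n%:~R ^+ 2) * `|n%:~R| * tanh (b * `|n%:~R|)).

Definition Lop (g b : R) a : int -> R[i] := fun n => (ell g b n)%:C%C * a n.

Definition truncate A u : R -> R[i] := fun x => (\1_A x)%:C%C * u x.

(* The solutions, on [0, T], of the Cauchy problem
     d_t u + i L u = 1_omega f,  u|_{t=0} = uin,
   in C^0([0, T]; L^2).  As L has order 3/2, L u is valued in H^(-3/2), and
   the equation is an equality in this space at each time. *)
Definition is_solution (g b T : R) (omega : set R) (f : R -> R -> R[i])
    (uin : R -> R[i]) (u : R -> R -> R[i]) :=
  [/\ C0L2 T u,
      forall t : R, t \in `[0, T] ->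
        is_derive_Hs (- (3 / 2)) T (fun s => fourier (u s)) t
          (fun n => fourier (truncate omega (f t)) n
                    - 'i%C * Lop g b (fourier (u t)) n) &
      u 0 = uin %[ae lebesgue_measure]].

End torus.

(* Main.v *)
Require Import Defs.
From mathcomp Require Import all_boot all_order all_algebra complex.
From mathcomp Require Import all_classical all_reals all_analysis.
From mathcomp Require Import measurable_realfun.
From mathcomp Require Import ring lra zify.

Set Implicit Arguments.
Unset Strict Implicit.
Unset Printing Implicit Defensive.
Import Order.TTheory GRing.Theory Num.Theory.
Import numFieldNormedType.Exports.
Local Open Scope classical_set_scope.
Local Open Scope ring_scope.

(** Write [lam n = ell g b n], [e_n (x) = exp (i n x)] and [a_n] for the Fourier
    coefficients of [uin]. On Fourier coefficients the equation decouples into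
    [u_n' + i lam n u_n = F_n], where [F_n (t)] is the coefficient of order [n]
    of [1_omega f (t)], and Duhamel's formula reduces null control to the moment
    equations
      [int_0^T exp (i lam n t) F_n (t) dt = - a_n]    for all [n].

    They are solved by an explicit control. Suppose that there are real functions
    [q_k], indexed by natural numbers, continuous, supported in [[0, T]], bounded
    uniformly in [k], and biorthogonal to the oscillations of the problem:
      [int q_k (t) exp (i (lam n - lam k) t) dt] is 1 if [n = k] and 0 otherwise.
    Set [f (t) = sum_m d_m exp (- i lam m t) q_|m| (t) e_m] with [d] square
    summable. With [phi] the Fourier coefficients of [1_omega], the moment of
    order [n] is the sum of [phi (n - m) d_m] over the [m] with [|m| = |n|],
    because [lam] is even. So the moment equations split into the systems of size
    two
      [phi 0 d_n + phi (2 n) d_(-n) = - a_n],  [phi (-2 n) d_n + phi 0 d_(-n) = - a_(-n)]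
    (and one scalar equation for [n = 0]). Their determinants are bounded below
    by a positive constant ([phi_gap]): up to the factor [2 pi], the difference
    [phi 0 - |phi (2 n)|] is the integral over [omega], which contains an
    interval, of a function [1 - cos (2 n x + f)]. So [d] exists and is square
    summable ([solve_pairs]).

    The profiles come from the superlinear growth of [lam], in the form of the gap
    [|lam n - lam k| >= c |n - k| ^ (3 / 2)] ([ell_gap]). To kill the frequency
    [eta = lam n - lam k] in the Fourier transform of a function, one averages its
    translates by [+ d] and [- d], where [d = pi / (2 |eta|)]. The total of these
    translations over [n] is finite by the gap, hence small beyond some distance
    of [n] to [k] that depends only on [T] and [c]. The finitely many other
    frequencies are killed by arbitrarily short three-point convolutions, whose
    norm exceeds 1 but is controlled. Starting from a tent function in the middle
    of [[0, T]], the infinite convolution converges and keeps its support in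
    [[0, T]] ([biorthogonal_profiles]).

    The functional analysis is expressed by Fourier coefficients. Bessel's
    inequality, the theorem of Riesz and Fischer ([riesz_fischer]) and the
    completeness of the trigonometric system ([fourier_inj]) identify [L^2] of
    the circle with the square summable sequences. Continuity in time is then
    dominated convergence for sequences ([l2le_mult_near]), and the equation in
    [H^(-3/2)] follows from a mean value inequality in [l^2] ([l2_mean_value],
    [sol_derive]). Uniqueness holds because the coefficients of the difference of
    two solutions have constant modulus ([rotation_unique]). *)

(** * Complex numbers and square summable sequences *)

Section complex_squares.
Context {R : realType}.
Implicit Types (x y z : R[i]).

(** Squared moduli are polynomials in the real and imaginary parts, which keeps
    all estimates within the arithmetic of the real field. *)
Definition sqmod z : R := complex.Re z ^+ 2 + complex.Im z ^+ 2.

Lemma cReD x y : complex.Re (x + y) = complex.Re x + complex.Re y.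
Proof. by case: x; case: y. Qed.
Lemma cImD x y : complex.Im (x + y) = complex.Im x + complex.Im y.
Proof. by case: x; case: y. Qed.
Lemma cReN x : complex.Re (- x) = - complex.Re x.
Proof. by case: x. Qed.
Lemma cImN x : complex.Im (- x) = - complex.Im x.
Proof. by case: x. Qed.
Lemma cReB x y : complex.Re (x - y) = complex.Re x - complex.Re y.
Proof. by case: x; case: y. Qed.
Lemma cImB x y : complex.Im (x - y) = complex.Im x - complex.Im y.
Proof. by case: x; case: y. Qed.
Lemma cReM x y : complex.Re (x * y) =
  complex.Re x * complex.Re y - complex.Im x * complex.Im y.
Proof. by case: x; case: y. Qed.
Lemma cImM x y : complex.Im (x * y) =
  complex.Re x * complex.Im y + complex.Im x * complex.Re y.
Proof. by case: x; case: y. Qed.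
Lemma cReC (r : R) : complex.Re (r%:C%C) = r. Proof. by []. Qed.
Lemma cImC (r : R) : complex.Im (r%:C%C) = 0. Proof. by []. Qed.
Lemma cReJ x : complex.Re (x^*)%C = complex.Re x. Proof. by case: x. Qed.
Lemma cImJ x : complex.Im (x^*)%C = - complex.Im x. Proof. by case: x. Qed.

Definition ReImE := (cReD, cImD, cReN, cImN, cReB, cImB, cReM, cImM, cReJ, cImJ).

Lemma complexP x y :
  complex.Re x = complex.Re y -> complex.Im x = complex.Im y -> x = y.
Proof. by case: x y => [a b] [c d] /= -> ->. Qed.

Lemma sqmod_ge0 z : 0 <= sqmod z.
Proof. by rewrite addr_ge0 ?sqr_ge0. Qed.

Lemma sqmodE z : Normc.normc z ^+ 2 = sqmod z.
Proof. by case: z => a b; rewrite /= sqr_sqrtr// addr_ge0 ?sqr_ge0. Qed.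

Lemma sqmod0 : sqmod 0 = 0.
Proof. by rewrite /sqmod /= expr0n addr0. Qed.

Lemma sqmodM x y : sqmod (x * y) = sqmod x * sqmod y.
Proof. by rewrite -!sqmodE Normc.normcM exprMn. Qed.

Lemma sqmodC (r : R) : sqmod r%:C%C = r ^+ 2.
Proof. by rewrite /sqmod /= expr0n addr0. Qed.

Lemma sqmodN x : sqmod (- x) = sqmod x.
Proof. by rewrite /sqmod !ReImE !sqrrN. Qed.

Lemma sqmodBC x y : sqmod (x - y) = sqmod (y - x).
Proof. by rewrite -sqmodN opprB. Qed.

Lemma sqmodJ x : sqmod (x^*)%C = sqmod x.
Proof. by rewrite /sqmod !ReImE sqrrN. Qed.

Lemma sqmod_eq0 x : (sqmod x == 0) = (x == 0).
Proof.
apply/idP/eqP => [|->]; last by rewrite sqmod0.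
rewrite paddr_eq0 ?sqr_ge0// !sqrf_eq0 => /andP[/eqP a /eqP b].
exact: complexP.
Qed.

Lemma sqmodD_le x y : sqmod (x + y) <= 2 * sqmod x + 2 * sqmod y.
Proof.
rewrite -subr_ge0 (_ : _ - _ = sqmod (x - y)) ?sqmod_ge0//.
by rewrite /sqmod !ReImE; ring.
Qed.

Lemma sqmodB_le x y : sqmod (x - y) <= 2 * sqmod x + 2 * sqmod y.
Proof. by rewrite -(sqmodN y) sqmodD_le. Qed.

Lemma mulcJ x : x * (x^*)%C = (sqmod x)%:C%C.
Proof. by apply: complexP; rewrite !ReImE /sqmod /=; ring. Qed.

Lemma normRe_sqmod x : complex.Re x ^+ 2 <= sqmod x.
Proof. by rewrite lerDl sqr_ge0. Qed.

Lemma normIm_sqmod x : complex.Im x ^+ 2 <= sqmod x.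
Proof. by rewrite lerDr sqr_ge0. Qed.

Lemma expiD (s t : R) : expi (s + t) = expi s * expi t :> R[i].
Proof. by apply: complexP; rewrite !ReImE /= ?cosD ?sinD// addrC. Qed.

Lemma expi0 : expi 0 = 1 :> R[i].
Proof. by apply: complexP; rewrite /= ?cos0 ?sin0. Qed.

Lemma expiN (s : R) : expi (- s) = (expi s)^*%C :> R[i].
Proof. by apply: complexP; rewrite !ReImE /= ?cosN ?sinN. Qed.

Lemma sqmod_expi (s : R) : sqmod (expi s) = 1.
Proof. by rewrite /sqmod /= cos2Dsin2. Qed.

End complex_squares.

Section square_summable.
Context {R : realType}.
Implicit Types (a b : int -> R[i]) (M : R).

(** Square summability with an explicit bound, through finite partial sums, so
    that all estimates are between finite sums of real numbers. *)
Definition l2le a M :=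
  forall s : seq int, uniq s -> \sum_(n <- s) sqmod (a n) <= M.

Lemma l2le_ge0 a M : l2le a M -> 0 <= M.
Proof. by move=> /(_ [::] isT); rewrite big_nil. Qed.

Lemma l2leW a M N : M <= N -> l2le a M -> l2le a N.
Proof. by move=> MN aM s us; exact: le_trans (aM s us) MN. Qed.

Lemma l2le_term a M n : l2le a M -> sqmod (a n) <= M.
Proof. by move=> /(_ [:: n] isT); rewrite big_seq1. Qed.

Lemma l2le_ler a b M C : 0 <= C -> (forall n, sqmod (b n) <= C * sqmod (a n)) ->
  l2le a M -> l2le b (C * M).
Proof.
move=> C0 ba aM s us; apply: le_trans (ler_wpM2l C0 (aM s us)).
by rewrite mulr_sumr; apply: ler_sum.
Qed.

Lemma l2leD a b M N : l2le a M -> l2le b N ->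
  l2le (fun n => a n + b n) (2 * M + 2 * N).
Proof.
move=> aM bN s us; apply: (@le_trans _ _
  (2 * \sum_(n <- s) sqmod (a n) + 2 * \sum_(n <- s) sqmod (b n))).
  by rewrite !mulr_sumr -big_split/=; apply: ler_sum => i _; exact: sqmodD_le.
by apply: lerD; apply: ler_wpM2l => //; [exact: aM|exact: bN].
Qed.

Lemma l2leB a b M N : l2le a M -> l2le b N ->
  l2le (fun n => a n - b n) (2 * M + 2 * N).
Proof.
move=> aM bN; apply: l2leD => // s us.
by under eq_bigr do rewrite sqmodN; exact: bN.
Qed.

Lemma l2le_opp a M : l2le a M -> l2le (fun n => a (- n)) M.
Proof.
move=> aM s us; have := aM [seq - n | n <- s].
by rewrite big_map; apply; rewrite map_inj_uniq//; exact: oppr_inj.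
Qed.

(** Outside a suitable finite set of frequencies the energy is arbitrarily
    small: choose a finite sum that nearly attains the supremum. *)
Lemma l2le_tail a M (e : R) : l2le a M -> 0 < e ->
  exists s0 : seq int, uniq s0 /\
    l2le (fun n => if n \in s0 then 0 else a n) e.
Proof.
move=> aM e0.
pose S : set R := [set \sum_(n <- s) sqmod (a n) | s in [set s | uniq s]].
have S0 : S !=set0 by exists 0; exists [::] => //; rewrite big_nil.
have Sub : has_sup S by split => //; exists M => _ [s us <-]; exact: aM.
have [_ [s0 us0 <-] Hs0] := sup_adherent e0 Sub.
exists s0; split => // s us.
have -> : \sum_(n <- s) sqmod (if n \in s0 then 0 else a n) =
    \sum_(n <- [seq n <- s | n \notin s0]) sqmod (a n).
  rewrite big_filter (bigID (mem s0))/= big1 ?add0r => [|i ->]; last by rewrite sqmod0.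
  by apply: eq_bigr => i /negbTE ->.
have : \sum_(n <- s0 ++ [seq n <- s | n \notin s0]) sqmod (a n) <= sup S.
  apply: ub_le_sup; first by case: Sub.
  exists (s0 ++ [seq n <- s | n \notin s0]) => //=.
  rewrite cat_uniq us0 filter_uniq// andbT; apply/hasPn => x.
  by rewrite mem_filter => /andP[].
by rewrite big_cat/=; lra.
Qed.

Lemma fsbig_seq_int (X : set int) (f : int -> \bar R) : finite_set X ->
  exists s : seq int, uniq s /\ (\sum_(n \in X) f n = \sum_(n <- s) f n)%E.
Proof.
move=> fX; exists (finmap.enum_fset (fset_set X)); split; first exact: finmap.fset_uniq.
by rewrite fsbig_finite.
Qed.

Lemma esum_le (c : int -> R) M :
  (forall s : seq int, uniq s -> \sum_(n <- s) c n <= M) ->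
  (\esum_(n in [set: int]) (c n)%:E <= M%:E)%E.
Proof.
move=> cM; apply: ge_ereal_sup => _ [X [fX _] <-].
have [s [us ->]] := fsbig_seq_int (fun n => (c n)%:E) fX.
by rewrite sumEFin lee_fin cM.
Qed.

Lemma le_esum_term (c : int -> R) n : (forall m, 0 <= c m) ->
  ((c n)%:E <= \esum_(n in [set: int]) (c n)%:E)%E.
Proof.
move=> c0; apply: esum_ge; exists [set n]; first by split.
by rewrite fsbig_set1.
Qed.

End square_summable.

Section bounded_multipliers.
Context {R : realType}.

Lemma half_share (e N : R) : 0 < e -> 0 <= N -> e / (2 * (N + 1)) * N <= e / 2.
Proof.
move=> e0 N0; rewrite mulrAC ler_pdivrMr; last by lra.
by rewrite mulrCA -mulrA; nra.
Qed.

(** Dominated convergence for sequences: finitely many terms are handled by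
    pointwise convergence, the others carry little energy. *)
Lemma l2le_mult_near (T : Type) (F : set_system T) {FF : Filter F}
    (m : int -> T -> R[i]) (d : int -> R[i]) (M C : R) :
  l2le d M -> 0 <= C -> (forall n x, sqmod (m n x) <= C) ->
  (forall n, sqmod (m n x) @[x --> F] --> (0 : R)) ->
  forall e, 0 < e -> \forall x \near F, l2le (fun n => m n x * d n) e.
Proof.
move=> dM C0 mC mcv e e0.
pose e1 := e / (2 * (C + 1)).
have e10 : 0 < e1 by rewrite divr_gt0// mulr_gt0//; lra.
have [s0 [us0 ds0]] := l2le_tail dM e10.
pose N := (size s0)%:R * M.
have M0 := l2le_ge0 dM.
have N0 : 0 <= N by rewrite mulr_ge0.
pose e2 := e / (2 * (N + 1)).
have e20 : 0 < e2 by rewrite divr_gt0// mulr_gt0//; lra.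
have : \forall x \near F, forall n, n \in s0 -> sqmod (m n x) <= e2.
  elim: (s0) => [|j s IH].
    by apply: filterE => x n; rewrite in_nil.
  have /cvgrPdist_le/(_ _ e20) := mcv j.
  apply: filterS2 IH => x IH; rewrite sub0r normrN ger0_norm ?sqmod_ge0// => jx n.
  by rewrite inE => /predU1P[->//|/IH].
apply: filterS => x xs0 s us.
rewrite (bigID (mem s0))/=.
have -> : e = e / 2 + e / 2 by rewrite -splitr.
apply: lerD.
  apply: (@le_trans _ _ (\sum_(n <- s | n \in s0) e2 * M)).
    apply: ler_sum => n ns0; rewrite sqmodM ler_pM ?sqmod_ge0//; first exact: xs0.
    exact: l2le_term dM.
  rewrite -big_filter big_const_seq iter_addr addr0 count_predT.
  have ss : (size [seq i <- s | i \in s0] <= size s0)%N.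
    apply: uniq_leq_size; first by rewrite filter_uniq.
    by move=> i; rewrite mem_filter => /andP[].
  rewrite -[_ *+ size _]mulr_natl.
  apply: (@le_trans _ _ (e2 * N)).
    by rewrite mulrCA ler_wpM2l ?(ltW e20)// ler_wpM2r// ler_nat.
  exact: half_share.
apply: (@le_trans _ _ (C * \sum_(n <- s) sqmod (if n \in s0 then 0 else d n))).
  rewrite [X in C * X](bigID (mem s0))/= [X in _ * (X + _)]big1 ?add0r; last first.
    by move=> i ->; rewrite sqmod0.
  rewrite mulr_sumr; apply: ler_sum => n /negbTE ->.
  by rewrite sqmodM ler_wpM2r ?sqmod_ge0.
apply: (@le_trans _ _ (C * e1)); first by rewrite ler_wpM2l// ds0.
by rewrite mulrC; exact: half_share.
Qed.

End bounded_multipliers.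

(** * Square integrable functions and their Fourier coefficients *)

Section complex_integral.
Context {R : realType}.
Notation mu := (@lebesgue_measure R).
Implicit Types (A : set (measurableTypeR R)) (u v w : R -> R[i]).

Definition cmeas u :=
  measurable_fun [set: measurableTypeR R] (fun x => complex.Re (u x)) /\
  measurable_fun [set: measurableTypeR R] (fun x => complex.Im (u x)).

Lemma cmeasD u v : cmeas u -> cmeas v -> cmeas (fun x => u x + v x).
Proof.
move=> [u1 u2] [v1 v2]; split.
  by rewrite (funext (fun x => cReD _ _)); exact: measurable_funD.
by rewrite (funext (fun x => cImD _ _)); exact: measurable_funD.
Qed.

Lemma cmeasB u v : cmeas u -> cmeas v -> cmeas (fun x => u x - v x).
Proof.
move=> [u1 u2] [v1 v2]; split.
  by rewrite (funext (fun x => cReB _ _)); exact: measurable_funB.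
by rewrite (funext (fun x => cImB _ _)); exact: measurable_funB.
Qed.

Lemma cmeasM u v : cmeas u -> cmeas v -> cmeas (fun x => u x * v x).
Proof.
move=> [u1 u2] [v1 v2]; split.
  rewrite (funext (fun x => cReM _ _)).
  by apply: measurable_funB; exact: measurable_funM.
rewrite (funext (fun x => cImM _ _)).
by apply: measurable_funD; exact: measurable_funM.
Qed.

Lemma cmeasJ u : cmeas u -> cmeas (fun x => (u x)^*%C).
Proof.
move=> [u1 u2]; split.
  by rewrite (funext (fun x => cReJ _)).
rewrite (funext (fun x => cImJ _)).
exact: measurableT_comp.
Qed.

Lemma cmeas_cst (c : R[i]) : cmeas (fun=> c).
Proof. by split; exact: measurable_cst. Qed.

Lemma measurable_sqmod u A : measurable A -> cmeas u ->
  measurable_fun A (fun x => sqmod (u x)).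
Proof.
move=> mA [u1 u2]; apply: measurable_funTS.
by apply: measurable_funD; exact: measurable_funX.
Qed.

Definition cint A u :=
  mu.-integrable A (EFin \o (fun x => complex.Re (u x))) /\
  mu.-integrable A (EFin \o (fun x => complex.Im (u x))).

Lemma Re_Cintegral A u :
  complex.Re (Cintegral A u) = \int[mu]_(x in A) complex.Re (u x).
Proof. by []. Qed.

Lemma Im_Cintegral A u :
  complex.Im (Cintegral A u) = \int[mu]_(x in A) complex.Im (u x).
Proof. by []. Qed.

Variable (A : set (measurableTypeR R)) (mA : measurable A).

Lemma integrable_ext (f g : R -> \bar R) : (forall x, f x = g x) ->
  mu.-integrable A f -> mu.-integrable A g.
Proof. by move=> /funext ->. Qed.

Lemma integrable_EFinD (f g : R -> R) : mu.-integrable A (EFin \o f) ->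
  mu.-integrable A (EFin \o g) -> mu.-integrable A (EFin \o (fun x => f x + g x)).
Proof.
move=> fi gi; apply: integrable_ext (integrableD mA fi gi) => //.
Qed.

Lemma integrable_EFinB (f g : R -> R) : mu.-integrable A (EFin \o f) ->
  mu.-integrable A (EFin \o g) -> mu.-integrable A (EFin \o (fun x => f x - g x)).
Proof.
move=> fi gi; apply: integrable_ext (integrableB mA fi gi) => //.
Qed.

Lemma integrable_EFinZ (c : R) (f : R -> R) : mu.-integrable A (EFin \o f) ->
  mu.-integrable A (EFin \o (fun x => c * f x)).
Proof.
by move=> fi; apply: integrable_ext (integrableZl mA c fi) => //.
Qed.

Lemma cintZ (c : R[i]) u : cint A u -> cint A (fun x => c * u x).
Proof.
move=> [u1 u2]; split.
  apply: integrable_ext (integrable_EFinB (integrable_EFinZ (complex.Re c) u1)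
    (integrable_EFinZ (complex.Im c) u2)) => x /=.
  by rewrite cReM.
apply: integrable_ext (integrable_EFinD (integrable_EFinZ (complex.Re c) u2)
  (integrable_EFinZ (complex.Im c) u1)) => x /=.
by rewrite cImM.
Qed.

Lemma eq_Cintegral u v : (forall x, A x -> u x = v x) ->
  Cintegral A u = Cintegral A v.
Proof.
by move=> uv; apply: complexP; rewrite !(Re_Cintegral, Im_Cintegral);
  apply: eq_Rintegral => x /[1!inE] Ax; rewrite uv.
Qed.

Lemma CintegralD u v : cint A u -> cint A v ->
  Cintegral A (fun x => u x + v x) = Cintegral A u + Cintegral A v.
Proof.
move=> [u1 u2] [v1 v2]; apply: complexP; rewrite !ReImE !(Re_Cintegral, Im_Cintegral).
  under eq_Rintegral do rewrite cReD.
  exact: RintegralD.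
under eq_Rintegral do rewrite cImD.
exact: RintegralD.
Qed.

Lemma CintegralZ (c : R[i]) u : cint A u ->
  Cintegral A (fun x => c * u x) = c * Cintegral A u.
Proof.
move=> [u1 u2]; apply: complexP; rewrite !ReImE !(Re_Cintegral, Im_Cintegral).
  under eq_Rintegral do rewrite cReM.
  rewrite RintegralB ?RintegralZl//; exact: integrable_EFinZ.
under eq_Rintegral do rewrite cImM.
rewrite RintegralD ?RintegralZl//; exact: integrable_EFinZ.
Qed.

Lemma cintN u : cint A u -> cint A (fun x => - u x).
Proof.
move=> /(cintZ (-1)) h.
by rewrite (_ : (fun x => - u x) = (fun x => -1 * u x))//; apply/funext => x; rewrite mulN1r.
Qed.

Lemma CintegralN u : cint A u -> Cintegral A (fun x => - u x) = - Cintegral A u.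
Proof.
move=> ui; rewrite -mulN1r -CintegralZ//.
by apply: eq_Cintegral => x _; rewrite mulN1r.
Qed.

Lemma CintegralB u v : cint A u -> cint A v ->
  Cintegral A (fun x => u x - v x) = Cintegral A u - Cintegral A v.
Proof. by move=> ui vi; rewrite CintegralD ?CintegralN//; exact: cintN. Qed.

Lemma CintegralJ u : cint A u -> Cintegral A (fun x => (u x)^*%C) = (Cintegral A u)^*%C.
Proof.
move=> [u1 u2]; apply: complexP; rewrite !ReImE !(Re_Cintegral, Im_Cintegral).
  by under eq_Rintegral do rewrite cReJ.
under eq_Rintegral do rewrite cImJ.
under eq_Rintegral do rewrite -mulN1r.
by rewrite RintegralZl// mulN1r.
Qed.

End complex_integral.

Section square_integrable.
Context {R : realType}.
Notation mu := (@lebesgue_measure R).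
Implicit Types (u v w : R -> R[i]).

Let D : set (measurableTypeR R) := `[0, 2 * pi]%classic.
Let mD : measurable D. Proof. exact: measurable_itv. Qed.

(** Membership in [L^2] over one period, for functions that need not be
    periodic. *)
Definition sqint u := cmeas u /\ mu.-integrable D (fun x => (sqmod (u x))%:E).
(** The square of the norm of [L^2]; a real number, 0 by convention when the
    integral diverges. *)
Definition energy u : R := \int[mu]_(x in D) sqmod (u x).

Lemma muD_lty : (mu D < +oo)%E.
Proof. by rewrite lebesgue_measure_itv /=; case: ifP; rewrite ?ltry. Qed.

Lemma fine_muD : fine (mu D) = 2 * pi.
Proof.
rewrite lebesgue_measure_itv /= lte_fin mulr_gt0 ?pi_gt0//=.
by rewrite subr0.
Qed.

Lemma integrable_cstD (c : R) : mu.-integrable D (EFin \o cst c).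
Proof.
apply: measurable_bounded_integrable => //=; first exact: muD_lty.
exact: bounded_cst.
Qed.

Lemma sqint_bounded u (C : R) : cmeas u -> (forall x, sqmod (u x) <= C) -> sqint u.
Proof.
move=> mu_ uC; split => //.
apply: le_integrable (integrable_cstD C) => //.
  by apply/measurable_EFinP; exact: measurable_sqmod.
move=> x _ /=; rewrite lee_fin ger0_norm ?sqmod_ge0// (le_trans (uC x))//.
exact: ler_norm.
Qed.

Lemma sqint_le u v (C : R) : cmeas u -> sqint v ->
  (forall x, sqmod (u x) <= C * sqmod (v x)) -> sqint u.
Proof.
move=> mu_ [mv vi] uv; split => //.
apply: le_integrable (integrable_EFinZ mD C vi) => //.
  by apply/measurable_EFinP; exact: measurable_sqmod.
move=> x _ /=; rewrite lee_fin ger0_norm ?sqmod_ge0// (le_trans (uv x))//.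
exact: ler_norm.
Qed.

Lemma sqintD u v : sqint u -> sqint v -> sqint (fun x => u x + v x).
Proof.
move=> [mu_ ui] [mv vi]; split; first exact: cmeasD.
apply: le_integrable (integrable_EFinD mD (integrable_EFinZ mD 2 ui)
  (integrable_EFinZ mD 2 vi)) => //.
  by apply/measurable_EFinP; apply: measurable_sqmod => //; exact: cmeasD.
move=> x _ /=; rewrite lee_fin ger0_norm ?sqmod_ge0// (le_trans _ (ler_norm _))//.
exact: sqmodD_le.
Qed.

Lemma sqintM u v (C : R) : cmeas u -> (forall x, sqmod (u x) <= C) -> sqint v ->
  sqint (fun x => u x * v x).
Proof.
move=> mu_ uC [mv vi]; apply: (@sqint_le _ v C) => //; first exact: cmeasM.
by move=> x; rewrite sqmodM ler_wpM2r ?sqmod_ge0.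
Qed.

Lemma sqintZ (c : R[i]) u : sqint u -> sqint (fun x => c * u x).
Proof. by apply: (@sqintM _ _ (sqmod c)) => //; exact: cmeas_cst. Qed.

Lemma sqintB u v : sqint u -> sqint v -> sqint (fun x => u x - v x).
Proof.
move=> su sv; rewrite (_ : (fun x => u x - v x) = (fun x => u x + (-1) * v x)).
  by apply: sqintD => //; exact: sqintZ.
by apply/funext => x; rewrite mulN1r.
Qed.

Lemma sqint0 : sqint (fun=> 0).
Proof. by apply: (@sqint_bounded _ 0); [exact: cmeas_cst|rewrite sqmod0]. Qed.

Lemma sqint_sum (I : Type) (s : seq I) (F : I -> R -> R[i]) :
  (forall i, sqint (F i)) -> sqint (fun x => \sum_(i <- s) F i x).
Proof.
move=> FI; elim: s => [|i s IH].
  rewrite (_ : (fun x => \sum_(j <- [::]) F j x) = fun=> 0); first exact: sqint0.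
  by apply/funext => x; rewrite big_nil.
rewrite (_ : (fun x => \sum_(j <- i :: s) F j x) = fun x => F i x + \sum_(i <- s) F i x); first exact: sqintD.
by apply/funext => x; rewrite big_cons.
Qed.

(** The modulus of the product is at most the sum of the squared moduli. *)
Lemma cint_mulJ u v : sqint u -> sqint v -> cint D (fun x => u x * (v x)^*%C).
Proof.
move=> [mu_ ui] [mv vi]; have [m1 m2] := cmeasM mu_ (cmeasJ mv).
have key x : sqmod (u x * (v x)^*%C) <= (sqmod (u x) + sqmod (v x)) ^+ 2.
  rewrite sqmodM sqmodJ; have := sqmod_ge0 (u x); have := sqmod_ge0 (v x).
  by nra.
have s0 x : 0 <= sqmod (u x) + sqmod (v x) by rewrite addr_ge0 ?sqmod_ge0.
split; apply: le_integrable (integrable_EFinD mD ui vi) => //.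
- by apply/measurable_EFinP; exact: measurable_funTS.
- move=> x _ /=; rewrite lee_fin (ger0_norm (s0 x)).
  rewrite -ler_sqr ?nnegrE// real_normK ?num_real//.
  exact: le_trans (normRe_sqmod _) (key x).
- by apply/measurable_EFinP; exact: measurable_funTS.
- move=> x _ /=; rewrite lee_fin (ger0_norm (s0 x)).
  rewrite -ler_sqr ?nnegrE// real_normK ?num_real//.
  exact: le_trans (normIm_sqmod _) (key x).
Qed.

Lemma energy_ge0 u : 0 <= energy u.
Proof. by apply: Rintegral_ge0 => x _; exact: sqmod_ge0. Qed.

Lemma le_energy u v (C : R) : sqint u -> sqint v ->
  (forall x, sqmod (u x) <= C * sqmod (v x)) -> energy u <= C * energy v.
Proof.
move=> [_ ui] [_ vi] uv; rewrite -RintegralZl//.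
by apply: le_Rintegral => //; exact: integrable_EFinZ.
Qed.

Lemma integral_sqmod u : sqint u ->
  (\int[mu]_(x in D) (sqmod (u x))%:E = (energy u)%:E)%E.
Proof.
by move=> [_ ui]; rewrite /energy /Rintegral fineK//; exact: integrable_fin_num.
Qed.

Definition expz (n : int) (x : R) : R[i] := expi (n%:~R * x).

Lemma cmeas_expi (a : R) : cmeas (fun x : R => expi (a * x)).
Proof.
split => /=; apply: continuous_measurable_fun => x.
  by apply: (@continuous_comp _ _ _ (fun x => a * x) cos);
    [exact: mulrl_continuous|exact: continuous_cos].
by apply: (@continuous_comp _ _ _ (fun x => a * x) sin);
  [exact: mulrl_continuous|exact: continuous_sin].
Qed.

Lemma sqint_expz n : sqint (expz n).
Proof. by apply: (@sqint_bounded _ 1); [exact: cmeas_expi|move=> x; rewrite sqmod_expi]. Qed.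

Lemma fourierE u n :
  fourier u n = ((2 * pi)^-1)%:C%C * Cintegral D (fun x => u x * (expz n x)^*%C).
Proof. by rewrite /fourier; congr (_ * _); apply: eq_Cintegral => x _; rewrite expiN. Qed.

Lemma eq_fourier u v n : u =1 v -> fourier u n = fourier v n.
Proof. by move=> /funext ->. Qed.

Lemma fourierD u v n : sqint u -> sqint v ->
  fourier (fun x => u x + v x) n = fourier u n + fourier v n.
Proof.
move=> su sv; rewrite !fourierE -mulrDr -(CintegralD mD);
  [|by apply: cint_mulJ => //; exact: sqint_expz..].
by congr (_ * _); apply: eq_Cintegral => x _; rewrite mulrDl.
Qed.

Lemma fourierZ c u n : sqint u -> fourier (fun x => c * u x) n = c * fourier u n.
Proof.
move=> su; rewrite !fourierE mulrCA -(CintegralZ mD c);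
  last by apply: cint_mulJ => //; exact: sqint_expz.
by congr (_ * _); apply: eq_Cintegral => x _; rewrite mulrA.
Qed.

Lemma fourierB u v n : sqint u -> sqint v ->
  fourier (fun x => u x - v x) n = fourier u n - fourier v n.
Proof.
move=> su sv; rewrite -[- fourier v n]mulN1r -fourierZ// -fourierD//; last exact: sqintZ.
by apply: eq_fourier => x; rewrite mulN1r.
Qed.

Lemma fourier0 n : fourier (fun=> 0 : R[i]) n = 0.
Proof.
have h := fourierZ 0 n sqint0; rewrite [RHS]mul0r in h; rewrite -[RHS]h.
by apply: eq_fourier => x; rewrite mul0r.
Qed.

Lemma fourier_sum (I : Type) (s : seq I) (F : I -> R -> R[i]) n :
  (forall i, sqint (F i)) ->
  fourier (fun x => \sum_(i <- s) F i x) n = \sum_(i <- s) fourier (F i) n.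
Proof.
move=> FI; elim: s => [|i s IH].
  rewrite big_nil -[RHS](fourier0 n).
  by apply: eq_fourier => x; rewrite big_nil.
rewrite big_cons -IH -fourierD//; last exact: sqint_sum.
by apply: eq_fourier => x; rewrite big_cons.
Qed.

End square_integrable.

Section trigonometric_sums.
Context {R : realType}.
Notation mu := (@lebesgue_measure R).
Implicit Types (u v w : R -> R[i]) (a : int -> R[i]).

Let D : set (measurableTypeR R) := `[0, 2 * pi]%classic.
Let mD : measurable D. Proof. exact: measurable_itv. Qed.

Lemma Rintegral_eq (A : set (measurableTypeR R)) (f g : R -> R) : f =1 g ->
  \int[mu]_(x in A) f x = \int[mu]_(x in A) g x.
Proof. by move=> /funext ->. Qed.

Lemma expi_2pi_int (n : int) : expi (n%:~R * (2 * pi)) = 1 :> R[i].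
Proof.
have nat_case (k : nat) : expi (k%:R * (2 * pi)) = 1 :> R[i].
  elim: k => [|k IH]; first by rewrite mul0r expi0.
  rewrite -natr1 mulrDl expiD IH mul1r mul1r.
  by apply: complexP; rewrite /= mulr_natl ?cos2pi ?sin2pi.
case: n => k; first exact: nat_case.
by rewrite NegzE rmorphN /= mulNr expiN nat_case conjc1.
Qed.

Lemma continuous_cos_affine (k c : R) : continuous (fun x : R => cos (k * x + c)).
Proof.
move=> x; apply: (@continuous_comp _ _ _ (fun x => k * x + c) cos); last exact: continuous_cos.
by apply: cvgD; [exact: mulrl_continuous|exact: cvg_cst].
Qed.

Lemma is_derive_sin_affine (k c x : R) :
  is_derive x 1 (fun x : R => sin (k * x + c)) (k * cos (k * x + c)).
Proof.
have h1 : is_derive x 1 (fun x : R => k * x + c) k.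
  by apply: is_derive_eq; rewrite addr0 -[RHS]mulr1.
by rewrite mulrC; apply: (@is_derive1_comp _ sin (fun x => k * x + c)).
Qed.

Lemma Rintegral_cos_affine (k c a b : R) : k != 0 -> a < b ->
  \int[mu]_(x in `[a, b]) cos (k * x + c) =
  (sin (k * b + c) - sin (k * a + c)) / k.
Proof.
move=> k0 ab; rewrite /Rintegral.
pose F (x : R) := k^-1 * sin (k * x + c).
have dF (x : R) : is_derive x 1 F (cos (k * x + c)).
  have h := is_derive_sin_affine k c x.
  by apply: is_derive_eq; rewrite /GRing.scale /= mulrA mulVf// mul1r.
rewrite (@continuous_FTC2 _ (fun x => cos (k * x + c)) F a b)//.
- by rewrite -EFinB /= /F -mulrBr mulrC.
- by apply: continuous_subspaceT => x; exact: continuous_cos_affine.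
- have cF (x : R) : {for x, continuous F}.
    by apply: differentiable_continuous; apply/derivable1_diffP; exact: ex_derive.
  split => //.
  + by apply: cvg_at_right_filter; exact: cF.
  + by apply: cvg_at_left_filter; exact: cF.
- by move=> x _; rewrite derive1E; apply: derive_val.
Qed.

Lemma Cintegral_expz (n : int) : n != 0 -> Cintegral D (expz n) = 0 :> R[i].
Proof.
move=> n0; have nR : n%:~R != 0 :> R by rewrite intr_eq0.
have pi2 : 0 < 2 * pi :> R by rewrite mulr_gt0// pi_gt0.
have E := expi_2pi_int n.
have cE : cos (n%:~R * (2 * pi)) = 1 :> R by move/(congr1 (@complex.Re _)): E.
have sE : sin (n%:~R * (2 * pi)) = 0 :> R by move/(congr1 (@complex.Im _)): E.
apply: complexP; rewrite (Re_Cintegral, Im_Cintegral) /=.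
  rewrite (@Rintegral_eq D _ (fun x => cos (n%:~R * x + 0))); last by move=> x; rewrite addr0.
  by rewrite Rintegral_cos_affine// !addr0 mulr0 sE sin0 subrr mul0r.
rewrite (@Rintegral_eq D _ (fun x => cos (n%:~R * x + (- (pi / 2))))); last first.
  by move=> x; rewrite cosBpihalf.
by rewrite Rintegral_cos_affine// !sinBpihalf mulr0 cE cos0 subrr mul0r.
Qed.

Lemma Cintegral_1 : Cintegral D (fun=> 1) = (2 * pi)%:C%C :> R[i].
Proof.
apply: complexP; rewrite (Re_Cintegral, Im_Cintegral) /=.
  by rewrite Rintegral_cst// fine_muD mul1r.
by rewrite Rintegral_cst// mul0r.
Qed.

Lemma twopi_gt0 : 0 < 2 * pi :> R.
Proof. by rewrite mulr_gt0// pi_gt0. Qed.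

Lemma fourier_expz m n : fourier (expz m) n = (m == n)%:R :> R[i].
Proof.
rewrite fourierE.
have [->|mn] := eqVneq m n.
  rewrite (@eq_Cintegral _ D _ (fun=> 1)); last first.
    by move=> x _; rewrite mulcJ sqmod_expi.
  rewrite Cintegral_1 -rmorphM /= mulVf ?gt_eqF ?twopi_gt0//.
rewrite (@eq_Cintegral _ D _ (expz (m - n))); last first.
  by move=> x _; rewrite -expiN -expiD -mulrBl -intrB.
by rewrite Cintegral_expz ?subr_eq0// mulr0.
Qed.

(** Removing its [n]-th harmonic lowers the energy of a function by the energy
    of this harmonic, which is all that Bessel and Parseval need. *)
Lemma energy_sub_harmonic u n : sqint u ->
  energy u = 2 * pi * sqmod (fourier u n) +
    energy (fun x => u x - fourier u n * expz n x).
Proof.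
move=> su; set c := fourier u n.
have CI : Cintegral D (fun x => u x * (expz n x)^*%C) = (2 * pi)%:C%C * c.
  by rewrite /c fourierE mulrA -rmorphM /= divff ?gt_eqF ?twopi_gt0// mul1r.
have ci : cint D (fun x => c^*%C * (u x * (expz n x)^*%C)).
  by apply: cintZ => //; apply: cint_mulJ => //; exact: sqint_expz.
have key x : sqmod (u x - c * expz n x) =
    (sqmod (u x) + sqmod c) - 2 * complex.Re (c^*%C * (u x * (expz n x)^*%C)).
  have e1 : sqmod (expz n x) = 1 by rewrite sqmod_expi.
  have -> : sqmod c = sqmod c * sqmod (expz n x) by rewrite e1 mulr1.
  by rewrite /sqmod !ReImE; ring.
have [mu_ ui] := su; have [ci1 ci2] := ci.
rewrite {2}/energy; under eq_Rintegral do rewrite key.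
rewrite RintegralB//; last 2 first.
- by apply: integrable_EFinD => //; exact: integrable_cstD.
- exact: integrable_EFinZ.
rewrite RintegralD//; last exact: integrable_cstD.
rewrite RintegralZl// Rintegral_cst// fine_muD.
rewrite -Re_Cintegral CintegralZ//; last by apply: cint_mulJ => //; exact: sqint_expz.
have -> : c^*%C * Cintegral D (fun x => u x * (expz n x)^*%C) = (2 * pi * sqmod c)%:C%C.
  by rewrite CI mulrCA (mulrC _ c) mulcJ -rmorphM.
rewrite /= /energy; ring.
Qed.

Definition trigsum (s : seq int) a x : R[i] := \sum_(n <- s) a n * expz n x.

Lemma sqint_trigsum s a : sqint (trigsum s a).
Proof. by apply: sqint_sum => n; apply: sqintZ; exact: sqint_expz. Qed.

Lemma fourier_trigsum s a n : uniq s ->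
  fourier (trigsum s a) n = if n \in s then a n else 0.
Proof.
move=> us; rewrite fourier_sum; last by move=> i; apply: sqintZ; exact: sqint_expz.
under eq_bigr => i _ do rewrite (fourierZ _ _ (sqint_expz i)) fourier_expz.
case: ifPn => ns.
  rewrite (bigD1_seq n)//= eqxx mulr1 big1 ?addr0// => i /negbTE ->.
  by rewrite mulr0.
rewrite big_seq big1// => i si; case: eqVneq => [E|]; last by rewrite mulr0.
by rewrite -E si in ns.
Qed.

Lemma energy_split u s : sqint u -> uniq s ->
  energy u = 2 * pi * (\sum_(n <- s) sqmod (fourier u n)) +
    energy (fun x => u x - trigsum s (fourier u) x).
Proof.
move=> su; elim: s => [|n s IH].
  rewrite big_nil mulr0 add0r => _; congr energy; apply/funext => x.
  by rewrite /trigsum big_nil subr0.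
move=> /= /andP[ns us]; rewrite (IH us) big_cons.
have sr : sqint (fun x => u x - trigsum s (fourier u) x).
  by apply: sqintB => //; exact: sqint_trigsum.
have fr : fourier (fun x => u x - trigsum s (fourier u) x) n = fourier u n.
  rewrite fourierB//; last exact: sqint_trigsum.
  by rewrite fourier_trigsum// (negbTE ns) subr0.
rewrite (energy_sub_harmonic n sr) fr.
have -> : (fun x => u x - trigsum s (fourier u) x - fourier u n * expz n x) =
    (fun x => u x - trigsum (n :: s) (fourier u) x).
  by apply/funext => x; rewrite /trigsum big_cons opprD addrA addrAC.
by move: (energy _) (\sum_(i <- s) _) (sqmod _) => x y z; ring.
Qed.

Lemma bessel u : sqint u -> l2le (fourier u) ((2 * pi)^-1 * energy u).
Proof.
move=> su s us; rewrite ler_pdivlMl ?twopi_gt0//.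
by rewrite (energy_split su us) lerDl energy_ge0.
Qed.

Lemma energy0 : energy (fun=> 0 : R[i]) = 0.
Proof.
rewrite /energy; under eq_Rintegral do rewrite sqmod0.
by rewrite Rintegral_cst// mul0r.
Qed.

Lemma energy_trigsum s a : uniq s ->
  energy (trigsum s a) = 2 * pi * (\sum_(n <- s) sqmod (a n)).
Proof.
move=> us; rewrite (energy_split (sqint_trigsum s a) us).
have -> : energy (fun x => trigsum s a x - trigsum s (fourier (trigsum s a)) x) = 0.
  rewrite -energy0; congr energy; apply/funext => x.
  rewrite /trigsum -sumrB big_seq big1// => i si.
  by rewrite fourier_trigsum// si subrr.
rewrite addr0; congr (_ * _); rewrite big_seq [RHS]big_seq.
by apply: eq_bigr => i si; rewrite fourier_trigsum// si.
Qed.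

Lemma sqmod_fourier u n : sqint u -> sqmod (fourier u n) <= (2 * pi)^-1 * energy u.
Proof. by move=> /bessel /l2le_term. Qed.

End trigonometric_sums.

(** * Square summable sequences are Fourier coefficients *)

Section riesz_fischer.
Context {R : realType}.
Notation mu := (@lebesgue_measure R).
Implicit Types (u v w : R -> R[i]) (a : int -> R[i]).

Let D : set (measurableTypeR R) := `[0, 2 * pi]%classic.
Let mD : measurable D. Proof. exact: measurable_itv. Qed.

Lemma trigsum_widen s t a : uniq s -> uniq t -> {subset s <= t} ->
  trigsum s a =1 trigsum (R := R) t (fun n => if n \in s then a n else 0).
Proof.
move=> us ut st x; rewrite /trigsum [RHS](bigID (mem s))/= [X in _ + X]big1 ?addr0; last first.
  by move=> i /negbTE ->; rewrite mul0r.
rewrite -[RHS]big_filter; under [RHS]eq_big_seq => i.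
  by rewrite mem_filter => /andP[-> _]; over.
apply: perm_big; apply: uniq_perm; rewrite ?filter_uniq// => i.
by rewrite mem_filter; case: (boolP (i \in s)) => // /st ->.
Qed.

Lemma trigsumB s a b x : trigsum s a x - trigsum s b x = trigsum (R := R) s (fun n => a n - b n) x.
Proof. by rewrite -sumrB; apply: eq_bigr => i _; rewrite mulrBl. Qed.

(** The energy of the difference of two partial sums lives on frequencies that
    one of them misses. *)
Lemma energy_trigsumB s t a (e f : R) : uniq s -> uniq t ->
  l2le (fun n => if n \in s then 0 else a n) e ->
  l2le (fun n => if n \in t then 0 else a n) f ->
  energy (fun x => trigsum s a x - trigsum t a x) <= 2 * pi * (e + f).
Proof.
move=> us ut ae af; pose r := undup (s ++ t).
have ur : uniq r by exact: undup_uniq.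
have sr : {subset s <= r} by move=> i; rewrite mem_undup mem_cat => ->.
have tr : {subset t <= r} by move=> i; rewrite mem_undup mem_cat => ->; rewrite orbT.
rewrite (_ : (fun x => _) = trigsum r (fun n =>
    (if n \in s then a n else 0) - (if n \in t then a n else 0))); last first.
  by apply/funext => x; rewrite (trigsum_widen a us ur sr) (trigsum_widen a ut ur tr) trigsumB.
rewrite energy_trigsum// ler_wpM2l ?(ltW (@twopi_gt0 R))//.
apply: le_trans (lerD (ae r ur) (af r ur)); rewrite -big_split/=.
apply: ler_sum => n _; case: ifP; case: ifP => _ _.
- by rewrite subrr sqmod0 addr0.
- by rewrite subr0 sqmod0 add0r.
- by rewrite sub0r sqmodN sqmod0 addr0.
- by rewrite subrr sqmod0 addr_ge0 ?sqmod_ge0.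
Qed.

Lemma limn_einf_cvg (f : (\bar R)^nat) (l : \bar R) : f @ \oo --> l -> limn_einf f = l.
Proof. by move=> fl; rewrite is_cvg_limn_einfE ?(cvg_lim _ fl)//; apply/cvg_ex; exists l. Qed.

Lemma limn_einf_le_cst (f : (\bar R)^nat) (c : \bar R) : (forall n, (f n <= c)%E) ->
  (limn_einf f <= c)%E.
Proof.
move=> fc; rewrite limn_einf_lim; apply: lime_le; first exact: is_cvg_einfs.
by apply: nearW => n; apply: le_trans (fc n); apply: ereal_inf_lbound; exists n => /=.
Qed.

(** Fatou's lemma, for the lower limit of the squared moduli. *)
Lemma energy_fatou (v : nat -> R -> R[i]) w (c : R) :
  (forall i, sqint (v i)) -> (forall i, energy (v i) <= c) -> cmeas w ->
  {ae mu, forall x, D x -> sqmod (v i x) @[i --> \oo] --> sqmod (w x)} ->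
  sqint w /\ energy w <= c.
Proof.
move=> sv vc mw aew.
have mv i : cmeas (v i) by case: (sv i).
have msw : measurable_fun D (fun x => (sqmod (w x))%:E).
  by apply/measurable_EFinP; exact: measurable_sqmod.
have msv i : measurable_fun D (fun x => (sqmod (v i x))%:E).
  by apply/measurable_EFinP; exact: measurable_sqmod.
have le : (\int[mu]_(x in D) (sqmod (w x))%:E <= c%:E)%E.
  rewrite (@ae_eq_integral _ _ _ mu D (fun x => limn_einf (fun i => (sqmod (v i x))%:E)))//.
  - apply: le_trans (fatou mu mD msv _) _.
      by move=> n x _; rewrite lee_fin sqmod_ge0.
    apply: limn_einf_le_cst => i; rewrite integral_sqmod// lee_fin; exact: vc.
  - under [X in measurable_fun _ X]eq_fun do rewrite -[limn_einf _]oppeK.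
    apply: measurableT_comp => //.
    rewrite (_ : (fun x => _) = (fun x => limn_esup (fun i => - (sqmod (v i x))%:E))%E); last first.
      by apply/funext => x; rewrite limn_esupN oppeK.
    by apply: measurable_fun_limn_esup => i; apply: measurableT_comp.
  - apply: filterS aew => x h Dx; apply/esym/limn_einf_cvg.
    by apply: cvg_EFin; [exact: nearW|exact: h].
have iw : mu.-integrable D (fun x => (sqmod (w x))%:E).
  apply/integrableP; split => //.
  under eq_integral do rewrite gee0_abs ?lee_fin ?sqmod_ge0//.
  exact: le_lt_trans le (ltry _).
split; first by split.
by rewrite -lee_fin -integral_sqmod.
Qed.

End riesz_fischer.

Section riesz_fischer_theorem.
Context {R : realType}.
Notation mu := (@lebesgue_measure R).
Implicit Types (u v w : R -> R[i]) (a : int -> R[i]).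

Let D : set (measurableTypeR R) := `[0, 2 * pi]%classic.
Let mD : measurable D. Proof. exact: measurable_itv. Qed.

Lemma expz_periodic n : periodic_fun (expz (R := R) n).
Proof. by move=> x; rewrite /expz mulrDr expiD expi_2pi_int mulr1. Qed.

Lemma L2P u : L2 u <-> periodic_fun u /\ sqint u.
Proof.
pose I := (\int[mu]_(x in D) (sqmod (u x))%:E)%E.
have E : L2norm u = (I `^ 2^-1)%E.
  by rewrite /L2norm; congr (_ `^ _)%E; apply: eq_integral => x _; rewrite sqmodE.
split => [[pu m1 m2]|[pu su]].
  rewrite E => fin; split => //; have mu_ : cmeas u by split; [exact: m1|exact: m2].
  split => //; apply/integrableP; split.
    by apply/measurable_EFinP; exact: measurable_sqmod.
  under eq_integral do rewrite gee0_abs ?lee_fin ?sqmod_ge0//.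
  by apply: lty_poweRy fin; rewrite invr_eq0.
have [[m1 m2] _] := su; split => //.
by rewrite E /I integral_sqmod// poweR_EFin ltry.
Qed.

Lemma L2normE u : sqint u -> L2norm u = (energy u `^ 2^-1)%:E.
Proof.
move=> su; rewrite -poweR_EFin -integral_sqmod// /L2norm.
by congr (_ `^ _)%E; apply: eq_integral => x _; rewrite sqmodE.
Qed.

Lemma pow2_mul_ge0 (k : nat) (r : R) : 0 <= r -> 0 <= 2 ^+ k * r.
Proof. by move=> r0; rewrite mulr_ge0// exprn_ge0. Qed.

(** By the inequality between arithmetic and geometric means,
    [|z k| <= 2^k z k^2 + 2^-k]. *)
Lemma cvg_series_of_weighted_squares (z : R^nat) :
  ((\sum_(0 <= k <oo) ((2 ^+ k * z k ^+ 2)%:E)) < +oo)%E -> cvgn (series z).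
Proof.
move=> h.
have c1 : cvgn (series (fun k => 2 ^+ k * z k ^+ 2)).
  apply: nnseries_is_cvg => [k|]; last exact: h.
  by rewrite pow2_mul_ge0 ?sqr_ge0.
have c2 : cvgn (series (geometric (1 : R) (2^-1))).
  by apply: is_cvg_geometric_series; rewrite ger0_norm ?invr_ge0// invf_lt1// ltr1n.
have c3 : cvgn (series (fun k => 2 ^+ k * z k ^+ 2 + 2^-1 ^+ k)).
  rewrite (_ : (fun k => _) = (fun k => 2 ^+ k * z k ^+ 2) + geometric (1 : R) (2^-1)).
    exact: is_cvg_seriesD.
  by apply/funext => k /=; rewrite -[RHS]/(_ + 1 * 2^-1 ^+ k) mul1r.
apply: normed_cvg; apply: series_le_cvg c3 => k.
- exact: normr_ge0.
- by rewrite addr_ge0// ?pow2_mul_ge0 ?sqr_ge0// exprn_ge0 ?invr_ge0.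
rewrite /= exprVn.
rewrite -(real_normK (num_real (z k))).
have t0 : 0 < 2 ^+ k :> R by rewrite exprn_gt0.
set t := 2 ^+ k in t0 *; set n := `|z k|.
rewrite -subr_ge0.
have -> : t * n ^+ 2 + t^-1 - n = t^-1 * ((t * n - 1) ^+ 2 + t * n).
  by field; rewrite gt_eqF.
have n0 : 0 <= n by exact: normr_ge0.
have t0' := ltW t0.
apply: mulr_ge0; first by rewrite invr_ge0.
by rewrite addr_ge0 ?sqr_ge0 ?mulr_ge0.
Qed.

(** Partial sums over rapidly exhausting sets of frequencies converge almost
    everywhere, since the weighted sum of the squares of their increments has a
    finite integral. *)
Lemma ae_cvg_trigsum a (s : nat -> seq int) : (forall j, uniq (s j)) ->
  (forall j, l2le (fun n => if n \in s j then 0 else a n) ((4^-1) ^+ j)) ->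
  {ae mu, forall x, D x ->
    cvgn (fun j => complex.Re (trigsum (R := R) (s j) a x)) /\
    cvgn (fun j => complex.Im (trigsum (R := R) (s j) a x))}.
Proof.
move=> us sa.
pose d j x := trigsum (R := R) (s j.+1) a x - trigsum (s j) a x.
have sd j : sqint (d j) by apply: sqintB; exact: sqint_trigsum.
have md j : cmeas (d j) by case: (sd j).
have ed j : energy (d j) <= 4 * pi * 4^-1 ^+ j.
  apply: le_trans (energy_trigsumB (us j.+1) (us j) (sa j.+1) (sa j)) _.
  rewrite exprS; set q := _ ^+ j.
  have q0 : 0 <= q by rewrite exprn_ge0 ?invr_ge0.
  by have := mulr_ge0 (pi_ge0 R) q0; lra.
pose g x := (\sum_(0 <= k <oo) ((2 ^+ k * sqmod (d k x))%:E))%E.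
have g0 k x : (0 <= (2 ^+ k * sqmod (d k x))%:E)%E.
  by rewrite lee_fin pow2_mul_ge0 ?sqmod_ge0.
have mg k : measurable_fun D (fun x => (2 ^+ k * sqmod (d k x))%:E).
  by apply/measurable_EFinP; apply: measurable_funM => //; exact: measurable_sqmod.
have ig : (\int[mu]_(x in D) g x < +oo)%E.
  rewrite /g integral_nneseries//.
  apply: (@le_lt_trans _ _ (\sum_(0 <= k <oo) (4 * pi * 2^-1 ^+ k)%:E)%E).
    apply: lee_nneseries => [k _ _|k _].
      by apply: integral_ge0 => x _; exact: g0.
    under eq_integral do rewrite EFinM.
    rewrite ge0_integralZl_EFin//; last 2 first.
    - by move=> x _; rewrite lee_fin sqmod_ge0.
    - by apply/measurable_EFinP; exact: measurable_sqmod.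
    rewrite integral_sqmod// -EFinM lee_fin.
    apply: le_trans (ler_wpM2l (exprn_ge0 _ _) (ed k)) _ => //.
    rewrite mulrCA -exprMn (_ : 2 * 4^-1 = 2^-1 :> R)//; by field.
  have h : cvgn (series (geometric (4 * pi : R) (2^-1))).
    by apply: is_cvg_geometric_series; rewrite ger0_norm ?invr_ge0// invf_lt1// ltr1n.
  rewrite (_ : (fun _ => _) = EFin \o series (geometric (4 * pi : R) (2^-1))); last first.
    by apply/funext => n /=; rewrite /series /= sumEFin.
  by rewrite EFin_lim// ltry.
have mgg : measurable_fun D g.
  by apply: ge0_emeasurable_sum => // k x _ _; exact: g0.
have gi : mu.-integrable D g.
  apply/integrableP; split => //.
  under eq_integral do rewrite gee0_abs ?nneseries_ge0//.
  exact: ig.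
have := integrable_ae mD gi; apply: filterS => x /[apply] gx.
have gx' : (g x < +oo)%E by rewrite ltey_eq gx.
have tele (z : R^nat) : cvgn (series (fun k => z k.+1 - z k)) -> cvgn z.
  move=> cz; have -> : z = (fun n => z 0%N + series (fun k => z k.+1 - z k) n).
    by apply/funext => n; rewrite /series /= telescope_sumr// addrC subrK.
  by apply: is_cvgD => //; exact: is_cvg_cst.
split; apply: tele; apply: cvg_series_of_weighted_squares.
  apply: le_lt_trans gx'; apply: lee_nneseries => [k _ _|k _].
    by rewrite lee_fin pow2_mul_ge0 ?sqr_ge0.
  by rewrite lee_fin ler_wpM2l ?exprn_ge0// -cReB normRe_sqmod.
apply: le_lt_trans gx'; apply: lee_nneseries => [k _ _|k _].
  by rewrite lee_fin pow2_mul_ge0 ?sqr_ge0.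
by rewrite lee_fin ler_wpM2l ?exprn_ge0// -cImB normIm_sqmod.
Qed.

End riesz_fischer_theorem.

Section riesz_fischer_statement.
Context {R : realType}.
Notation mu := (@lebesgue_measure R).
Implicit Types (u v w : R -> R[i]) (a : int -> R[i]).

Let D : set (measurableTypeR R) := `[0, 2 * pi]%classic.
Let mD : measurable D. Proof. exact: measurable_itv. Qed.

Lemma trigsum_periodic s a : periodic_fun (trigsum (R := R) s a).
Proof. by move=> x; apply: eq_bigr => n _; rewrite expz_periodic. Qed.

Lemma cvg_sqmod (z : nat -> R[i]) (l : R[i]) :
  complex.Re (z j) @[j --> \oo] --> complex.Re l ->
  complex.Im (z j) @[j --> \oo] --> complex.Im l ->
  sqmod (z j) @[j --> \oo] --> sqmod l.
Proof. by move=> h1 h2; apply: cvgD; rewrite expr2; apply: cvgM. Qed.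

(** Partial sums that leave out an energy at most [4^-j] converge almost
    everywhere. Upper limits of their real and imaginary parts give a function
    that is measurable and periodic everywhere, and Fatou's lemma bounds its
    energy and its distance to the partial sums. *)
Theorem riesz_fischer a M : l2le a M ->
  exists u, [/\ L2 u, forall n, fourier u n = a n & energy u <= 2 * pi * M].
Proof.
move=> aM.
have q0 (j : nat) : 0 < 4^-1 ^+ j :> R by rewrite exprn_gt0// invr_gt0.
have [s Hs] := @choice _ _ _ (fun j => l2le_tail aM (q0 j)).
have us j : uniq (s j) by case: (Hs j).
have sa j : l2le (fun n => if n \in s j then 0 else a n) (4^-1 ^+ j) by case: (Hs j).
pose S j := trigsum (R := R) (s j) a.
have sS j : sqint (S j) by exact: sqint_trigsum.
have mS j : cmeas (S j) by case: (sS j).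
pose u x := Complex (fine (limn_esup (fun j => (complex.Re (S j x))%:E)))
                    (fine (limn_esup (fun j => (complex.Im (S j x))%:E))).
have mu_ : cmeas u.
  have key (f : nat -> R -> R) :
      (forall j, measurable_fun [set: measurableTypeR R] (f j)) ->
      measurable_fun [set: measurableTypeR R] (fun x => fine (limn_esup (fun j => (f j x)%:E))).
    move=> mf; apply: (measurableT_comp (f := fine)) => //.
    by apply: measurable_fun_limn_esup => j; apply/measurable_EFinP.
  by split; apply: key => j; case: (mS j).
have cvu : {ae mu, forall x, D x -> complex.Re (S j x) @[j --> \oo] --> complex.Re (u x) /\
                                    complex.Im (S j x) @[j --> \oo] --> complex.Im (u x)}.
  have := ae_cvg_trigsum us sa; apply: filterS => x /[apply] -[c1 c2].
  have key (z : R^nat) : cvgn z -> z j @[j --> \oo] --> fine (limn_esup (fun j => (z j)%:E)).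
    move=> cz; rewrite is_cvg_limn_esupE.
      by rewrite (EFin_lim cz).
    by apply/cvg_ex; exists (limn z)%:E; apply: cvg_EFin; [exact: nearW|exact: cz].
  by split; [exact: (key _ c1)|exact: (key _ c2)].
have [su eu] : sqint u /\ energy u <= 2 * pi * M.
  apply: (@energy_fatou _ S) => //.
  - move=> j; rewrite energy_trigsum// ler_wpM2l ?(ltW (@twopi_gt0 R))//; exact: aM.
  - by apply: filterS cvu => x /[apply] -[c1 c2]; exact: cvg_sqmod.
have close j : energy (fun x => u x - S j x) <= 2 * pi * (2 * 4^-1 ^+ j).
  suff [_ h] : sqint (fun x => u x - S j x) /\
      energy (fun x => u x - S j x) <= 2 * pi * (2 * 4^-1 ^+ j) by exact: h.
  apply: (@energy_fatou _ (fun i x => S (i + j)%N x - S j x)).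
  - by move=> i; exact: sqintB.
  - move=> i; apply: le_trans (energy_trigsumB (us _) (us _) (sa _) (sa _)) _.
    rewrite ler_wpM2l ?(ltW (@twopi_gt0 R))// exprD.
    set q := 4^-1 ^+ j; set p := 4^-1 ^+ i.
    have : p <= 1 by rewrite exprn_ile1 ?invr_ge0// invf_le1// ler1n.
    have := q0 j; rewrite -/q; nra.
  - exact: cmeasB.
  - apply: filterS cvu => x /[apply] -[c1 c2].
    apply: cvg_sqmod.
      under eq_cvg do rewrite cReB; rewrite cReB; apply: cvgB; last exact: cvg_cst.
      by apply: (cvg_comp (addn^~ j) (fun i => complex.Re (S i x)) _ c1); exact: cvg_addnr.
    under eq_cvg do rewrite cImB; rewrite cImB; apply: cvgB; last exact: cvg_cst.
    by apply: (cvg_comp (addn^~ j) (fun i => complex.Im (S i x)) _ c2); exact: cvg_addnr.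
exists u; split => //.
  apply/L2P; split => // x; rewrite /u.
  have E j : S j (x + 2 * pi) = S j x by exact: trigsum_periodic.
  by under eq_fun do rewrite E; under [in X in Complex _ X]eq_fun do rewrite E.
move=> n; apply/eqP; rewrite -subr_eq0 -sqmod_eq0; apply/eqP.
have small j : sqmod (fourier u n - a n) <= 6 * 4^-1 ^+ j.
  have -> : fourier u n - a n = (fourier u n - fourier (S j) n) - (a n - fourier (S j) n).
    by rewrite opprB addrA subrK.
  apply: le_trans (sqmodB_le _ _) _.
  have h1 : sqmod (fourier u n - fourier (S j) n) <= 2 * 4^-1 ^+ j.
    rewrite -fourierB//; apply: le_trans (sqmod_fourier n (sqintB su (sS j))) _.
    by rewrite ler_pdivrMl ?twopi_gt0.
  have h2 : sqmod (a n - fourier (S j) n) <= 4^-1 ^+ j.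
    rewrite /S fourier_trigsum//; have := l2le_term n (sa j).
    by case: ifP; rewrite ?subr0// subrr.
  by lra.
apply/eqP; rewrite eq_le sqmod_ge0 andbT; apply/ler_addgt0Pl => e e0.
have cv : 6 * 4^-1 ^+ j @[j --> \oo] --> (0 : R).
  rewrite -(mulr0 6); apply: cvgM; first exact: cvg_cst.
  by apply: cvg_expr; rewrite ger0_norm ?invr_ge0// invf_lt1// ltr1n.
have /cvgrPdist_le/(_ _ e0) [j _ /(_ j (leqnn j))] := cv.
rewrite sub0r normrN ger0_norm ?mulr_ge0 ?(ltW (q0 j))// addr0 => h.
exact: le_trans (small j) h.
Qed.

End riesz_fischer_statement.

(** * Completeness of the trigonometric system *)

Section translation.
Context {R : realType}.
Notation mu := (@lebesgue_measure R).

Definition transl (a : R) : measurableTypeR R -> measurableTypeR R := fun x => x + a.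

Lemma measurable_transl a : measurable_fun [set: measurableTypeR R] (transl a).
Proof.
apply: (@continuous_measurable_fun R (fun x => x + a)) => x.
by apply: cvgD; [exact: cvg_id|exact: cvg_cst].
Qed.

(** Lebesgue measure is characterized by its values on half-open intervals. *)
Lemma lebesgue_measure_transl a (A : set (measurableTypeR R)) : measurable A ->
  pushforward mu (transl a) A = mu A.
Proof.
move=> mA; apply/esym/lebesgue_measure_unique => //=; first exact: measurable_transl.
move=> _ _ [[c b] _ <-].
rewrite /pushforward (_ : _ @^-1` _ = `](c - a), (b - a)]%classic); last first.
    by apply/seteqP; split => x /=; rewrite !in_itv/= /transl ltrBlDr lerBrDr.
by rewrite !lebesgue_measure_itv/= !lte_fin ltrD2r -!EFinB opprD opprK addrACA addNr addr0.
Qed.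

Lemma negligible_transl a (N : set (measurableTypeR R)) : mu.-negligible N ->
  mu.-negligible (transl a @^-1` N).
Proof.
move=> [B [mB B0 NB]]; exists (transl a @^-1` B); split.
- by rewrite -[X in measurable X]setTI; exact: measurable_transl.
- by have /= := lebesgue_measure_transl a mB; rewrite /pushforward B0.
- by move=> x /=; exact: NB.
Qed.

Lemma Rintegral_transl a (f : R -> R) :
  measurable_fun [set: measurableTypeR R] f ->
  mu.-integrable setT (EFin \o (fun x => f (x + a))) ->
  \int[mu]_x f (x + a) = \int[mu]_x f x.
Proof.
move=> mf intf; rewrite /Rintegral; congr fine.
have /= <- := @integral_pushforward _ _ _ _ _ _ (measurable_transl a) mu setT (EFin \o f)
  _ _ measurableT.
- apply: eq_measure_integral; first exact: measurable_transl.
  by move=> mt A mA _; exact: lebesgue_measure_transl.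
- exact/measurable_EFinP.
- exact: intf.
Qed.

(** The exceptional set on one period and the endpoint 0 have countably many
    translates by multiples of the period, each of measure zero. *)
Lemma ae_periodic (P : R -> Prop) : (forall x, P (x + 2 * pi) -> P x) ->
  (forall x, P x -> P (x + 2 * pi)) ->
  {ae mu, forall x, 0 < x < 2 * pi -> P x} -> {ae mu, forall x, P x}.
Proof.
move=> Pm Pp [B [mB B0 NB]].
have N0 : mu.-negligible (B `|` [set 0 : measurableTypeR R]).
  apply: negligibleU; first by exists B; split.
  by apply/negligibleP => //; exact: lebesgue_measure_set1.
have Pn (n : nat) x : P (x + n%:R * (2 * pi)) <-> P x.
  elim: n => [|n IH]; first by rewrite mul0r addr0.
  rewrite -natr1 mulrDl mul1r addrA; split => [/Pm/IH//|/IH/Pp//].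
have Pz (n : int) x : P (x + n%:~R * (2 * pi)) <-> P x.
  case: n => n; first exact: Pn.
  rewrite NegzE rmorphN /= mulNr.
  by have := Pn n.+1 (x - n.+1%:R * (2 * pi)); rewrite subrK => H; apply: iff_sym.
pose S (k : nat) := transl (k%:R * (2 * pi)) @^-1` (B `|` [set 0]) `|`
  transl (- (k%:R * (2 * pi))) @^-1` (B `|` [set 0]).
have : mu.-negligible (\bigcup_k S k).
  by apply: negligible_bigcup => k; apply: negligibleU; exact: negligible_transl.
apply: negligibleS => x /= nPx.
have p0 := @twopi_gt0 R.
pose k := Num.floor (x / (2 * pi)).
have k1 : k%:~R * (2 * pi) <= x by rewrite -ler_pdivlMr// ge_floor.
have k2 : x < (k%:~R + 1) * (2 * pi).
  by rewrite -ltr_pdivrMr//; have := lt_succ_floor (x / (2 * pi)); rewrite intrD.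
have inB : (B `|` [set 0]) (x - k%:~R * (2 * pi)).
  have [->|y0] := eqVneq (x - k%:~R * (2 * pi)) 0; first by right.
  left; apply: NB => /= H; apply: nPx.
  rewrite -(Pz (- k)) rmorphN /= mulNr; apply: H.
  rewrite lt0r y0 subr_ge0 k1 /= ltrBlDr.
  by move: k2; rewrite mulrDl mul1r addrC.
case: k inB {k1 k2} => n inB; first by exists n => //; right.
by exists n.+1 => //; left; move: inB; rewrite NegzE rmorphN /= mulNr opprK /transl.
Qed.

End translation.

Section trigonometric_polynomials.
Context {R : realType}.
Notation mu := (@lebesgue_measure R).
Implicit Types (u v w : R -> R[i]).

Let D : set (measurableTypeR R) := `[0, 2 * pi]%classic.
Let mD : measurable D. Proof. exact: measurable_itv. Qed.

(** Frequencies may be repeated in the list, so that sums and products are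
    obtained without normalizing it. *)
Definition istrig v := exists l : seq (R[i] * int),
  v =1 fun x => \sum_(p <- l) p.1 * expz p.2 x.

Lemma istrig_ext v w : v =1 w -> istrig v -> istrig w.
Proof. by move=> vw [l vl]; exists l => x; rewrite -vw. Qed.

Lemma istrig_cst c : istrig (fun=> c).
Proof. by exists [:: (c, 0)] => x; rewrite big_seq1 /expz /= mul0r expi0 mulr1. Qed.

Lemma istrig_expz n : istrig (expz n).
Proof. by exists [:: (1, n)] => x; rewrite big_seq1 mul1r. Qed.

Lemma istrigD v w : istrig v -> istrig w -> istrig (fun x => v x + w x).
Proof. by move=> [l vl] [k wk]; exists (l ++ k) => x; rewrite big_cat vl wk. Qed.

Lemma istrigM v w : istrig v -> istrig w -> istrig (fun x => v x * w x).
Proof.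
move=> [l vl] [k wk].
exists [seq (p.1 * q.1, p.2 + q.2) | p <- l, q <- k] => x.
rewrite big_allpairs_dep vl wk mulr_suml; apply: eq_bigr => p _.
rewrite mulr_sumr; apply: eq_bigr => q _ /=.
by rewrite /expz intrD mulrDl expiD mulrACA.
Qed.

Lemma istrig_cos (c : R) : istrig (fun x => (cos (x - c))%:C%C).
Proof.
apply: (@istrig_ext (fun x => (2^-1)%:C%C *
    ((expi (- c) : R[i]) * expz 1 x + expi c * expz (-1) x))).
  move=> x; rewrite /expz rmorphN /= mulN1r mul1r -!expiD.
  rewrite [- c + x]addrC -[c - x]opprB expiN.
  by apply: complexP; rewrite !ReImE /=; field.
apply: istrigM; first exact: istrig_cst.
by apply: istrigD; apply: istrigM; try exact: istrig_cst; exact: istrig_expz.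
Qed.

Lemma Cintegral_istrig u v : sqint u -> (forall n, fourier u n = 0) -> istrig v ->
  Cintegral D (fun x => u x * (v x)^*%C) = 0.
Proof.
move=> su u0 [l vl].
have sl k : sqint (fun x => \sum_(p <- k) p.1 * expz (R := R) p.2 x).
  by apply: sqint_sum => p; apply: sqintZ; exact: sqint_expz.
rewrite (@eq_Cintegral _ D _ (fun x => u x * (\sum_(p <- l) p.1 * expz p.2 x)^*%C)); last first.
  by move=> x _; rewrite vl.
elim: l {vl} => [|p l IH].
  rewrite (@eq_Cintegral _ D _ (fun x => 0 * (u x * (expz 0 x)^*%C))); last first.
    by move=> x _; rewrite big_nil conjc0 mulr0 mul0r.
  by rewrite CintegralZ ?mul0r//; apply: cint_mulJ => //; exact: sqint_expz.
have ce : Cintegral D (fun x => u x * (expz p.2 x)^*%C) = 0.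
  have := u0 p.2; rewrite fourierE => /eqP; rewrite mulf_eq0 => /orP[|/eqP//].
  by rewrite eq_complex /= invr_eq0 (gt_eqF (@twopi_gt0 R)).
rewrite (@eq_Cintegral _ D _ (fun x => p.1^*%C * (u x * (expz p.2 x)^*%C) +
    u x * (\sum_(p <- l) p.1 * expz p.2 x)^*%C)); last first.
  by move=> x _; rewrite big_cons rmorphD rmorphM /= mulrDr mulrCA.
have ci : cint D (fun x => u x * (expz p.2 x)^*%C).
  by apply: cint_mulJ => //; exact: sqint_expz.
rewrite (CintegralD mD) ?IH ?CintegralZ ?ce ?mulr0 ?addr0//; first exact: cintZ.
exact: cint_mulJ.
Qed.

End trigonometric_polynomials.

Section sign_approximation.
Context {R : realType}.

Definition sgstep (t : R) : R := (3 * t - t ^+ 3) / 2.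

Lemma sgstepN t : sgstep (- t) = - sgstep t.
Proof. by rewrite /sgstep; field. Qed.

Lemma iter_sgstepN j t : iter j sgstep (- t) = - iter j sgstep t.
Proof. by elim: j => //= j ->; rewrite sgstepN. Qed.

Lemma iter_sgstep_itv j t : 0 < t <= 1 ->
  t <= iter j sgstep t <= 1 /\ 1 - iter j sgstep t <= (1 - t / 2) ^+ j.
Proof.
move=> /andP[t0 t1]; elim: j => [|j [/andP[IH1 IH2] IH3]] /=.
  by rewrite lexx t1 expr0; split => //; lra.
set s := iter j sgstep t in IH1 IH2 IH3 *.
have E : 1 - sgstep s = (1 - s) * ((1 - s) * (2 + s) / 2) by rewrite /sgstep; field.
have s0 : 0 <= s by lra.
have s1 : 0 <= 1 - s by lra.
have f1 : (1 - s) * (2 + s) / 2 <= 1 - t / 2 by nra.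
have f0 : 0 <= (1 - s) * (2 + s) / 2 by rewrite divr_ge0// mulr_ge0//; lra.
split.
  apply/andP; split; last by rewrite -subr_ge0 E mulr_ge0.
  apply: le_trans IH1 _; rewrite -subr_ge0 (_ : _ - s = s * ((1 - s) * (1 + s)) / 2).
    by apply: divr_ge0 => //; apply: mulr_ge0; [lra|apply: mulr_ge0; lra].
  by rewrite /sgstep; field.
rewrite E exprSr; apply: ler_pM => //.
Qed.

(** The map [t |-> (3 t - t^3) / 2] preserves [-1, 1] and drives every nonzero
    point to the fixed point [1] or [-1] of the same sign. *)
Lemma cvg_iter_sgstep t : -1 <= t <= 1 -> iter j sgstep t @[j --> \oo] --> Num.sg t.
Proof.
have pos s : 0 < s <= 1 -> iter j sgstep s @[j --> \oo] --> (1 : R).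
  move=> s01; have [s0 s1] := andP s01.
  have cv : (1 - s / 2) ^+ j @[j --> \oo] --> (0 : R).
    by apply: cvg_expr; rewrite ger0_norm; lra.
  have cv1 : 1 - (1 - s / 2) ^+ j @[j --> \oo] --> (1 : R).
    by rewrite -[X in _ --> X](subr0 1); apply: cvgB => //; exact: cvg_cst.
  apply: (squeeze_cvgr _ cv1 (@cvg_cst _ _ _ _ _)).
  by apply: nearW => j; have [/andP[a b] c] := iter_sgstep_itv j s01; apply/andP; split; lra.
move=> /andP[tm tp]; case: (ltrgtP t 0) => t0.
- rewrite ltr0_sg// -[t]opprK; under eq_cvg do rewrite iter_sgstepN.
  by apply: cvgN; apply: pos; lra.
- by rewrite gtr0_sg//; apply: pos; lra.
- rewrite t0 sgr0 (_ : (fun j => _) = fun=> 0); first exact: cvg_cst.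
  by apply/funext; elim => //= j ->; rewrite /sgstep mulr0 expr0n subr0 mul0r.
Qed.

Lemma iter_sgstep_bound j t : -1 <= t <= 1 -> `|iter j sgstep t| <= 1.
Proof.
move=> /andP[tm tp]; have [t0|t0|->] := ltrgtP t 0.
- rewrite -[t]opprK iter_sgstepN normrN.
  have [|/andP[a b] _] := @iter_sgstep_itv j (- t); first by lra.
  by rewrite ler_norml; lra.
- have [|/andP[a b] _] := @iter_sgstep_itv j t; first by lra.
  by rewrite ler_norml; lra.
- suff -> : iter j sgstep 0 = 0 by rewrite normr0.
  by elim: j => //= j ->; rewrite /sgstep mulr0 expr0n subr0 mul0r.
Qed.

Lemma istrig_iter_sgstep j (T : R -> R) : istrig (fun x => (T x)%:C%C) ->
  istrig (fun x => (iter j sgstep (T x))%:C%C).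
Proof.
move=> hT; elim: j => //= j IH.
set S := fun x => (iter j sgstep (T x))%:C%C in IH.
apply: (@istrig_ext _ (fun x => (3 / 2)%:C%C * S x + (- 2^-1)%:C%C * (S x * (S x * S x)))).
  move=> x; rewrite /S -!rmorphM -rmorphD; congr (_%:C)%C.
  by rewrite /sgstep; field.
by apply: istrigD; apply: istrigM => //; try exact: istrig_cst; do 2 apply: istrigM => //.
Qed.

End sign_approximation.

Section completeness.
Context {R : realType}.
Notation mu := (@lebesgue_measure R).
Implicit Types (u v w : R -> R[i]).

Let D : set (measurableTypeR R) := `[0, 2 * pi]%classic.
Let mD : measurable D. Proof. exact: measurable_itv. Qed.

Let T (y x : R) : R := (cos (x - y / 2) - cos (y / 2)) / 2.

(** The factorization shows that the trigonometric polynomial [T y] has the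
    sign of [y - x] inside the period: its iterates under [sgstep] converge
    to this sign. *)
Lemma prodsinE (y x : R) : T y x = sin (x / 2) * sin ((y - x) / 2).
Proof.
rewrite /T (_ : x - y / 2 = x / 2 - (y - x) / 2); last by field.
rewrite (_ : y / 2 = x / 2 + (y - x) / 2); last by field.
by rewrite cosB cosD; field.
Qed.

Lemma sg_prodsin (y x : R) : 0 < y < 2 * pi -> 0 < x < 2 * pi ->
  Num.sg (T y x) = Num.sg (y - x).
Proof.
move=> /andP[y0 y1] /andP[x0 x1]; rewrite prodsinE sgrM gtr0_sg ?mul1r; last first.
  by apply: sin_gt0_pi; apply/andP; split; lra.
have [yx|yx|->] := ltrgtP y x.
- rewrite ltr0_sg ?ltr0_sg ?subr_lt0//.
  rewrite -[_ / 2]opprK sinN oppr_lt0; apply: sin_gt0_pi; apply/andP; split; lra.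
- rewrite gtr0_sg ?gtr0_sg ?subr_gt0//.
  by apply: sin_gt0_pi; apply/andP; split; lra.
- by rewrite subrr mul0r sin0.
Qed.

Lemma prodsin_bound (y x : R) : -1 <= T y x <= 1.
Proof.
have := cos_le1 (x - y / 2); have := cos_geN1 (x - y / 2).
have := cos_le1 (y / 2); have := cos_geN1 (y / 2).
by rewrite /T => a b c d; apply/andP; split; lra.
Qed.

Lemma istrig_prodsin (y : R) : istrig (fun x => (T y x)%:C%C : R[i]).
Proof.
apply: (@istrig_ext _ (fun x => (2^-1)%:C%C * ((cos (x - y / 2))%:C%C + (- cos (y / 2))%:C%C))).
  by move=> x; rewrite -rmorphD -rmorphM; congr (_%:C)%C; rewrite /T mulrC.
apply: istrigM; first exact: istrig_cst.
by apply: istrigD; [exact: istrig_cos|exact: istrig_cst].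
Qed.

Lemma continuous_prodsin (y : R) : continuous (T y).
Proof.
move=> x; apply: cvgM; last exact: cvg_cst.
apply: cvgB; last exact: cvg_cst.
have E : (fun x : R => cos (x - y / 2)) = (fun x => cos (1 * x + - (y / 2))).
  by apply/funext => z; rewrite mul1r.
by rewrite -[cos (x - _)]/((fun x : R => cos (x - y / 2)) x) E; exact: continuous_cos_affine.
Qed.

(** The iterates of [T y] are trigonometric polynomials bounded by 1, so by
    dominated convergence [f] is orthogonal to [x |-> sg (y - x)]; it is also
    orthogonal to the constants, and [1 + sg (y - x)] is twice the indicator of
    [[0, y]] almost everywhere. *)
Lemma integral0_of_orthogonal (f : R -> R) (y : R) :
  mu.-integrable D (EFin \o f) ->
  (forall v : R -> R, istrig (fun x => (v x)%:C%C) -> \int[mu]_(x in D) (f x * v x) = 0) ->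
  0 < y < 2 * pi -> \int[mu]_(x in `[0, y]) f x = 0.
Proof.
move=> fi f0 y02; have [y0 y1] := andP y02.
have mf : measurable_fun D f by apply/measurable_EFinP; exact: measurable_int fi.
pose h j x := iter j sgstep (T y x).
have mh j : measurable_fun [set: measurableTypeR R] (h j).
  elim: j => [|j IH]; first exact: (continuous_measurable_fun (@continuous_prodsin y)).
  apply: measurable_funM => //; apply: measurable_funB; last exact: measurable_funX.
  exact: measurable_funM.
have msg : measurable_fun [set: measurableTypeR R] (fun x => Num.sg (T y x)).
  apply: (@measurable_fun_cvg _ _ _ _ h) => // x _.
  exact: cvg_iter_sgstep (prodsin_bound y x).
have m1 j : measurable_fun D (fun x => (f x * h j x)%:E).
  by apply/measurable_EFinP; apply: measurable_funM => //; exact: measurable_funTS.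
have m2 : measurable_fun D (fun x => (f x * Num.sg (T y x))%:E).
  by apply/measurable_EFinP; apply: measurable_funM => //; exact: measurable_funTS.
have [i1 _ c1] : [/\ mu.-integrable D (fun x => (f x * Num.sg (T y x))%:E),
    (\int[mu]_(x in D) `|(f x * h j x)%:E - (f x * Num.sg (T y x))%:E|)%E @[j --> \oo] --> 0%E &
    (\int[mu]_(x in D) (f x * h j x)%:E)%E @[j --> \oo] -->
      (\int[mu]_(x in D) (f x * Num.sg (T y x))%:E)%E].
  apply: (@dominated_convergence _ _ _ mu D mD _ _ (EFin \o (fun x => `|f x|))) => //.
  - apply: aeW => x _; apply: cvg_EFin; first exact: nearW.
    by apply: cvgM; [exact: cvg_cst|exact: cvg_iter_sgstep (prodsin_bound y x)].
  - exact: integrable_norm.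
  - apply: aeW => x j _ /=; rewrite lee_fin normrM ler_piMr//.
    exact: iter_sgstep_bound (prodsin_bound y x).
have hj j : (\int[mu]_(x in D) (f x * h j x)%:E)%E = 0%E.
  have fh : mu.-integrable D (fun x => (f x * h j x)%:E).
    apply: le_integrable fi => // x _ /=.
    by rewrite lee_fin normrM ler_piMr//; exact: iter_sgstep_bound (prodsin_bound y x).
  have := f0 (h j) (istrig_iter_sgstep j (istrig_prodsin y)).
  rewrite /Rintegral => E; rewrite -[LHS]fineK; last exact: integrable_fin_num.
  by congr EFin.
have sg0 : (\int[mu]_(x in D) (f x * Num.sg (T y x))%:E)%E = 0%E.
  move: c1; rewrite (funext hj) => c1.
  by rewrite -(cvg_lim (@ereal_hausdorff R) c1) lim_cst.
have i2 : mu.-integrable D (EFin \o (fun x => f x * Num.sg (T y x))) by [].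
have f1 : \int[mu]_(x in D) f x = 0.
  have := f0 (fun=> 1) (istrig_cst _).
  by under eq_Rintegral do rewrite mulr1.
have I : \int[mu]_(x in D) (f x + f x * Num.sg (T y x)) = 0.
  by rewrite RintegralD// f1 add0r /Rintegral sg0.
pose Y : set (measurableTypeR R) := `[0, y]%classic.
have mY : measurable Y by exact: measurable_itv.
have sub : Y `<=` D.
  by move=> x; rewrite /Y /D /= !in_itv/= => /andP[a b]; apply/andP; split; lra.
have AE : (\int[mu]_(x in D) (f x + f x * Num.sg (T y x))%:E =
           \int[mu]_(x in D) ((fun x => 2 * f x) \_ Y x)%:E)%E.
  apply: ae_eq_integral => //.
  - apply/measurable_EFinP; apply: measurable_funD => //; exact/measurable_EFinP.
  - apply/measurable_EFinP; apply/(measurable_restrict _ mY mD).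
    rewrite setIidr//; apply: measurable_funM => //; exact: measurable_funS mf.
  - have n1 (z : R) : mu.-negligible [set z].
      by apply/negligibleP; [exact: measurable_set1|exact: lebesgue_measure_set1].
    have := negligibleU (negligibleU (n1 0) (n1 y)) (n1 (2 * pi)).
    apply: negligibleS => x /= nP; apply: contrapT => nx; apply: nP => Dx.
    have x0 : x != 0 by apply/eqP => E; apply: nx; left; left.
    have xy : x != y by apply/eqP => E; apply: nx; left; right.
    have x2 : x != 2 * pi by apply/eqP => E; apply: nx; right.
    move: Dx; rewrite /D /= in_itv /= => /andP[x0' x2'].
    have xin : 0 < x < 2 * pi by rewrite !lt_neqAle x0' x2' x2 eq_sym x0.
    rewrite (sg_prodsin y02 xin).
    rewrite patchE; case: ifPn.
      rewrite inE /Y /= in_itv /= x0' /= => xley.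
      by rewrite gtr0_sg ?subr_gt0 ?lt_neqAle ?xy// mulr1 mulr2n mulrDl !mul1r.
    rewrite notin_setE /Y /= in_itv /= x0' /= => /negP; rewrite -ltNge => yx.
    by rewrite ltr0_sg ?subr_lt0// mulrN1 subrr.
move: I; rewrite /Rintegral AE -[fine _]/(Rintegral mu D _) -Rintegral_mkcondr setIidr//.
rewrite RintegralZl//; last exact: integrableS fi.
by move/eqP; rewrite mulf_eq0 pnatr_eq0 /= => /eqP.
Qed.

End completeness.

Section fourier_injective.
Context {R : realType}.
Notation mu := (@lebesgue_measure R).
Implicit Types (u v w : R -> R[i]).

Let D : set (measurableTypeR R) := `[0, 2 * pi]%classic.
Let mD : measurable D. Proof. exact: measurable_itv. Qed.

(** The primitive of [f] vanishes identically, and its derivative is [f] almost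
    everywhere by Lebesgue's differentiation theorem. *)
Lemma ae0_of_orthogonal (f : R -> R) :
  mu.-integrable D (EFin \o f) ->
  (forall v : R -> R, istrig (fun x => (v x)%:C%C) -> \int[mu]_(x in D) (f x * v x) = 0) ->
  {ae mu, forall x, 0 < x < 2 * pi -> f x = 0}.
Proof.
move=> fi f0; pose fD : R -> R := f \_ D.
have fDi : mu.-integrable setT (EFin \o fD).
  by rewrite /fD -restrict_EFin; apply/integrable_restrict => //; rewrite setTI.
have fDiy y : mu.-integrable [set` Interval (BLeft 0) (BRight y)] (EFin \o fD).
  by apply: integrableS fDi => //; exact: measurable_itv.
have := FTC1 fDiy (integrable_locally_restrict mD fi).
apply: filterS; first exact: (ae_filter_ringOfSetsType mu).
move=> x /= H /andP[x0 x1].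
have {H} [_ H] := H x0.
have -> : f x = fD x by rewrite /fD patchE mem_set// /D /= in_itv /= !ltW.
rewrite -H derive1E (near_eq_derive (g := cst 0)) ?derive_cst//.
near=> z.
have zin : 0 < z < 2 * pi.
  by apply/andP; split; near: z; [exact: lt_nbhsr|exact: lt_nbhsl].
rewrite /= -[RHS](integral0_of_orthogonal fi f0 zin).
apply: eq_Rintegral => t; rewrite inE /= in_itv /= => /andP[t0 tz].
by rewrite /fD patchE mem_set// /D /= in_itv /= t0 (le_trans tz)//; case/andP: zin => _ /ltW.
Unshelve. all: by end_near. Qed.

(** Completeness of the trigonometric system. It is reduced to real functions by
    testing the difference against real trigonometric polynomials. *)
Theorem fourier_inj u v : L2 u -> L2 v -> (forall n, fourier u n = fourier v n) ->
  u = v %[ae mu].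
Proof.
move=> /L2P[pu su] /L2P[pv sv] uv.
pose w x := u x - v x.
have sw : sqint w by exact: sqintB.
have w0 n : fourier w n = 0 by rewrite fourierB// uv subrr.
have key (p : R -> R) : istrig (fun x => (p x)%:C%C) ->
    \int[mu]_(x in D) (complex.Re (w x) * p x) = 0 /\
    \int[mu]_(x in D) (complex.Im (w x) * p x) = 0.
  move=> tv; have E := Cintegral_istrig sw w0 tv.
  have := congr1 (@complex.Re R) E; have := congr1 (@complex.Im R) E.
  rewrite Re_Cintegral Im_Cintegral /= => E2 E1; split.
    rewrite -[RHS]E1; apply: Rintegral_eq => x.
    by rewrite !ReImE /= oppr0 mulr0 subr0.
  rewrite -[RHS]E2; apply: Rintegral_eq => x.
  by rewrite !ReImE /= oppr0 mulr0 add0r.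
have wi : cint D w.
  have := cint_mulJ sw (sqint_expz 0); congr cint; apply/funext => x.
  by rewrite /expz mul0r expi0 conjc1 mulr1.
have a1 := ae0_of_orthogonal wi.1 (fun p tp => (key p tp).1).
have a2 := ae0_of_orthogonal wi.2 (fun p tp => (key p tp).2).
have a3 : {ae mu, forall x, 0 < x < 2 * pi -> u x = v x}.
  apply: filterS2 a1 a2; first exact: (ae_filter_ringOfSetsType mu).
  move=> x h1 h2 x0; apply/eqP; rewrite -subr_eq0; apply/eqP.
  by apply: complexP; [exact: h1|exact: h2].
have : {ae mu, forall x, u x = v x}.
  by apply: ae_periodic a3 => x; rewrite pu pv.
by apply: filterS; first exact: (ae_filter_ringOfSetsType mu).
Qed.

(** The half of Parseval's identity opposite to Bessel's inequality: the function
    of [riesz_fischer] with the same coefficients satisfies the bound and is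
    equal to [u] almost everywhere. *)
Lemma energy_le_of_fourier u M : L2 u -> l2le (fourier u) M -> energy u <= 2 * pi * M.
Proof.
move=> Lu uM; have [v [Lv vu ev]] := riesz_fischer uM.
have /L2P[_ su] := Lu; have /L2P[_ sv] := Lv.
suff -> : energy u = energy v by [].
rewrite /energy /Rintegral; congr fine; apply: ae_eq_integral => //.
- by apply/measurable_EFinP; apply: measurable_sqmod => //; case: su.
- by apply/measurable_EFinP; apply: measurable_sqmod => //; case: sv.
- apply: filterS (fourier_inj Lv Lu vu); first exact: (ae_filter_ringOfSetsType mu).
  by move=> x /= h _; rewrite h.
Qed.

End fourier_injective.

(** * Biorthogonal families of time profiles *)

Section kill_frequency.
Context {R : realType}.
Notation mu := (@lebesgue_measure R).
Implicit Types (q : R -> R) (M K a b c d : R).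

Definition profile M K a b q := [/\ forall t, `|q t| <= M,
  forall s t, `|q s - q t| <= K * `|s - t| &
  forall t, t < a \/ b < t -> q t = 0].

(** Convolution with a symmetric three-point measure of total mass one, whose
    Fourier transform vanishes at the frequencies [e] with [cos (e * d) = c].
    For [c = 0] it is the average of two translates, which increases neither
    the sup norm nor the Lipschitz constant. *)
Definition kill d c q : R -> R :=
  fun t => (q (t + d) + q (t - d) - 2 * c * q t) / (2 - 2 * c).

Lemma profile_ge0 M K a b q : profile M K a b q -> 0 <= M /\ 0 <= K.
Proof.
move=> [h1 h2 _]; split; first exact: le_trans (normr_ge0 _) (h1 0).
by have := h2 1 0; rewrite subr0 normr1 mulr1; exact: le_trans.
Qed.

Lemma profile_kill M K a b d c q : 0 <= d -> 0 <= c < 1 -> profile M K a b q ->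
  profile ((1 + c) / (1 - c) * M) ((1 + c) / (1 - c) * K) (a - d) (b + d) (kill d c q).
Proof.
move=> d0 /andP[c0 c1] [h1 h2 h3].
have p : 0 < 2 - 2 * c by lra.
have E X : (1 + c) / (1 - c) * X = (X + X + 2 * c * X) / (2 - 2 * c).
  by field; lra.
have aux (x y z X : R) : `|x| <= X -> `|y| <= X -> `|z| <= X ->
    `|(x + y - 2 * c * z) / (2 - 2 * c)| <= (1 + c) / (1 - c) * X.
  move=> hx hy hz; rewrite E normrM [X in _ * X]gtr0_norm ?invr_gt0//.
  rewrite ler_wpM2r ?invr_ge0 ?(ltW p)//.
  apply: le_trans (ler_normB _ _) _; apply: lerD.
    by apply: le_trans (ler_normD _ _) _; exact: lerD.
  by rewrite normrM ger0_norm ?ler_wpM2l// mulr_ge0.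
split.
- by move=> t; apply: aux.
- move=> s t; rewrite -mulrA /kill -mulrBl.
  rewrite (_ : _ - _ = (q (s + d) - q (t + d)) + (q (s - d) - q (t - d)) -
    2 * c * (q s - q t)); last by ring.
  have e1 : s + d - (t + d) = s - t by ring.
  have e2 : s - d - (t - d) = s - t by ring.
  by apply: aux; [rewrite -e1|rewrite -e2|]; exact: h2.
- move=> t ht; rewrite /kill !h3 ?mulr0 ?addr0 ?subrr ?mul0r//; lra.
Qed.

Lemma kill_close M K a b d c q t : 0 <= d -> 0 <= c < 1 -> profile M K a b q ->
  `|kill d c q t - q t| <= d * K / (1 - c).
Proof.
move=> d0 /andP[c0 c1] [h1 h2 h3].
have p : 0 < 2 - 2 * c by lra.
rewrite /kill (_ : _ - _ = ((q (t + d) - q t) - (q t - q (t - d))) / (2 - 2 * c)); last first.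
  by field; lra.
rewrite (_ : d * K / (1 - c) = (K * d + K * d) / (2 - 2 * c)); last by field; lra.
rewrite normrM [X in _ * X]gtr0_norm ?invr_gt0// ler_wpM2r ?invr_ge0 ?(ltW p)//.
apply: le_trans (ler_normB _ _) _; apply: lerD.
  by apply: le_trans (h2 _ _) _; rewrite addrAC subrr add0r ger0_norm.
by apply: le_trans (h2 _ _) _; rewrite opprB addrC subrK ger0_norm.
Qed.

Lemma continuous_lip K q : (forall s t, `|q s - q t| <= K * `|s - t|) -> continuous q.
Proof.
move=> h t; apply/cvgrPdist_le => e e0.
have K1 : 0 < `|K| + 1 by rewrite ltr_wpDl.
have r0 : 0 < e / (`|K| + 1) by rewrite divr_gt0.
have /cvgrPdist_le/(_ _ r0) : (fun x : R => x) x @[x --> t] --> t by exact: cvg_id.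
apply: filterS => s hs.
apply: le_trans (h _ _) _.
apply: (@le_trans _ _ ((`|K| + 1) * `|t - s|)).
  by rewrite ler_wpM2r// (le_trans (ler_norm K))// lerDl.
by rewrite mulrC -ler_pdivlMr.
Qed.

Lemma measurable_profile M K a b q : profile M K a b q ->
  measurable_fun [set: measurableTypeR R] q.
Proof. by move=> [_ h _]; apply: continuous_measurable_fun; exact: continuous_lip h. Qed.

Definition weight (w : R -> R) := continuous w /\ forall t, `|w t| <= 1.

Lemma integrable_profile M K a b q (w : R -> R) : profile M K a b q -> weight w ->
  mu.-integrable setT (EFin \o (fun t => q t * w t)).
Proof.
move=> pq [cw bw]; have mq := measurable_profile pq; have [h1 _ h3] := pq.
pose I : set (measurableTypeR R) := `[a, b]%classic.
have mI : measurable I by exact: measurable_itv.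
have mI_lty : (mu I < +oo)%E.
  by rewrite lebesgue_measure_itv /=; case: ifP; rewrite ?ltry.
have cI : mu.-integrable I (EFin \o cst M).
  by apply: measurable_bounded_integrable => //; exact: bounded_cst.
have cI' : mu.-integrable setT ((EFin \o cst M) \_ I).
  by apply/integrable_restrict => //; rewrite setTI.
apply: le_integrable cI' => //.
  apply/measurable_EFinP; apply: measurable_funM => //.
  exact: continuous_measurable_fun.
move=> t _ /=; rewrite patchE; case: ifPn => tI.
  rewrite !lee_fin normrM -[X in _ <= X]mulr1.
  have M0 : 0 <= M by case: (profile_ge0 pq).
  by rewrite /= (ger0_norm M0) ler_pM.
rewrite h3 ?mul0r ?normr0 ?lee_fin//.
move: tI; rewrite notin_setE /I /= in_itv /= => /negP; rewrite negb_and -!ltNge => /orP[]; by [left|right].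
Qed.

(** The weights used below are [cos (e t + f)]: the phases [f = 0] and
    [f = - pi / 2] give the real and imaginary parts of the Fourier transform of
    [q] at [e]. *)
Definition moment q (w : R -> R) := \int[mu]_t (q t * w t).

Lemma weight_cos (e f : R) : weight (fun t => cos (e * t + f)).
Proof.
split; first exact: continuous_cos_affine.
by move=> t; rewrite ler_norml cos_geN1 cos_le1.
Qed.

Lemma moment_transl M K a b q d e f : profile M K a b q ->
  moment (fun t => q (t + d)) (fun t => cos (e * t + f)) =
  moment q (fun t => cos (e * t + (f - e * d))).
Proof.
move=> pq; have [cw bw] := weight_cos e (f - e * d).
have pq' : profile M K (a - d) (b - d) (fun t => q (t + d)).
  have [h1 h2 h3] := pq; split => //.
  - by move=> s t; apply: le_trans (h2 _ _) _; rewrite opprD addrACA subrr addr0.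
  - by move=> t ht; apply: h3; lra.
have E t : q (t + d) * cos (e * t + f) =
    (fun t => q t * cos (e * t + (f - e * d))) (t + d).
  by congr (_ * cos _); ring.
rewrite /moment; under eq_Rintegral do rewrite E.
rewrite (Rintegral_transl (f := fun t => q t * cos (e * t + (f - e * d))))//.
- apply: measurable_funM; first exact: measurable_profile pq.
  exact: continuous_measurable_fun.
- under eq_fun do rewrite -E; exact: integrable_profile pq' (weight_cos _ _).
Qed.

(** The translations by [d] and [- d] shift the phase by [- e d] and [e d], and
    the addition formula for the cosine does the rest. *)
Lemma moment_kill M K a b d c q e f : 0 <= c < 1 -> profile M K a b q ->
  moment (kill d c q) (fun t => cos (e * t + f)) =
  (cos (e * d) - c) / (1 - c) * moment q (fun t => cos (e * t + f)).
Proof.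
move=> /andP[c0 c1] pq.
have [h1 h2 h3] := pq.
have shift s : profile M K (a - s) (b - s) (fun t => q (t + s)).
  split => //.
  - by move=> x t; apply: le_trans (h2 _ _) _; rewrite opprD addrACA subrr addr0.
  - by move=> t ht; apply: h3; lra.
have wc := weight_cos e f.
have E t : kill d c q t * cos (e * t + f) = (2 - 2 * c)^-1 * ((q (t + d) * cos (e * t + f) +
    q (t - d) * cos (e * t + f)) + (- (2 * c)) * (q t * cos (e * t + f))).
  by rewrite /kill; ring.
have i1 := integrable_profile (shift d) wc.
have i2 := integrable_profile (shift (- d)) wc.
have i3 := integrable_profile pq wc.
have i12 := integrable_EFinD measurableT i1 i2.
have i4 := integrable_EFinZ measurableT (- (2 * c)) i3.
rewrite /moment; under eq_Rintegral do rewrite E.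
rewrite RintegralZl ?RintegralD ?RintegralZl//; last exact: integrable_EFinD.
rewrite -/(moment (fun t => q (t + d)) _) -/(moment (fun t => q (t - d)) _) !(moment_transl _ _ _ pq).
have F : moment q (fun t => cos (e * t + (f - e * d))) +
    moment q (fun t => cos (e * t + (f - e * - d))) =
    2 * cos (e * d) * moment q (fun t => cos (e * t + f)).
  have w s := integrable_profile pq (weight_cos e s).
  rewrite /moment -RintegralD// -RintegralZl//.
  apply: Rintegral_eq => t; rewrite mulrN opprK !addrA (cosB (e * t + f)) (cosD (e * t + f)); ring.
rewrite F /moment; field; lra.
Qed.

End kill_frequency.

Section profile_limit.
Context {R : realType}.
Notation mu := (@lebesgue_measure R).
Variables (q0 : R -> R) (M K a b : R) (pq0 : profile M K a b q0).
Variables (d c : nat -> R) (cs P S : R).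
Hypothesis d_ge0 : forall j, 0 <= d j.
Hypothesis c_itv : forall j, 0 <= c j <= cs.
Hypothesis cs1 : cs < 1.
Hypothesis Pbound : forall j, \prod_(i < j) ((1 + c i) / (1 - c i)) <= P.
Hypothesis Sbound : forall j, \sum_(i < j) d i <= S.

Fixpoint killseq j : R -> R :=
  if j is i.+1 then kill (d i) (c i) (killseq i) else q0.

Lemma profile_le (M' K' a' b' : R) M1 K1 a1 b1 (q : R -> R) :
  M1 <= M' -> K1 <= K' -> a' <= a1 -> b1 <= b' ->
  profile M1 K1 a1 b1 q -> profile M' K' a' b' q.
Proof.
move=> hM hK ha hb [h1 h2 h3]; split.
- by move=> t; exact: le_trans (h1 t) hM.
- by move=> s t; apply: le_trans (h2 s t) _; rewrite ler_wpM2r.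
- by move=> t [ht|ht]; apply: h3; [left|right]; lra.
Qed.

Let c01 j : 0 <= c j < 1.
Proof. by case/andP: (c_itv j) => -> h; exact: le_lt_trans h cs1. Qed.

Lemma profile_killseq j : profile (P * M) (P * K) (a - S) (b + S) (killseq j).
Proof.
have [M0 K0] := profile_ge0 pq0.
have H : profile (\prod_(i < j) ((1 + c i) / (1 - c i)) * M)
    (\prod_(i < j) ((1 + c i) / (1 - c i)) * K)
    (a - \sum_(i < j) d i) (b + \sum_(i < j) d i) (killseq j).
  elim: j => [|j IH]; first by rewrite !big_ord0 !mul1r subr0 addr0.
  rewrite !big_ord_recr /= opprD !addrA ![_ * ((1 + c j) / _)]mulrC -!mulrA.
  by rewrite !(mulrA (1 + c j)); apply: profile_kill.
apply: profile_le H; rewrite ?ler_wpM2r// ?lerB ?lerD//.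
Qed.

Let L := P * K / (1 - cs).

Lemma killseq_step j t : `|killseq j.+1 t - killseq j t| <= d j * L.
Proof.
apply: le_trans (kill_close t (d_ge0 j) (c01 j) (profile_killseq j)) _.
have [_ PK] := profile_ge0 (profile_killseq j).
have /andP[c0 ccs] := c_itv j.
rewrite -mulrA ler_wpM2l// /L ler_wpM2l// lef_pV2 ?posrE ?subr_gt0//.
- by rewrite lerD2l lerN2.
- exact: le_lt_trans ccs cs1.
Qed.

Lemma cvg_killseq t : cvgn (fun j => killseq j t).
Proof.
have cd : cvgn (series (fun j => d j * L)).
  apply: nondecreasing_is_cvgn.
    apply/nondecreasing_seqP => n; rewrite /series /= big_nat_recr//= lerDl mulr_ge0//.
    have [_ PK] := profile_ge0 (profile_killseq 0).
    by rewrite divr_ge0// subr_ge0 ltW.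
  exists (S * L) => _ [n _ <-]; rewrite /series /= -mulr_suml big_mkord.
  have [_ PK] := profile_ge0 (profile_killseq 0).
  by rewrite ler_wpM2r// divr_ge0// subr_ge0 ltW.
have cs' : cvgn (series (fun j => killseq j.+1 t - killseq j t)).
  apply: normed_cvg; apply: series_le_cvg cd => j //=.
  - by apply: le_trans (normr_ge0 _) (killseq_step j t).
  - exact: killseq_step.
have -> : (fun j => killseq j t) =
    (fun n => killseq 0 t + series (fun k => killseq k.+1 t - killseq k t) n).
  by apply/funext => n; rewrite /series /= telescope_sumr// addrC subrK.
by apply: is_cvgD => //; exact: is_cvg_cst.
Qed.

Definition limkill t := limn (fun j => killseq j t).

Lemma limkillP t : killseq j t @[j --> \oo] --> limkill t.
Proof. exact: cvg_killseq. Qed.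

Lemma profile_limkill : profile (P * M) (P * K) (a - S) (b + S) limkill.
Proof.
split.
- move=> t; apply: (cvgr_to_le (cvg_norm (@limkillP t))); apply: nearW => j.
  by have [h _ _] := profile_killseq j.
- move=> s t; apply: (cvgr_to_le (cvg_norm (cvgB (@limkillP s) (@limkillP t)))).
  by apply: nearW => j; have [_ h _] := profile_killseq j; exact: (h s t).
- move=> t ht; rewrite /limkill (_ : (fun j => _) = fun=> 0) ?lim_cst//.
  by apply/funext => j; have [_ _ ->] := profile_killseq j.
Qed.

Lemma cvg_moment (w : R -> R) : weight w ->
  moment (killseq j) w @[j --> \oo] --> moment limkill w.
Proof.
move=> ww; have [cw bw] := ww.
pose I : set (measurableTypeR R) := `[a - S, b + S]%classic.
have mI : measurable I by exact: measurable_itv.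
have mI_lty : (mu I < +oo)%E.
  by rewrite lebesgue_measure_itv /=; case: ifP; rewrite ?ltry.
have cI : mu.-integrable I (EFin \o cst (P * M)).
  by apply: measurable_bounded_integrable => //; exact: bounded_cst.
have cI' : mu.-integrable setT ((EFin \o cst (P * M)) \_ I).
  by apply/integrable_restrict => //; rewrite setTI.
have i1 j := integrable_profile (profile_killseq j) ww.
have i2 := integrable_profile profile_limkill ww.
have [_ _ h] : [/\ mu.-integrable setT (fun t => (limkill t * w t)%:E),
    (\int[mu]_t `|(killseq j t * w t)%:E - (limkill t * w t)%:E|)%E @[j --> \oo] --> 0%E &
    (\int[mu]_t (killseq j t * w t)%:E)%E @[j --> \oo] -->
      (\int[mu]_t (limkill t * w t)%:E)%E].
  apply: (@dominated_convergence _ _ _ mu setT measurableT _ _ ((EFin \o cst (P * M)) \_ I)) => //.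
  - by move=> j; exact: measurable_int (i1 j).
  - exact: measurable_int i2.
  - apply: aeW => t _; apply: cvg_EFin; first exact: nearW.
    by apply: cvgM; [exact: limkillP|exact: cvg_cst].
  - apply: aeW => t j _; rewrite /= patchE; have [h1 _ h3] := profile_killseq j.
    case: ifPn => tI.
      by rewrite lee_fin normrM -[X in _ <= X]mulr1 ler_pM.
    rewrite h3 ?mul0r ?normr0//.
    move: tI; rewrite notin_setE /I /= in_itv /= => /negP; rewrite negb_and -!ltNge => /orP[]; by [left|right].
rewrite /moment /Rintegral; apply: fine_cvg; rewrite fineK//.
exact: integrable_fin_num i2.
Qed.

(** Once killed, a frequency stays killed, since each further step multiplies its
    moments by a constant. *)
Lemma moment_limkill_eq0 e f : (exists j, cos (e * d j) = c j) ->
  moment limkill (fun t => cos (e * t + f)) = 0.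
Proof.
move=> [j0 ec]; have w := weight_cos e f.
have H j : moment (killseq (j + j0.+1)) (fun t => cos (e * t + f)) = 0.
  elim: j => [|j IH]; rewrite ?addSn /= (moment_kill _ _ _ (c01 _) (profile_killseq _)).
    by rewrite ec subrr !mul0r.
  by rewrite IH mulr0.
have := cvg_moment w; rewrite -(cvg_shiftn j0.+1) /= (funext H) => h.
by rewrite -(cvg_lim _ h)// lim_cst.
Qed.

Lemma moment_limkill_mass : moment limkill (fun t => cos (0 * t + 0)) =
  moment q0 (fun t => cos (0 * t + 0)).
Proof.
have H j : moment (killseq j) (fun t => cos (0 * t + 0)) =
    moment q0 (fun t => cos (0 * t + 0)).
  elim: j => [//|j IH] /=; rewrite (moment_kill _ _ _ (c01 _) (profile_killseq _)) IH.
  have /andP[_ c1] := c01 j.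
  by rewrite mul0r cos0 divff ?mul1r// subr_eq0 gt_eqF.
have := cvg_moment (weight_cos 0 0); rewrite (funext H) => h.
by rewrite -(cvg_lim _ h)// lim_cst.
Qed.

End profile_limit.

Section hat_function.
Context {R : realType}.
Notation mu := (@lebesgue_measure R).

Lemma unit_tent (x0 w : R) : 0 < w -> exists q M K,
  profile M K (x0 - w) (x0 + w) q /\ moment q (fun t => cos (0 * t + 0)) = 1.
Proof.
move=> w0; pose h (t : R) := Num.max 0 (w - `|t - x0|).
have ph : profile w 1 (x0 - w) (x0 + w) h.
  split.
  - move=> t; have := normr_ge0 (t - x0); rewrite /h => n0.
    rewrite ger0_norm; last by rewrite le_max lexx.
    by rewrite ge_max; apply/andP; split; lra.
  - move=> s t; rewrite /h mul1r.
    have n1 : `|s - x0| <= `|t - x0| + `|s - t|.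
      by rewrite (_ : s - x0 = (t - x0) + (s - t)) ?ler_normD//; ring.
    have n2 : `|t - x0| <= `|s - x0| + `|s - t|.
      by rewrite (_ : t - x0 = (s - x0) - (s - t)) ?ler_normB//; ring.
    rewrite ler_norml; have n3 := normr_ge0 (s - t).
    by case: (leP 0 (w - `|s - x0|)) => a; case: (leP 0 (w - `|t - x0|)) => b;
      apply/andP; split; lra.
  - move=> t ht; rewrite /h; apply/max_idPl.
    have := ler_norm (t - x0); have := ler_norm (- (t - x0)); rewrite normrN; lra.
have cw := weight_cos (R := R) 0 0.
have hi := integrable_profile ph cw.
have c1 t : cos (0 * t + 0) = 1 :> R by rewrite mul0r addr0 cos0.
pose I := moment h (fun t => cos (0 * t + 0)).
have Ipos : 0 < I.
  pose J : set (measurableTypeR R) := `[x0 - w / 2, x0 + w / 2]%classic.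
  have mJ : measurable J by exact: measurable_itv.
  have hJ : mu.-integrable J (EFin \o (fun t => h t * cos (0 * t + 0))).
    by apply: integrableS hi.
  have muJ : mu J = w%:E.
    by rewrite lebesgue_measure_itv /= lte_fin ifT ?EFinB -?EFinD; [congr EFin; lra|lra].
  have muJlt : (mu J < +oo)%E by rewrite muJ ltry.
  have JI : \int[mu]_(t in J) (h t * cos (0 * t + 0)) <= I.
    rewrite /I /moment [X in X <= _]Rintegral_mkcond; apply: le_Rintegral => //.
      by rewrite -restrict_EFin; apply/integrable_restrict => //; rewrite setTI.
    move=> t _; rewrite patchE; case: ifPn => // _.
    by rewrite c1 mulr1 /h le_max lexx.
  apply: lt_le_trans JI.
  apply: (@lt_le_trans _ _ (\int[mu]_(t in J) (w / 2))).
    by rewrite Rintegral_cst// -[fine _]/(fine (mu J)) muJ /= mulr_gt0// divr_gt0.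
  apply: le_Rintegral => //.
    apply: measurable_bounded_integrable => //; exact: bounded_cst.
  move=> t; rewrite /J /= in_itv /= => /andP[t1 t2].
  rewrite c1 mulr1 /h le_max; apply/orP; right.
  have : `|t - x0| <= w / 2 by rewrite ler_norml; lra.
  lra.
exists (fun t => I^-1 * h t), (I^-1 * w), (I^-1 * 1); split.
  have [h1 h2 h3] := ph.
  have I0 : 0 <= I^-1 by rewrite invr_ge0 ltW.
  split.
  - by move=> t; rewrite normrM ger0_norm// ler_wpM2l.
  - by move=> s t; rewrite -mulrBr normrM ger0_norm// -mulrA ler_wpM2l.
  - by move=> t /h3 ->; rewrite mulr0.
rewrite /moment.
rewrite (@Rintegral_eq _ setT _ (fun t => I^-1 * (h t * cos (0 * t + 0)))); last first.
  by move=> t; rewrite mulrA.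
by rewrite RintegralZl// -/(moment h _) mulVf// gt_eqF.
Qed.

End hat_function.

Section distance_sums.
Context {R : realType}.

(** The distance of two natural numbers: one of the truncated differences is 0. *)
Definition ndist (i k : nat) := ((i - k) + (k - i))%N.

Lemma ndistC i k : ndist i k = ndist k i. Proof. exact: addnC. Qed.

(** Each distance to [k] is attained at most twice, below and above [k]. *)
Lemma sum_ndist (w : nat -> R) (B : R) (m k : nat) : (forall d, 0 <= w d) ->
  (forall N, \sum_(d < N) w d <= B) -> \sum_(i < m) w (ndist i k) <= 2 * B.
Proof.
move=> w0 wB.
have below N : (N <= k)%N -> \sum_(i < N) w (ndist i k) + \sum_(d < k.+1 - N) w d
    = \sum_(d < k.+1) w d.
  elim: N => [|N IH] Nk; first by rewrite big_ord0 add0r subn0.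
  rewrite big_ord_recr /= -(IH (ltnW Nk)) -addrA; congr (_ + _).
  rewrite subSS [in RHS]subSn ?(ltnW Nk)// big_ord_recr /= addrC; congr (_ + w _).
  by rewrite /ndist; lia.
have above p : \sum_(i < k + p) w (ndist i k) <= \sum_(d < k.+1) w d + \sum_(d < p) w d.
  elim: p => [|p IH].
    rewrite addn0 big_ord0 addr0 -(below k)// lerDl; exact: sumr_ge0.
  have -> : (k + p.+1 = (k + p).+1)%N by lia.
  rewrite big_ord_recr [X in _ + X]big_ord_recr addrA; apply: lerD => //.
  by rewrite /= (_ : ndist (k + p) k = p)// /ndist; lia.
have B2 : 2 * B = B + B by ring.
have [mk|km] := leqP m k.
  apply: (@le_trans _ _ (\sum_(d < k.+1) w d)).
    by rewrite -(below m mk) lerDl; exact: sumr_ge0.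
  have B0 : 0 <= B by have := wB 0%N; rewrite big_ord0.
  by rewrite B2; apply: le_trans (wB _) _; rewrite lerDl.
rewrite -(subnKC (ltnW km)); apply: le_trans (above _) _.
by rewrite B2 lerD.
Qed.

(** Makes the series of the [d ^ (-3 / 2)] telescope. *)
Lemma inv_sqrt_step (d : nat) : (0 < d)%N ->
  (d.+1%:R * Num.sqrt d.+1%:R)^-1 <= 2 * ((Num.sqrt d%:R)^-1 - (Num.sqrt d.+1%:R)^-1) :> R.
Proof.
move=> d0; set y := Num.sqrt d%:R; set z := Num.sqrt d.+1%:R.
have y0 : 0 < y by rewrite sqrtr_gt0 ltr0n.
have z0 : 0 < z by rewrite sqrtr_gt0 ltr0n.
have y2 : y ^+ 2 = d%:R by rewrite sqr_sqrtr.
have z2 : z ^+ 2 = d.+1%:R by rewrite sqr_sqrtr.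
have yz : y <= z by rewrite ler_wsqrtr// ler_nat.
have zy : (z - y) * (z + y) = 1 by rewrite -subr_sqr y2 z2 -natr1; ring.
rewrite -z2 -subr_ge0.
have -> : 2 * (y^-1 - z^-1) - (z ^+ 2 * z)^-1 =
    (2 * (z - y) * z ^+ 2 - y) / (y * z ^+ 3) by field; rewrite !gt_eqF.
rewrite divr_ge0 ?mulr_ge0 ?exprn_ge0 ?(ltW y0) ?(ltW z0)// subr_ge0.
have : (z + y) * y <= 2 * z ^+ 2 by nra.
have zy1 : 0 <= z - y by rewrite subr_ge0.
move=> h; have := ler_wpM2l zy1 h; rewrite mulrA zy mul1r => h'.
by apply: le_trans h' _; rewrite mulrCA mulrA.
Qed.

Lemma sum_inv32_tail (e C : R) (J N : nat) : 0 <= e -> 0 <= C -> (0 < J)%N ->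
  \sum_(d < N) (if (d <= J)%N then e else C * (d%:R * Num.sqrt d%:R)^-1) <=
  J.+1%:R * e + 2 * C * (Num.sqrt J%:R)^-1.
Proof.
move=> e0 C0 J0; pose w (d : nat) := if (d <= J)%N then e else C * (d%:R * Num.sqrt d%:R)^-1.
rewrite -/(\sum_(d < N) w d).
have w0 d : 0 <= w d.
  by rewrite /w; case: ifP => // _; rewrite mulr_ge0 ?invr_ge0 ?mulr_ge0 ?sqrtr_ge0.
have low M : (M <= J.+1)%N -> \sum_(d < M) w d = M%:R * e.
  elim: M => [|M IH] MJ; first by rewrite big_ord0 mul0r.
  rewrite big_ord_recr /= (IH (ltnW MJ)) /w -ltnS MJ.
  by rewrite -natr1 mulrDl mul1r.
have s0 (x : nat) : 0 <= (Num.sqrt x%:R)^-1 :> R by rewrite invr_ge0 sqrtr_ge0.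
have high p : \sum_(d < J.+1 + p) w d <=
    J.+1%:R * e + 2 * C * ((Num.sqrt J%:R)^-1 - (Num.sqrt (J + p)%:R)^-1).
  elim: p => [|p IH]; first by rewrite !addn0 low// subrr mulr0 addr0.
  rewrite addnS big_ord_recr /=.
  have wE : w (J.+1 + p)%N = C * ((J + p).+1%:R * Num.sqrt (J + p).+1%:R)^-1.
    by rewrite /w addSn ltnNge leq_addr.
  have := @inv_sqrt_step (J + p) (ltn_addr _ J0).
  move=> /(ler_wpM2l C0); rewrite -wE -addnS => h.
  by apply: le_trans (lerD IH h) _; lra.
have [NJ|JN] := leqP N J.+1.
  rewrite low// -[X in X <= _]addr0 lerD// ?ler_wpM2r ?ler_nat//.
  by rewrite mulr_ge0// mulr_ge0.
rewrite -(subnKC (ltnW JN)); apply: le_trans (high _) _.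
by rewrite lerD2l ler_wpM2l ?mulr_ge0// lerBlDr lerDl.
Qed.

End distance_sums.

Section biorthogonal_profiles.
Context {R : realType}.

Lemma eq_ler (x y : R) : x = y -> x <= y. Proof. by move=> ->. Qed.

Lemma count_le_ord (N J : nat) : (\sum_(d < N) (d <= J)%N <= J.+1)%N.
Proof.
suff -> : (\sum_(d < N) (d <= J)%N = minn N J.+1)%N by exact: geq_minr.
elim: N => [|N IH]; first by rewrite big_ord0 min0n.
by rewrite big_ord_recr /= IH; case: leqP => h /=; lia.
Qed.

(** The profile of index [k] is obtained from a tent function by an infinite
    convolution killing the frequencies [lam n - lam k] one after the other.
    Where [n] is far from [k], the translation [pi / (2 |lam n - lam k|)] is an
    average and costs nothing; the finitely many others use a translation by at
    most [e], at a cost depending on [e] and the gap only. The gap makes the sum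
    of all translations as small as desired. *)
Theorem biorthogonal_profiles (lam : nat -> R) (g T : R) : 0 < g -> 0 < T ->
  (forall n k, n != k ->
    g * ((ndist n k)%:R * Num.sqrt (ndist n k)%:R) <= `|lam n - lam k|) ->
  exists (q : nat -> R -> R) (C : R), forall k,
    [/\ continuous (q k), forall t, `|q k t| <= C,
      forall t, t <= 0 \/ T <= t -> q k t = 0 &
      forall n f, moment (q k) (fun t => cos ((lam n - lam k) * t + f)) =
        (n == k)%:R * cos f].
Proof.
move=> g0 T0 gap.
have pi0 := pi_gt0 R.
pose C1 := pi / (2 * g).
have C10 : 0 < C1 by rewrite divr_gt0 ?mulr_gt0.
(* J is so large that the translations at distance more than J add up to at
   most T / 16 on each side of k. *)
have [J J0 HJ] : exists2 J : nat, (0 < J)%N & 2 * C1 * (Num.sqrt J%:R)^-1 <= T / 16.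
  pose X := 32 * C1 / T.
  have X0 : 0 < X by rewrite divr_gt0// mulr_gt0.
  exists (Num.truncn (X ^+ 2)).+1 => //.
  have h : X <= Num.sqrt (Num.truncn (X ^+ 2)).+1%:R.
    rewrite -[X in X <= _](ger0_norm (ltW X0)) -sqrtr_sqr ler_wsqrtr// ltW//.
    exact: truncnS_gt.
  have s0 : 0 < Num.sqrt (Num.truncn (X ^+ 2)).+1%:R :> R by apply: lt_le_trans h.
  rewrite ler_pdivrMr//; apply: le_trans (ler_wpM2l _ h); last by lra.
  by rewrite /X; apply: eq_ler; field; lra.
(* The bound on e * J.+1 makes the near translations add up to at most T / 16 on
   each side of k, the other bound keeps e * g in [0, pi / 2]. *)
pose e := Num.min (T / (16 * J.+1%:R)) (pi / (2 * g)).
have e0 : 0 < e by rewrite lt_min !divr_gt0 ?mulr_gt0.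
have eJ : J.+1%:R * e <= T / 16.
  apply: (@le_trans _ _ (J.+1%:R * (T / (16 * J.+1%:R)))).
    by rewrite ler_wpM2l// ge_min lexx.
  by apply: eq_ler; field; rewrite gt_eqF ?ltr0n.
have eg : e * g <= pi / 2.
  apply: (@le_trans _ _ (pi / (2 * g) * g)).
    by rewrite ler_wpM2r ?(ltW g0)// ge_min lexx orbT.
  by apply: eq_ler; field; rewrite gt_eqF.
have eg0 : 0 < e * g by rewrite mulr_gt0.
(* The largest parameter c at which a near frequency is killed: the product of
   the translation and of the frequency is at least e * g. *)
pose cs := cos (e * g).
have cs0 : 0 <= cs by rewrite cos_ge0_pihalf//; apply/andP; split; lra.
have cs1 : cs < 1.
  have := @ltr_cos R 0 (e * g); rewrite cos0 => ->//; rewrite in_itv /=; apply/andP; split; lra.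
pose ks := (1 + cs) / (1 - cs).
have ks1 : 1 <= ks by rewrite /ks ler_pdivlMr; lra.
pose P := ks ^+ (2 * J.+1).
(* The starting profile is supported in [3 T / 8, 5 T / 8], and the translations
   add up to at most T / 4. *)
have [q0 [M [K [pq0 q01]]]] := unit_tent (T / 2) (divr_gt0 T0 (ltr0n R 8)).
have Q k : exists q : R -> R, [/\ continuous q, forall t, `|q t| <= P * M,
      forall t, t <= 0 \/ T <= t -> q t = 0 &
      forall n f, moment q (fun t => cos ((lam n - lam k) * t + f)) =
        (n == k)%:R * cos f].
  pose eta n := `|lam n - lam k|.
  have nd n : n != k -> (0 < ndist n k)%N by rewrite /ndist addn_gt0 !subn_gt0 neq_ltn orbC.
  have eta_gap n : n != k -> g <= eta n.
    move=> nk; apply: le_trans (gap n k nk); rewrite ler_peMr ?(ltW g0)//.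
    have h1 : 1 <= (ndist n k)%:R :> R by rewrite ler1n nd.
    apply: (le_trans h1); rewrite ler_peMr//.
    by rewrite -[X in X <= _]sqrtr1 ler_wsqrtr.
  have eta0 n : n != k -> 0 < eta n by move=> /eta_gap; exact: lt_le_trans.
  (* A frequency eta is killed with c = 0 by the translation pi / (2 eta); a
     smaller translation d kills it with c = cos (eta d) > 0. The index k takes
     the trivial values d = c = 0, for which [kill] is the identity. *)
  pose d n := if n == k then 0 else
    if (ndist n k <= J)%N then Num.min e (pi / (2 * eta n)) else pi / (2 * eta n).
  pose c n := if n == k then 0 else cos (eta n * d n).
  have dE n : n != k -> eta n * (pi / (2 * eta n)) = pi / 2.
    by move=> /eta0 h; field; rewrite gt_eqF.
  have d0 n : 0 <= d n.
    rewrite /d; case: eqVneq => // /eta0 h.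
    have h' : 0 <= pi / (2 * eta n) by rewrite divr_ge0 ?mulr_ge0 ?(ltW h)// ltW.
    by case: ifP => // _; rewrite le_min (ltW e0).
  have c_itv n : 0 <= c n <= cs.
    rewrite /c /d; case: (eqVneq n k) => [_|nk]; first by rewrite lexx.
    case: ifP => [_|_]; last by rewrite dE// cos_pihalf lexx.
    have hn := eta0 n nk; have hg := eta_gap n nk.
    have b1 : e * g <= eta n * Num.min e (pi / (2 * eta n)).
      rewrite minEle; case: ifP => _; last by rewrite dE.
      by rewrite mulrC ler_wpM2r// ltW.
    have b2 : eta n * Num.min e (pi / (2 * eta n)) <= pi / 2.
      by rewrite -(dE n nk) ler_wpM2l ?(ltW hn)// ge_min lexx orbT.
    apply/andP; split; first by apply: cos_ge0_pihalf; apply/andP; split; lra.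
    move: b1; rewrite le_eqVlt => /predU1P[<-//|b1].
    apply/ltW; have := @ltr_cos R (e * g) (eta n * Num.min e (pi / (2 * eta n))).
    by move=> ->//; rewrite in_itv /=; apply/andP; split; lra.
  have c_far n : (J < ndist n k)%N -> c n = 0.
    rewrite /c /d ltnNge => /negbTE ->; case: eqVneq => // nk.
    by rewrite dE// cos_pihalf.
  have Pb j : \prod_(i < j) ((1 + c i) / (1 - c i)) <= P.
    apply: (@le_trans _ _ (\prod_(i < j) ks ^+ (ndist i k <= J)%N)).
      apply: ler_prod => i _; have /andP[h1 h2] := c_itv i.
      have h3 : 0 < 1 - c i by lra.
      rewrite divr_ge0 ?(ltW h3) ?addr_ge0//=.
      case: leqP => [_|/c_far ->]; last by rewrite addr0 subr0 divr1 expr0.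
      rewrite expr1 /ks; apply: ler_pM; rewrite ?invr_ge0 ?(ltW h3) ?addr_ge0//.
        by rewrite lerD2l.
      by rewrite lef_pV2 ?posrE ?subr_gt0 ?lerD2l ?lerN2//; lra.
    rewrite prodrXr ler_weXn2l// -(ler_nat R) natr_sum natrM.
    apply: (@sum_ndist _ (fun d => (d <= J)%N%:R)) => // N.
    by rewrite -natr_sum ler_nat count_le_ord.
  have Sb j : \sum_(i < j) d i <= T / 4.
    pose w (m : nat) := if (m <= J)%N then e else C1 * (m%:R * Num.sqrt m%:R)^-1.
    have w0 m : 0 <= w m.
      rewrite /w; case: ifP => _; first exact: ltW.
      by rewrite mulr_ge0 ?(ltW C10)// invr_ge0 mulr_ge0 ?sqrtr_ge0.
    apply: (@le_trans _ _ (\sum_(i < j) w (ndist i k))).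
      apply: ler_sum => i _; rewrite /d; case: eqVneq => // nk.
      rewrite /w; case: leqP => hJ; first by rewrite ge_min lexx.
      have m0 : 0 < (ndist i k)%:R * Num.sqrt (ndist i k)%:R :> R.
        by rewrite mulr_gt0 ?sqrtr_gt0 ?ltr0n ?nd.
      rewrite /C1 -mulrA -invfM ler_wpM2l ?(ltW pi0)//.
      have e2 : 0 < 2 * eta i by rewrite mulr_gt0 ?(eta0 _ nk).
      have g2 : 0 < 2 * g by rewrite mulr_gt0.
      rewrite lef_pV2 ?posrE//; last exact: mulr_gt0.
      by rewrite -mulrA ler_wpM2l//; exact: gap.
    have B16 : 2 * (J.+1%:R * e + 2 * C1 * (Num.sqrt J%:R)^-1) <= T / 4 by lra.
    apply: le_trans B16.
    apply: sum_ndist => // N; exact: sum_inv32_tail (ltW e0) (ltW C10) J0.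
  have pl := profile_limkill pq0 d0 c_itv cs1 Pb Sb.
  have [l1 l2 l3] := pl.
  exists (limkill q0 d c); split => //.
  - exact: continuous_lip l2.
  - by move=> t ht; apply: l3; lra.
  move=> n f; case: (eqVneq n k) => [->|nk].
    rewrite subrr mul1r.
    rewrite /moment (@Rintegral_eq _ setT _ (fun t => cos f * (limkill q0 d c t * cos (0 * t + 0)))).
      rewrite RintegralZl//; last exact: integrable_profile pl (weight_cos _ _).
      by rewrite -/(moment _ _) (moment_limkill_mass pq0 d0 c_itv cs1 Pb Sb) q01 mulr1.
    by move=> t; rewrite !mul0r !add0r cos0 mulr1 mulrC.
  rewrite mul0r; apply: (moment_limkill_eq0 pq0 d0 c_itv cs1 Pb Sb); exists n.
  rewrite /c (negbTE nk) /eta.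
  by case: (ger0P (lam n - lam k)) => // _; rewrite mulNr cosN.
have [q Hq] := choice Q.
by exists q, (P * M).
Qed.

End biorthogonal_profiles.

(** * The dispersion relation *)

Section dispersion.
Context {R : realType}.
Variables (g b : R).
Hypotheses (g0 : 0 < g) (b0 : 0 < b).

(** In this form [tanh] is visibly increasing and at most 1. *)
Lemma tanhE (x : R) : tanh x = 1 - 2 / (expR (2 * x) + 1).
Proof.
have e0 := expR_gt0 x; have en0 := expR_gt0 (- x).
rewrite (_ : 2 * x = x + x); last by ring.
rewrite expRD /tanh; have E : expR (- x) = (expR x)^-1 by rewrite expRN.
rewrite E; field.
have h := mulr_gt0 e0 e0.
by rewrite !gt_eqF// addr_gt0.
Qed.

Lemma tanh_le (x y : R) : x <= y -> tanh x <= tanh y.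
Proof.
move=> xy; rewrite !tanhE lerD2l lerN2 ler_wpM2l//.
by rewrite lef_pV2 ?posrE ?addr_gt0 ?expR_gt0// lerD2r ler_expR ler_wpM2l.
Qed.

Lemma tanh0 : tanh (0 : R) = 0.
Proof. by rewrite /tanh oppr0 subrr mul0r. Qed.

Lemma tanh_ge0 (x : R) : 0 <= x -> 0 <= tanh x.
Proof. by move=> /tanh_le; rewrite tanh0. Qed.

Lemma tanh_gt0 (x : R) : 0 < x -> 0 < tanh x.
Proof.
move=> x0; apply: divr_gt0; last by rewrite addr_gt0 ?expR_gt0.
by rewrite subr_gt0 ltr_expR; lra.
Qed.

Lemma tanh_le1 (x : R) : tanh x <= 1.
Proof. by rewrite tanhE gerBl divr_ge0// addr_ge0// expR_ge0. Qed.

Lemma ell_abs (n : int) : ell g b n = ell g b `|n|%N.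
Proof.
rewrite /ell; have -> : `|n%:~R| = (`|n|%N)%:~R :> R by rewrite -intr_norm -abszE.
have -> : `|(`|n|%N)%:~R| = (`|n|%N)%:~R :> R by rewrite ger0_norm// ler0z.
by rewrite -[n%:~R ^+ 2]real_normK ?num_real// -intr_norm -abszE.
Qed.

Let lamsq (k : nat) : R := (g + k%:R ^+ 2) * k%:R * tanh (b * k%:R).

Let lamE (k : nat) : ell g b k = Num.sqrt (lamsq k).
Proof. by rewrite /ell (ger0_norm (ler0n R k)). Qed.

Let lamsq_ge0 k : 0 <= lamsq k.
Proof.
rewrite /lamsq mulr_ge0//; last by apply: tanh_ge0; rewrite mulr_ge0 ?(ltW b0).
by rewrite mulr_ge0// addr_ge0 ?sqr_ge0 ?(ltW g0).
Qed.

Lemma lamsq_le k : lamsq k <= (g + k%:R ^+ 2) * k%:R.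
Proof.
rewrite /lamsq ler_piMr ?tanh_le1// mulr_ge0// addr_ge0 ?sqr_ge0 ?(ltW g0)//.
Qed.

(** For [k < n], the difference of the squares of [ell n] and [ell k] is at least
    [n^2 (n - k) tanh b], while their sum is at most a constant times
    [n ^ (3 / 2)]. *)
Lemma ell_gap : exists2 c, 0 < c & forall n k : nat, n != k ->
  c * ((ndist n k)%:R * Num.sqrt (ndist n k)%:R) <= `|ell g b n - ell g b k|.
Proof.
pose t := tanh b; have t0 : 0 < t by exact: tanh_gt0.
pose G := Num.sqrt (g + 1); have G0 : 0 < G by rewrite sqrtr_gt0 addr_gt0.
exists (t / (2 * G)); first by rewrite divr_gt0// mulr_gt0.
suff H (n k : nat) : (k < n)%N ->
    t / (2 * G) * ((ndist n k)%:R * Num.sqrt (ndist n k)%:R) <= ell g b n - ell g b k.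
  move=> n k; rewrite neq_ltn => /orP[nk|kn].
    by rewrite ndistC distrC; apply: le_trans (H _ _ nk) (ler_norm _).
  exact: le_trans (H _ _ kn) (ler_norm _).
move=> kn; have n0 : (0 < n)%N by exact: leq_ltn_trans kn.
have -> : ndist n k = (n - k)%N by rewrite /ndist (eqP (ltnW kn : _ - _ == 0)%N) addn0.
pose s := Num.sqrt n%:R : R.
have s0 : 0 < s by rewrite sqrtr_gt0 ltr0n.
have s2 : s ^+ 2 = n%:R by rewrite sqr_sqrtr.
pose m : R := (n - k)%:R.
have m0 : 0 <= m by exact: ler0n.
have mE : m = n%:R - k%:R by rewrite /m natrB// ltnW.
have sm : Num.sqrt m <= s by rewrite ler_wsqrtr// ler_nat leq_subr.
rewrite -/m.
have n1 : 1 <= n%:R :> R by rewrite ler1n.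
have k0 : 0 <= k%:R :> R by exact: ler0n.
have knR : k%:R <= n%:R :> R by rewrite ler_nat ltnW.
have tn : t <= tanh (b * n%:R) by apply: tanh_le; rewrite ler_peMr// ltW.
have tk : tanh (b * k%:R) <= tanh (b * n%:R) by apply: tanh_le; rewrite ler_wpM2l// ltW.
have tk0 : 0 <= tanh (b * k%:R) by apply: tanh_ge0; rewrite mulr_ge0// ltW.
have D : n%:R ^+ 2 * m * t <= lamsq n - lamsq k.
  rewrite /lamsq; set N : R := n%:R in n1 mE knR tn tk *; set k' : R := k%:R in k0 mE knR tk tk0 *.
  set tn' := tanh (b * N) in tn tk *; set tk' := tanh (b * k') in tk tk0 *.
  have h1 : (g + k' ^+ 2) * k' * tk' <= (g + N ^+ 2) * k' * tn'.
    apply: ler_pM => //; first by rewrite mulr_ge0// addr_ge0 ?sqr_ge0 ?(ltW g0).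
    by rewrite ler_wpM2r// lerD2l ler_sqr ?nnegrE//; lra.
  have h2 : N ^+ 2 * m * t <= (g + N ^+ 2) * m * tn'.
    apply: ler_pM => //; [by rewrite mulr_ge0 ?sqr_ge0|exact: ltW|].
    by rewrite ler_wpM2r// lerDr ltW.
  by apply: le_trans h2 _; rewrite mE; lra.
have L0 (j : nat) : 0 <= ell g b j by exact: sqrtr_ge0.
have L2 (j : nat) : ell g b j ^+ 2 = lamsq j by rewrite lamE sqr_sqrtr.
have Lkn : ell g b k <= ell g b n.
  rewrite !lamE ler_wsqrtr// -subr_ge0; apply: le_trans D.
  by rewrite mulr_ge0 ?(ltW t0)// mulr_ge0 ?sqr_ge0.
have Ln : ell g b n <= G * s ^+ 3.
  rewrite -(@ler_pXn2r _ 2)// ?nnegrE// ?mulr_ge0 ?exprn_ge0 ?(ltW G0) ?(ltW s0)//.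
  rewrite L2; apply: le_trans (lamsq_le n) _.
  rewrite exprMn /G sqr_sqrtr ?addr_ge0 ?(ltW g0)// -exprM -[(3 * 2)%N]/(2 * 3)%N exprM s2.
  have := sqr_ge0 (n%:R : R); set N : R := n%:R in n1 * => N0.
  rewrite [N ^+ 3]exprSr mulrA ler_wpM2r ?(le_trans ler01)//.
  have : 1 <= N ^+ 2 by rewrite exprn_ege1.
  by have := g0; nra.
have key : s ^+ 4 * m * t <= (ell g b n - ell g b k) * (2 * (G * s ^+ 3)).
  apply: (@le_trans _ _ ((ell g b n - ell g b k) * (ell g b n + ell g b k))).
    by rewrite -subr_sqr !L2 -[4%N]/(2 * 2)%N exprM s2.
  rewrite ler_wpM2l ?subr_ge0//; lra.
have step : t / (2 * G) * (m * s) <= ell g b n - ell g b k.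
  rewrite -(ler_pM2r (x := 2 * (G * s ^+ 3))); last by rewrite !mulr_gt0 ?exprn_gt0.
  apply: le_trans key; apply: eq_ler; field; rewrite gt_eqF//.
apply: le_trans step.
have c0 : 0 <= t / (2 * G).
  by apply: divr_ge0; [exact: ltW|apply: mulr_ge0 => //; exact: ltW].
by apply: (ler_wpM2l c0); apply: (ler_wpM2l m0).
Qed.

(** The operator [L] is bounded from [L^2] to [H^(-3/2)]. *)
Lemma ell_weight (n : int) :
  (1 + n%:~R ^+ 2) `^ (- (3 / 2)) * ell g b n ^+ 2 <= g + 1.
Proof.
pose X : R := 1 + n%:~R ^+ 2.
have X1 : 1 <= X by rewrite lerDl sqr_ge0.
have X0 : 0 < X by lra.
have E : ell g b n ^+ 2 <= (g + 1) * (X * Num.sqrt X).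
  rewrite ell_abs lamE sqr_sqrtr//; apply: le_trans (lamsq_le _) _.
  have sq : (`|n|%N)%:R ^+ 2 = n%:~R ^+ 2 :> R.
    by rewrite natr_absz intr_norm real_normK ?num_real.
  rewrite sq mulrA; apply: ler_pM => //.
  - by rewrite addr_ge0 ?sqr_ge0 ?(ltW g0).
  - have := sqr_ge0 (n%:~R : R); rewrite /X; have := g0; nra.
  - rewrite -[X in X <= _](ger0_norm (ler0n _ _)) -sqrtr_sqr ler_wsqrtr// sq.
    by rewrite lerDr.
have P : X `^ (- (3 / 2)) * (X * Num.sqrt X) = 1.
  rewrite -powR12_sqrt ?(ltW X0)// -{2}(powRr1 (ltW X0)) -!powRD ?(gt_eqF X0) ?implybT//.
  by rewrite (_ : - (3 / 2) + (1 + 2^-1) = 0) ?powRr0//; field.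
apply: le_trans (ler_wpM2l (powR_ge0 _ _) E) _.
by rewrite mulrCA P mulr1.
Qed.

Lemma Hweight_le1 (n : int) : (1 + n%:~R ^+ 2) `^ (- (3 / 2)) <= 1 :> R.
Proof.
have X1 : 1 <= 1 + n%:~R ^+ 2 :> R by rewrite lerDl sqr_ge0.
rewrite powRN invf_le1 ?powR_gt0//; last by lra.
have one : 1 `^ (3 / 2) = 1 :> R by rewrite powR1.
by rewrite -[X in X <= _]one ge0_ler_powR ?nnegrE//; lra.
Qed.

End dispersion.

(** * Curves of sequences and Sobolev norms *)

Section curves_of_sequences.
Context {R : realType}.
Implicit Types (y w : R -> R[i]).

Definition is_cderive y (t : R) (d : R[i]) :=
  is_derive t 1 (fun r => complex.Re (y r)) (complex.Re d) /\
  is_derive t 1 (fun r => complex.Im (y r)) (complex.Im d).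

Lemma is_cderiveM y w t (d e : R[i]) : is_cderive y t d -> is_cderive w t e ->
  is_cderive (fun r => y r * w r) t (d * w t + y t * e).
Proof.
move=> [y1 y2] [w1 w2]; split.
  rewrite (_ : (fun r => complex.Re (y r * w r)) =
    (fun r => complex.Re (y r) * complex.Re (w r)) - (fun r => complex.Im (y r) * complex.Im (w r))).
    apply: (is_derive_eq (is_deriveB (is_deriveM y1 w1) (is_deriveM y2 w2))).
    by rewrite !ReImE /GRing.scale /=; ring.
  by apply/funext => r; rewrite cReM.
rewrite (_ : (fun r => complex.Im (y r * w r)) =
  (fun r => complex.Re (y r) * complex.Im (w r)) + (fun r => complex.Im (y r) * complex.Re (w r))).
  apply: (is_derive_eq (is_deriveD (is_deriveM y1 w2) (is_deriveM y2 w1))).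
  by rewrite !ReImE /GRing.scale /=; ring.
by apply/funext => r; rewrite cImM.
Qed.

Lemma is_cderiveB y w t (d e : R[i]) : is_cderive y t d -> is_cderive w t e ->
  is_cderive (fun r => y r - w r) t (d - e).
Proof.
move=> [y1 y2] [w1 w2]; split.
  rewrite (_ : (fun r => complex.Re (y r - w r)) =
    (fun r => complex.Re (y r)) - (fun r => complex.Re (w r))).
    by apply: (is_derive_eq (is_deriveB y1 w1)); rewrite !ReImE.
  by apply/funext => r; rewrite cReB.
rewrite (_ : (fun r => complex.Im (y r - w r)) =
    (fun r => complex.Im (y r)) - (fun r => complex.Im (w r))).
  by apply: (is_derive_eq (is_deriveB y2 w2)); rewrite !ReImE.
by apply/funext => r; rewrite cImB.
Qed.

Lemma is_cderive_cst (c : R[i]) t : is_cderive (fun=> c) t 0.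
Proof. by split; exact: is_derive_cst. Qed.

Lemma is_cderiveZ c y t (d : R[i]) : is_cderive y t d -> is_cderive (fun r => c * y r) t (c * d).
Proof.
move=> h; have := is_cderiveM (is_cderive_cst c t) h.
by rewrite mul0r add0r.
Qed.

Lemma is_cderive_id (c : R[i]) t : is_cderive (fun r => r%:C%C * c) t c.
Proof.
have h : is_cderive (fun r => r%:C%C) t 1 by split => /=; [exact: is_derive_id|exact: is_derive_cst].
by have := is_cderiveM h (is_cderive_cst c t); rewrite mul1r mulr0 addr0.
Qed.

Lemma is_derive_cos_affine (k c x : R) :
  is_derive x 1 (fun x : R => cos (k * x + c)) (- k * sin (k * x + c)).
Proof.
have h1 : is_derive x 1 (fun x : R => k * x + c) k.
  by apply: is_derive_eq; rewrite addr0 -[RHS]mulr1.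
rewrite mulNr mulrC -mulNr.
by apply: (@is_derive1_comp _ cos (fun x => k * x + c)).
Qed.

Lemma is_cderive_expi (k t : R) :
  is_cderive (fun r => expi (k * r)) t ('i%C * k%:C%C * expi (k * t)).
Proof.
split => /=.
  have := is_derive_cos_affine k 0 t; rewrite addr0.
  rewrite (_ : (fun x => cos (k * x + 0)) = (fun r => cos (k * r))); last first.
    by apply/funext => r; rewrite addr0.
  by move=> h; apply: (is_derive_eq h); ring.
have := is_derive_sin_affine k 0 t; rewrite addr0.
rewrite (_ : (fun x => sin (k * x + 0)) = (fun r => sin (k * r))); last first.
  by apply/funext => r; rewrite addr0.
by move=> h; apply: (is_derive_eq h); ring.
Qed.

Lemma is_derive_bigsum (I : Type) (s : seq I) (f : I -> R -> R) (df : I -> R) (t : R) :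
  (forall i, is_derive t 1 (f i) (df i)) ->
  is_derive t 1 (fun r => \sum_(i <- s) f i r) (\sum_(i <- s) df i).
Proof.
move=> h; elim: s => [|i s IH].
  rewrite big_nil (_ : (fun r => _) = cst 0); first exact: is_derive_cst.
  by apply/funext => r; rewrite big_nil.
rewrite big_cons (_ : (fun r => _) = f i + (fun r => \sum_(i <- s) f i r)).
  exact: is_deriveD.
by apply/funext => r; rewrite big_cons.
Qed.

(** Mean value inequality in the space of square summable sequences: apply the
    scalar mean value theorem to the inner product with the increment itself. *)
Lemma l2_mean_value (y d : int -> R -> R[i]) (a b M : R) : a < b ->
  (forall n t, a <= t <= b -> is_cderive (y n) t (d n t)) ->
  (forall t, a <= t <= b -> l2le (fun n => d n t) M) ->
  l2le (fun n => y n b - y n a) ((b - a) ^+ 2 * M).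
Proof.
move=> ab dy dM s us.
pose z n := y n b - y n a.
pose Psi r := \sum_(n <- s) (complex.Re (z n) * complex.Re (y n r) +
                             complex.Im (z n) * complex.Im (y n r)).
pose dPsi r := \sum_(n <- s) (complex.Re (z n) * complex.Re (d n r) +
                             complex.Im (z n) * complex.Im (d n r)).
have dP r : a <= r <= b -> is_derive r 1 Psi (dPsi r).
  move=> abr; apply: is_derive_bigsum => n; have [h1 h2] := dy n r abr.
  rewrite (_ : (fun r => _) = (complex.Re (z n) *: (fun r => complex.Re (y n r)) : R -> R) +
     (complex.Im (z n) *: (fun r => complex.Im (y n r)) : R -> R)).
    exact: (is_deriveD (is_deriveZ _ h1) (is_deriveZ _ h2)).
  by apply/funext.
have [||c cab E] := @MVT _ Psi dPsi a b ab.
- by move=> x; rewrite in_itv /= => /andP[h1 h2]; apply: dP; rewrite !ltW.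
- apply: derivable_within_continuous => x; rewrite in_itv /= => h.
  have dx := dP x h; exact: ex_derive.
have cab' : a <= c <= b by move: cab; rewrite in_itv /= => /andP[h1 h2]; rewrite !ltW.
have Z : Psi b - Psi a = \sum_(n <- s) sqmod (z n).
  rewrite /Psi -sumrB; apply: eq_bigr => n _.
  by rewrite /sqmod /z !ReImE; ring.
have h0 : 0 < b - a by rewrite subr_gt0.
have B : dPsi c * (b - a) <= \sum_(n <- s) (sqmod (z n) / 2 + (b - a) ^+ 2 * sqmod (d n c) / 2).
  rewrite /dPsi mulr_suml; apply: ler_sum => n _.
  rewrite -subr_ge0 /sqmod; set A := complex.Re (z n); set A' := complex.Im (z n).
  set X := complex.Re _; set X' := complex.Im _; set h := b - a.
  rewrite (_ : _ - _ = ((A - h * X) ^+ 2 + (A' - h * X') ^+ 2) / 2); last by field.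
  by rewrite divr_ge0// addr_ge0// sqr_ge0.
have Dc := dM c cab' s us.
rewrite -/(\sum_(n <- s) sqmod (z n)).
have : \sum_(n <- s) sqmod (z n) <= (\sum_(n <- s) sqmod (z n)) / 2 +
    (b - a) ^+ 2 * (\sum_(n <- s) sqmod (d n c)) / 2.
  by rewrite -{1}Z E; apply: le_trans B _; rewrite big_split /= -!mulr_suml -mulr_sumr.
have := ler_wpM2l (sqr_ge0 (b - a)) Dc.
by lra.
Qed.

End curves_of_sequences.

Section extended_norms.
Context {R : realType}.

Lemma cvge0P (T : Type) (F : set_system T) {FF : Filter F} (f : T -> \bar R) :
  (forall x, (0 <= f x)%E) ->
  (forall e, 0 < e -> \forall x \near F, (f x <= e%:E)%E) ->
  f @ F --> 0%E.
Proof.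
move=> f0 fe; apply/fine_cvgP; split.
  apply: filterS (fe 1 ltr01) => x h.
  by rewrite ge0_fin_numE// (le_lt_trans h)// ltry.
apply/cvgrPdist_le => e e0; apply: filterS (fe e e0) => x h.
rewrite sub0r normrN /= ger0_norm ?fine_ge0// -lee_fin fineK//.
by rewrite ge0_fin_numE// (le_lt_trans h)// ltry.
Qed.

Lemma sqrt_bound (I : \bar R) (e : R) : 0 < e -> (0 <= I)%E -> (I <= (e ^+ 2)%:E)%E ->
  (I `^ 2^-1 <= e%:E)%E.
Proof.
move=> e0; case: I => [r||]//; rewrite !lee_fin => r0 re.
rewrite powR12_sqrt// -[X in _ <= X](ger0_norm (ltW e0)) -sqrtr_sqr.
exact: ler_wsqrtr.
Qed.

Lemma L2norm_cvg0 (T : Type) (F : set_system T) {FF : Filter F} (f : T -> R -> R[i]) :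
  (forall e, 0 < e -> \forall x \near F, sqint (f x) /\ energy (f x) <= e) ->
  L2norm (f x) @[x --> F] --> 0%E.
Proof.
move=> H; apply: cvge0P => [x|e e0]; first exact: poweR_ge0.
have e2 : 0 < e ^+ 2 by rewrite exprn_gt0.
apply: filterS (H _ e2) => x [sx ex]; rewrite L2normE// lee_fin.
rewrite powR12_sqrt ?energy_ge0// -[X in _ <= X](ger0_norm (ltW e0)) -sqrtr_sqr.
exact: ler_wsqrtr.
Qed.

Definition Hweight (r : R) (n : int) : R := (1 + n%:~R ^+ 2) `^ r.

Lemma Hweight_gt0 r n : 0 < Hweight r n.
Proof. by rewrite powR_gt0// ltr_pwDl// sqr_ge0. Qed.

Lemma Hnorm_le r (a : int -> R[i]) e : 0 < e ->
  l2le (fun n => (Num.sqrt (Hweight r n))%:C%C * a n) (e ^+ 2) -> (Hnorm r a <= e%:E)%E.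
Proof.
move=> e0 h; apply: sqrt_bound => //.
  by apply: esum_ge0 => n _; rewrite lee_fin mulr_ge0 ?powR_ge0 ?sqr_ge0.
apply: esum_le => s us; apply: le_trans (h s us); apply: ler_sum => n _.
by rewrite sqmodM sqmodC sqr_sqrtr ?(ltW (Hweight_gt0 r n))// sqmodE.
Qed.

(** Smallness of a distribution in [H^r] makes each coefficient small, which is
    how the equation is read off frequency by frequency. *)
Lemma Hnorm_ge r (a : int -> R[i]) n e : 0 < e -> (Hnorm r a <= e%:E)%E ->
  Hweight r n * sqmod (a n) <= e ^+ 2.
Proof.
move=> e0; rewrite /Hnorm; set S := (\esum_(m in _) _)%E => h.
have St : ((Hweight r n * sqmod (a n))%:E <= S)%E.
  rewrite -sqmodE; apply: (@le_esum_term _ (fun m => (1 + m%:~R ^+ 2) `^ r * Normc.normc (a m) ^+ 2)).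
  by move=> m; rewrite mulr_ge0 ?powR_ge0 ?sqr_ge0.
have t0 : 0 <= Hweight r n * sqmod (a n) by rewrite mulr_ge0 ?sqmod_ge0 ?(ltW (Hweight_gt0 _ _)).
move: h St; case: S => [x||] //.
  rewrite poweR_EFin !lee_fin => h hx; have x0 := le_trans t0 hx.
  move: h; rewrite powR12_sqrt// => h; apply: le_trans hx _.
  by rewrite -(sqr_sqrtr x0) ler_sqr ?nnegrE ?sqrtr_ge0// ltW.
by rewrite poweRyr ?invr_eq0// leye_eq.
Qed.

End extended_norms.

(** * Truncation to an open set *)

Section sine_inequalities.
Context {R : realType}.

Lemma sin_lt (h : R) : 0 < h <= 1 -> sin h < h.
Proof.
move=> /andP[h0 h1].
have pi2 : 1 <= pi / 2 :> R by exact: pihalf_ge1.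
have [|c] := @MVT R sin cos 0 h h0.
  by apply: continuous_subspaceT => x; exact: continuous_sin.
rewrite in_itv /= => /andP[c0 c1]; rewrite sin0 !subr0 => ->.
rewrite -[X in _ < X]mul1r ltr_pM2r//.
have := @ltr_cos R 0 c; rewrite cos0 => ->//; rewrite in_itv /=; apply/andP; split; lra.
Qed.

(** Induction on [k], by the addition formula for the sine. *)
Lemma norm_sin_natmul (k : nat) (x : R) : `|sin (k%:R * x)| <= k%:R * `|sin x|.
Proof.
elim: k => [|k IH]; first by rewrite !mul0r sin0 normr0.
rewrite -natr1 mulrDl mul1r sinD mulrDl mul1r.
apply: le_trans (ler_normD _ _) _; apply: lerD.
  rewrite normrM; apply: le_trans IH; rewrite ler_piMr// ler_norml.
  by rewrite cos_geN1 cos_le1.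
by rewrite normrM ler_piMl// ler_norml cos_geN1 cos_le1.
Qed.

Lemma norm_sin_intmul (n : int) (x : R) : `|sin (n%:~R * x)| <= `|n%:~R| * `|sin x|.
Proof.
case: n => k.
  by rewrite [X in _ <= X * _]ger0_norm ?ler0z//; exact: norm_sin_natmul.
rewrite NegzE rmorphN /= mulNr sinN !normrN [X in _ <= X * _]ger0_norm ?ler0z//.
exact: norm_sin_natmul.
Qed.

End sine_inequalities.

Section truncation.
Context {R : realType}.
Notation mu := (@lebesgue_measure R).
Variable (omega : set R).
Hypotheses (op : open omega) (per : periodic_set omega).
Implicit Types u v : R -> R[i].

Let D : set (measurableTypeR R) := `[0, 2 * pi]%classic.
Let mD : measurable D. Proof. exact: measurable_itv. Qed.

Let mo : @measurable _ (measurableTypeR R) omega.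
Proof. exact: open_measurable. Qed.

Let ind x : R[i] := (\1_omega x)%:C%C.

Lemma indic_01 (x : R) : 0 <= (\1_omega x : R) <= 1.
Proof. by rewrite indicE; case: (x \in omega); rewrite ?ler01 ?lexx. Qed.

Lemma measurable_indic_omega : measurable_fun [set: measurableTypeR R] (\1_omega : R -> R).
Proof. exact: measurable_indic. Qed.

Lemma cmeas_indic : cmeas ind.
Proof. by split => /=; [exact: measurable_indic_omega|exact: measurable_cst]. Qed.

Lemma sqmod_indic x : sqmod (ind x) <= 1.
Proof. by have /andP[h0 h1] := indic_01 x; rewrite sqmodC exprn_ile1. Qed.

Lemma sqint_truncate u : sqint u -> sqint (truncate omega u).
Proof. by move=> su; apply: sqintM cmeas_indic sqmod_indic su. Qed.

Lemma energy_truncate_le u : sqint u -> energy (truncate omega u) <= energy u.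
Proof.
move=> su; rewrite -[X in _ <= X]mul1r; apply: le_energy => //.
  exact: sqint_truncate.
by move=> x; rewrite /truncate sqmodM ler_wpM2r ?sqmod_ge0// sqmod_indic.
Qed.

Lemma truncateB u v : truncate omega (fun x => u x - v x) =
  (fun x => truncate omega u x - truncate omega v x).
Proof. by apply/funext => x; rewrite /truncate mulrBr. Qed.

(** The Fourier coefficients of the indicator function of [omega] are the entries
    of the Toeplitz matrix of the truncation, see [fourier_truncate_expz]. *)
Definition phi (n : int) : R[i] := fourier (fun x => (\1_omega x)%:C%C) n.

Lemma fourier_truncate_expz m n : fourier (truncate omega (expz m)) n = phi (n - m).
Proof.
rewrite /phi !fourierE; congr (_ * _); apply: eq_Cintegral => x _.
rewrite /truncate -mulrA; congr (_ * _).
by rewrite /expz -!expiN -expiD; congr expi; rewrite intrB; ring.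
Qed.

Lemma phiN n : phi (- n) = (phi n)^*%C.
Proof.
have si : sqint ind by apply: (@sqint_bounded _ _ 1); [exact: cmeas_indic|exact: sqmod_indic].
have cJ (r : R) (z : R[i]) : ((r%:C * z)^*)%C = r%:C%C * (z^*)%C.
  by apply: complexP; rewrite !ReImE /=; ring.
rewrite /phi !fourierE cJ; congr (_ * _).
rewrite -(CintegralJ mD); last by apply: cint_mulJ => //; exact: sqint_expz.
apply: eq_Cintegral => x _; rewrite cJ; congr (_ * _).
by rewrite conjcK -expiN /expz rmorphN /= mulNr opprK.
Qed.

Lemma phi0E : phi 0 = (complex.Re (phi 0))%:C%C.
Proof.
have E := phiN 0; rewrite oppr0 in E.
have h : complex.Im (phi 0) = - complex.Im (phi 0) by rewrite -cImJ -E.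
by apply: complexP; [rewrite cReC|rewrite cImC; lra].
Qed.

Let iind (f : R -> R) : continuous f -> (forall x, `|f x| <= 2) ->
  mu.-integrable D (EFin \o (fun x => \1_omega x * f x)).
Proof.
move=> cf f2; apply: le_integrable (integrable_cstD (R := R) 2) => //.
  apply/measurable_EFinP; apply: measurable_funTS; apply: measurable_funM.
    exact: measurable_indic_omega.
  exact: continuous_measurable_fun.
move=> x _ /=; rewrite lee_fin normrM; have /andP[h0 h1] := indic_01 x.
rewrite (ger0_norm h0) (ger0_norm (ler0n R 2)).
by apply: le_trans (f2 x); rewrite ler_piMl.
Qed.

Lemma Re_phi n : 2 * pi * complex.Re (phi n) = \int[mu]_(x in D) (\1_omega x * cos (n%:~R * x + 0)).
Proof.
rewrite /phi fourierE cReM cReC cImC mul0r subr0 mulrA divff ?gt_eqF ?twopi_gt0// mul1r Re_Cintegral.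
by apply: Rintegral_eq => x; rewrite !ReImE /= mul0r subr0 addr0.
Qed.

Lemma Im_phi n : 2 * pi * complex.Im (phi n) = - \int[mu]_(x in D) (\1_omega x * cos (n%:~R * x + - (pi / 2))).
Proof.
have h : mu.-integrable D (EFin \o (fun x => \1_omega x * cos (n%:~R * x + - (pi / 2)))).
  apply: iind; first exact: continuous_cos_affine.
  by move=> x; have [_ /(_ x) h] := weight_cos (R := R) n%:~R (- (pi / 2)); lra.
rewrite /phi fourierE cImM cReC cImC mul0r addr0 mulrA divff ?gt_eqF ?twopi_gt0// mul1r Im_Cintegral.
rewrite -mulN1r -RintegralZl//.
by apply: Rintegral_eq => x; rewrite !ReImE /= mul0r addr0 cosBpihalf; ring.
Qed.

(** A point of [omega] is moved to [[0, 2 pi[] by periodicity; as this interval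
    is half open, there is room on the right of the point. The bound [h <= 1] is
    for the sake of [sin_lt]. *)
Lemma omega_interval : omega !=set0 -> exists p h : R,
  [/\ 0 < h <= 1, 0 <= p, p + h <= 2 * pi & forall x, p <= x <= p + h -> omega x].
Proof.
move=> [x0 ox0].
have p0 := @twopi_gt0 R.
have Pn (n : nat) x : omega (x + n%:R * (2 * pi)) <-> omega x.
  elim: n => [|n IH]; first by rewrite mul0r addr0.
  by rewrite -natr1 mulrDl mul1r addrA per.
have Pz (n : int) x : omega (x + n%:~R * (2 * pi)) <-> omega x.
  case: n => n; first exact: Pn.
  rewrite NegzE rmorphN /= mulNr.
  by have := Pn n.+1 (x - n.+1%:R * (2 * pi)); rewrite subrK => H; apply: iff_sym.
pose k := Num.floor (x0 / (2 * pi)); pose p := x0 + (- k)%:~R * (2 * pi).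
have op' : omega p by apply/Pz.
have k1 : k%:~R * (2 * pi) <= x0 by rewrite -ler_pdivlMr// ge_floor.
have k2 : x0 < (k%:~R + 1) * (2 * pi).
  by rewrite -ltr_pdivrMr//; have := lt_succ_floor (x0 / (2 * pi)); rewrite intrD.
have pE : p = x0 - k%:~R * (2 * pi) by rewrite /p rmorphN /= mulNr.
have pp : p < 2 * pi by rewrite pE; lra.
have pge : 0 <= p by rewrite pE subr_ge0.
have /nbhs_ballP[r /= r0 br] : nbhs p omega by apply: open_nbhs_nbhs.
pose h := Num.min (Num.min (r / 2) 1) (2 * pi - p).
have hr : h <= r / 2 by rewrite !ge_min lexx.
have h1 : h <= 1 by rewrite !ge_min lexx orbT.
have hp : h <= 2 * pi - p by rewrite !ge_min lexx orbT.
have h0 : 0 < h by rewrite !lt_min divr_gt0// ltr01 subr_gt0 pp.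
exists p, h; split => //; [by rewrite h0|lra|].
move=> x /andP[x1 x2]; apply: br; rewrite /ball /= ltr_norml; apply/andP; split; lra.
Qed.

(** The Gram matrix of [e_n] and [e_(-n)] on [omega], with diagonal [phi 0] and
    off-diagonal entry [phi (2 n)], is definite uniformly in [n]. The difference
    [phi 0 - |phi (2 n)|], multiplied by [2 pi], is the integral over [omega] of a
    nonnegative function [1 - cos (2 n x + f)], hence at least its integral over
    an interval of length [h] contained in [omega]. There the cosine contributes
    at most [|sin (n h)| / |n| <= sin h < h]. *)
Lemma phi_gap : omega !=set0 -> exists delta : R,
  [/\ 0 < delta, delta <= complex.Re (phi 0) &
  forall n, n != 0 -> sqmod (phi (2 * n)) <= (complex.Re (phi 0) - delta) ^+ 2].
Proof.
move=> /omega_interval [p [h [/[dup] h01 /andP[h0 h1] p0 ph ho]]].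
have tp := @twopi_gt0 R.
have sh := sin_lt h01.
have sh0 : 0 <= sin h.
  have : 1 <= pi / 2 :> R by exact: pihalf_ge1.
  by move=> hh; apply: sin_ge0_pi; apply/andP; split; lra.
pose delta := (h - sin h) / (2 * pi).
have d0 : 0 < delta by rewrite divr_gt0// subr_gt0.
(* The maximum of the left-hand side over the unit vectors (z1, z2) is the
   modulus of phi (2 n). *)
have key (n : int) (z1 z2 : R) : n != 0 -> z1 ^+ 2 + z2 ^+ 2 = 1 ->
    z1 * complex.Re (phi (2 * n)) + z2 * complex.Im (phi (2 * n)) <= complex.Re (phi 0) - delta.
  move=> n0 z12.
  have nR : n%:~R != 0 :> R by rewrite intr_eq0.
  have n2 : (2 * n)%:~R != 0 :> R by rewrite intr_eq0 mulf_neq0.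
  have bcs m e x : `|cos (m * x + e)| <= 1 :> R by have [_ /(_ x)] := weight_cos (R := R) m e.
  have i1 m e : mu.-integrable D (EFin \o (fun x => \1_omega x * cos (m * x + e))).
    apply: iind; first exact: continuous_cos_affine.
    by move=> x; have := bcs m e x; lra.
  pose f x := 1 - z1 * cos ((2 * n)%:~R * x + 0) + z2 * cos ((2 * n)%:~R * x + - (pi / 2)).
  have f0 x : 0 <= f x.
    rewrite /f addr0 cosBpihalf; set y := (_ * x).
    have := cos2Dsin2 y; set c := cos y; set s := sin y => cs.
    have : (z1 * c - z2 * s) ^+ 2 + (z1 * s + z2 * c) ^+ 2 = 1.
      by rewrite -[RHS]mulr1 -{1}z12 -cs; ring.
    have := sqr_ge0 (z1 * s + z2 * c); nra.
  have E : 2 * pi * (complex.Re (phi 0) -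
      (z1 * complex.Re (phi (2 * n)) + z2 * complex.Im (phi (2 * n)))) =
      \int[mu]_(x in D) (\1_omega x * f x).
    rewrite (_ : 2 * pi * _ = 2 * pi * complex.Re (phi 0) - z1 * (2 * pi * complex.Re (phi (2 * n)))
      - z2 * (2 * pi * complex.Im (phi (2 * n)))); last by ring.
    rewrite (Re_phi 0) (Re_phi (2 * n)) (Im_phi (2 * n)).
    rewrite (@Rintegral_eq _ D (fun x => \1_omega x * f x) (fun x => (\1_omega x * cos (0%:~R * x + 0) +
      (- z1) * (\1_omega x * cos ((2 * n)%:~R * x + 0))) +
      z2 * (\1_omega x * cos ((2 * n)%:~R * x + - (pi / 2))))); last first.
      by move=> x; rewrite /f mul0r !addr0 cos0; ring.
    rewrite RintegralD ?RintegralD ?RintegralZl//; first by ring.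
    + exact: integrable_EFinZ.
    + by apply: integrable_EFinD => //; exact: integrable_EFinZ.
    + exact: integrable_EFinZ.
  pose J : set (measurableTypeR R) := `[p, p + h]%classic.
  have mJ : measurable J by exact: measurable_itv.
  have JD : J `<=` D.
    by move=> x; rewrite /J /D /= !in_itv /= => /andP[a b]; apply/andP; split; lra.
  have muJ : fine (mu J) = h.
    by rewrite /J lebesgue_measure_itv /= lte_fin ltrDl h0 /= addrAC subrr add0r.
  have iD : mu.-integrable D (EFin \o (fun x => \1_omega x * f x)).
    rewrite (_ : (fun x => \1_omega x * f x) = (fun x => (\1_omega x * cos (0 * x + 0) +
      (- z1) * (\1_omega x * cos ((2 * n)%:~R * x + 0))) +
      z2 * (\1_omega x * cos ((2 * n)%:~R * x + - (pi / 2))))); last first.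
      by apply/funext => x; rewrite /f mul0r !addr0 cos0; ring.
    by apply: integrable_EFinD => //; [apply: integrable_EFinD => //|]; exact: integrable_EFinZ.
  have iJ m e : mu.-integrable J (EFin \o (fun x => cos (m * x + e))).
    apply: (integrableS mD) => //; apply: le_integrable (integrable_cstD (R := R) 1) => //.
      apply/measurable_EFinP; apply: measurable_funTS.
      by apply: continuous_measurable_fun; exact: continuous_cos_affine.
    by move=> x _ /=; rewrite lee_fin normr1.
  have low : \int[mu]_(x in J) f x <= \int[mu]_(x in D) (\1_omega x * f x).
    have -> : \int[mu]_(x in J) f x = \int[mu]_(x in D) ((fun x => \1_omega x * f x) \_ J) x.
      rewrite -Rintegral_mkcondr setIidr//; apply: eq_Rintegral => x; rewrite inE => Jx.
      rewrite indicE mem_set ?mul1r//; apply: ho.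
      by move: Jx; rewrite /J /= in_itv.
    apply: le_Rintegral => //.
      rewrite -restrict_EFin; apply/integrable_restrict => //; rewrite setIidr//.
      exact: integrableS iD.
    move=> x _; rewrite patchE; case: ifPn => // _.
    by have /andP[a b] := indic_01 x; rewrite mulr_ge0.
  have phl : p < p + h by rewrite ltrDl.
  have val : \int[mu]_(x in J) f x = h - (z1 * cos (n%:~R * (2 * p + h)) - z2 * sin (n%:~R * (2 * p + h)))
       * (sin (n%:~R * h) / n%:~R).
    rewrite (@Rintegral_eq _ J f (fun x => (cos (0 * x + 0) +
      (- z1) * cos ((2 * n)%:~R * x + 0)) + z2 * cos ((2 * n)%:~R * x + - (pi / 2)))); last first.
      by move=> x; rewrite /f mul0r !addr0 cos0; ring.
    have i2 := integrable_EFinZ mJ (- z1) (iJ (2 * n)%:~R 0).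
    have i3 := integrable_EFinZ mJ z2 (iJ (2 * n)%:~R (- (pi / 2))).
    rewrite RintegralD ?RintegralD ?RintegralZl//; last exact: integrable_EFinD.
    rewrite (@Rintegral_eq _ J (fun x => cos (0 * x + 0)) (fun=> 1)); last first.
      by move=> x; rewrite mul0r addr0 cos0.
    rewrite Rintegral_cst// muJ /J !Rintegral_cos_affine//.
    rewrite !addr0 !sinBpihalf intrM.
    rewrite (_ : 2%:~R * n%:~R * (p + h) = n%:~R * (2 * p + h) + n%:~R * h); last by ring.
    rewrite (_ : 2%:~R * n%:~R * p = n%:~R * (2 * p + h) - n%:~R * h); last by ring.
    by rewrite sinD sinB cosD cosB; field.
  have bound : (z1 * cos (n%:~R * (2 * p + h)) - z2 * sin (n%:~R * (2 * p + h)))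
       * (sin (n%:~R * h) / n%:~R) <= sin h.
    have s1 : `|sin (n%:~R * h) / n%:~R| <= sin h.
      rewrite normrM normfV ler_pdivrMr ?normr_gt0//.
      by rewrite [X in _ <= X]mulrC; have := norm_sin_intmul n h; rewrite (ger0_norm sh0).
    apply: le_trans (ler_norm _) _; rewrite normrM -[X in _ <= X]mul1r; apply: ler_pM => //.
    set y := (_ * (2 * p + h)); have := cos2Dsin2 y; set c := cos y; set s := sin y => cs.
    have E1 : (z1 * c - z2 * s) ^+ 2 + (z1 * s + z2 * c) ^+ 2 = 1.
      by rewrite -[RHS]mulr1 -{1}z12 -cs; ring.
    rewrite -(@ler_pXn2r _ 2)// ?nnegrE// real_normK ?num_real// expr1n.
    by rewrite -[X in _ <= X]E1 lerDl sqr_ge0.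
  rewrite lerBrDl addrC -lerBrDl /delta ler_pdivrMr//.
  rewrite mulrC E; apply: le_trans low; rewrite val; lra.
exists delta; split => //.
  have := key 1 1 0; rewrite expr1n expr0n addr0 mul1r mul0r => /(_ isT erefl) k1.
  have := key 1 (-1) 0; rewrite sqrrN expr1n expr0n addr0 mulN1r mul0r => /(_ isT erefl) k2.
  by lra.
move=> n n0.
have [z0|z0] := eqVneq (sqmod (phi (2 * n))) 0; first by rewrite z0 sqr_ge0.
set w := phi (2 * n) in z0 *; pose r := Num.sqrt (sqmod w).
have w0 : 0 < sqmod w by rewrite lt0r z0 sqmod_ge0.
have r0 : 0 < r by rewrite sqrtr_gt0.
have r2 : r ^+ 2 = sqmod w by rewrite sqr_sqrtr ?sqmod_ge0.
have := key n (complex.Re w / r) (complex.Im w / r) n0.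
rewrite -/w !expr_div_n -mulrDl -/(sqmod w) r2 divff// => /(_ erefl).
rewrite (_ : _ + _ = r).
  move=> h2; rewrite -r2 ler_sqr ?nnegrE ?(ltW r0)//.
  exact: le_trans (ltW r0) h2.
rewrite mulrAC [X in _ + X]mulrAC -mulrDl -!expr2 -/(sqmod w) -r2 expr2 mulfK//.
by rewrite gt_eqF.
Qed.

End truncation.

(** * The control *)

Section oscillations.
Context {R : realType}.
Notation mu := (@lebesgue_measure R).

Lemma cvg_sqmodB (T : Type) (F : set_system T) {FF : Filter F} (z : T -> R[i]) (l : R[i]) :
  complex.Re (z x) @[x --> F] --> complex.Re l ->
  complex.Im (z x) @[x --> F] --> complex.Im l ->
  sqmod (z x - l) @[x --> F] --> (0 : R).
Proof.
move=> h1 h2; have -> : 0 = (complex.Re l - complex.Re l) * (complex.Re l - complex.Re l) +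
  (complex.Im l - complex.Im l) * (complex.Im l - complex.Im l) :> R by ring.
rewrite (_ : (fun x => sqmod (z x - l)) = fun x =>
  (complex.Re (z x) - complex.Re l) * (complex.Re (z x) - complex.Re l) +
  (complex.Im (z x) - complex.Im l) * (complex.Im (z x) - complex.Im l)); last first.
  by apply/funext => x; rewrite /sqmod !ReImE !expr2.
by apply: cvgD; apply: cvgM; apply: cvgB => //; exact: cvg_cst.
Qed.

Definition ccontinuous (z : R -> R[i]) := continuous (fun s => complex.Re (z s)) /\
  continuous (fun s => complex.Im (z s)).

Lemma ccontinuousM z w : ccontinuous z -> ccontinuous w -> ccontinuous (fun s => z s * w s).
Proof.
move=> [z1 z2] [w1 w2]; split.
  have -> : (fun s => complex.Re (z s * w s)) = (fun s =>
      complex.Re (z s) * complex.Re (w s) - complex.Im (z s) * complex.Im (w s)).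
    by apply/funext => s; rewrite cReM.
  by move=> s; apply: cvgB; apply: cvgM; [exact: z1|exact: w1|exact: z2|exact: w2].
have -> : (fun s => complex.Im (z s * w s)) = (fun s =>
    complex.Re (z s) * complex.Im (w s) + complex.Im (z s) * complex.Re (w s)).
  by apply/funext => s; rewrite cImM.
by move=> s; apply: cvgD; apply: cvgM; [exact: z1|exact: w2|exact: z2|exact: w1].
Qed.

Lemma ccontinuous_expi (k : R) : ccontinuous (fun s => expi (k * s)).
Proof.
split => s /=.
  have := @continuous_cos_affine R k 0 s.
  by rewrite (_ : (fun x => cos (k * x + 0)) = (fun x => cos (k * x)))//;
    apply/funext => x; rewrite addr0.
have -> : (fun x => sin (k * x)) = (fun x => cos (k * x + - (pi / 2))).
  by apply/funext => x; rewrite cosBpihalf.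
exact: continuous_cos_affine.
Qed.

Lemma ccontinuous_cvg z (t : R) : ccontinuous z -> sqmod (z s - z t) @[s --> t] --> (0 : R).
Proof. by move=> [z1 z2]; apply: cvg_sqmodB; [exact: z1|exact: z2]. Qed.

Lemma cint_ccontinuous z (a c : R) : ccontinuous z -> cint `[a, c] z.
Proof.
move=> [z1 z2]; split; apply: continuous_compact_integrable.
- exact: segment_compact.
- exact: continuous_subspaceT.
- exact: segment_compact.
- exact: continuous_subspaceT.
Qed.

Lemma ccontinuousZ (c : R[i]) z : ccontinuous z -> ccontinuous (fun s => c * z s).
Proof. by move=> cz; apply: ccontinuousM => //; split => s; exact: cvg_cst. Qed.

Lemma ccontinuousD z w : ccontinuous z -> ccontinuous w -> ccontinuous (fun s : R => z s + w s : R[i]).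
Proof.
move=> [z1 z2] [w1 w2]; split.
  rewrite (_ : (fun _ => _) = fun s => complex.Re (z s) + complex.Re (w s)); last first.
    by apply/funext => s; rewrite cReD.
  by move=> s; apply: cvgD; [exact: z1|exact: w1].
rewrite (_ : (fun _ => _) = fun s => complex.Im (z s) + complex.Im (w s)); last first.
  by apply/funext => s; rewrite cImD.
by move=> s; apply: cvgD; [exact: z2|exact: w2].
Qed.

Lemma ccontinuous_sum (I : Type) (l : seq I) (c : I -> R[i]) (z : I -> R -> R[i]) :
  (forall i, ccontinuous (z i)) -> ccontinuous (fun s => \sum_(i <- l) c i * z i s).
Proof.
move=> cz; elim: l => [|i l IH].
  rewrite (_ : (fun _ => _) = fun=> 0); first by split => s; exact: cvg_cst.
  by apply/funext => s; rewrite big_nil.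
rewrite (_ : (fun _ => _) = fun s => c i * z i s + \sum_(j <- l) c j * z j s).
  by apply: ccontinuousD => //; exact: ccontinuousZ.
by apply/funext => s; rewrite big_cons.
Qed.

Lemma Cintegral_sum (I : Type) (l : seq I) (c : I -> R[i]) (z : I -> R -> R[i]) a a' :
  (forall i, ccontinuous (z i)) ->
  Cintegral `[a, a'] (fun s => \sum_(i <- l) c i * z i s) =
  \sum_(i <- l) c i * Cintegral `[a, a'] (z i).
Proof.
move=> cz.
have mA : measurable (`[a, a']%classic : set (measurableTypeR R)) by exact: measurable_itv.
elim: l => [|i l IH].
  rewrite big_nil (@eq_Cintegral _ _ _ (fun=> 0)); last by move=> s _; rewrite big_nil.
  by apply: complexP; rewrite (Re_Cintegral, Im_Cintegral) /= Rintegral_cst ?mul0r.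
rewrite big_cons -IH -(CintegralZ mA); last exact: cint_ccontinuous.
rewrite -(CintegralD mA).
- by apply: eq_Cintegral => s _; rewrite big_cons.
- by apply: cint_ccontinuous; exact: ccontinuousZ.
- by apply: cint_ccontinuous; exact: ccontinuous_sum.
Qed.

(** The factor 2 comes from estimating the real and imaginary parts
    separately. *)
Lemma sqmod_Cintegral_le (z : R -> R[i]) (a c e : R) : a < c -> 0 <= e -> ccontinuous z ->
  (forall s, sqmod (z s) <= e ^+ 2) -> sqmod (Cintegral `[a, c] z) <= 2 * (e * (c - a)) ^+ 2.
Proof.
move=> ac e0 cz ze; have [i1 i2] := cint_ccontinuous a c cz.
have abs_le (x : R) : x ^+ 2 <= e ^+ 2 -> `|x| <= e.
  by rewrite -(real_normK (num_real x)) ler_sqr ?nnegrE.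
have muI : (mu `[a, c]%classic < +oo)%E.
  by rewrite lebesgue_measure_itv /= lte_fin ac -EFinB ltry.
have key (f : R -> R) : mu.-integrable `[a, c] (EFin \o f) -> (forall s, `|f s| <= e) ->
    (\int[mu]_(s in `[a, c]) f s) ^+ 2 <= (e * (c - a)) ^+ 2.
  move=> fi fe; rewrite -(real_normK (num_real (\int[mu]_(s in _) _))).
  rewrite ler_sqr ?nnegrE//; last by rewrite mulr_ge0// subr_ge0 ltW.
  apply: le_trans (le_normr_Rintegral _ fi) _; first exact: measurable_itv.
  have m : fine (mu `[a, c]%classic) = c - a by rewrite lebesgue_measure_itv /= lte_fin ac.
  rewrite -m -Rintegral_cst; last exact: measurable_itv.
  apply: le_Rintegral => //; first exact: integrable_norm.
  by apply: measurable_bounded_integrable => //; exact: (bounded_cst e).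
rewrite /sqmod Re_Cintegral Im_Cintegral mulr_natl mulr2n; apply: lerD; apply: key => // s.
  by apply: abs_le; exact: le_trans (normRe_sqmod _) (ze s).
by apply: abs_le; exact: le_trans (normIm_sqmod _) (ze s).
Qed.

Variables (lamn : nat -> R) (T C : R) (q : nat -> R -> R).
Hypothesis Hq : forall k,
    [/\ continuous (q k), forall t, `|q k t| <= C,
      forall t, t <= 0 \/ T <= t -> q k t = 0 &
      forall n f, moment (q k) (fun t => cos ((lamn n - lamn k) * t + f)) =
        (n == k)%:R * cos f].

(** The eigenvalues depend on [|n|] only: the frequencies [n] and [- n]
    resonate. *)
Definition lamz (n : int) := lamn `|n|%N.
Definition osc (m : int) (s : R) : R[i] := expi (- lamz m * s) * (q `|m|%N s)%:C%C.

Lemma C_ge0 : 0 <= C.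
Proof. by have [_ h _ _] := Hq 0; exact: le_trans (normr_ge0 _) (h 0). Qed.

Lemma sqmod_osc m s : sqmod (osc m s) <= C ^+ 2.
Proof.
have [_ h _ _] := Hq `|m|%N.
rewrite sqmodM sqmod_expi mul1r sqmodC -(real_normK (num_real (q _ _))).
by rewrite ler_sqr ?nnegrE ?C_ge0.
Qed.

Lemma ccontinuous_osc m : ccontinuous (osc m).
Proof.
have [h _ _ _] := Hq `|m|%N.
apply: ccontinuousM; first exact: ccontinuous_expi.
by split => /= s; [exact: h|exact: cvg_cst].
Qed.

Lemma osc_supp m s : s <= 0 \/ T <= s -> osc m s = 0.
Proof. by move=> hs; have [_ _ h _] := Hq `|m|%N; rewrite /osc h// mulr0. Qed.

(** Biorthogonality at the phases 0 and [- pi / 2]; the interval contains the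
    support of the profile. *)
Lemma Cintegral_osc n m :
  Cintegral `[-1, T] (fun s => expi (lamz n * s) * osc m s) = (`|n|%N == `|m|%N)%:R :> R[i].
Proof.
have [_ _ supp mom] := Hq `|m|%N.
pose e := lamz n - lamz m.
have E s : expi (lamz n * s) * osc m s =
    Complex (q `|m|%N s * cos (e * s + 0)) (q `|m|%N s * cos (e * s + - (pi / 2))).
  rewrite /osc mulrA -expiD -mulrDl -/e cosBpihalf addr0.
  by apply: complexP; rewrite !ReImE /=; ring.
have ext (w : R -> R) : \int[mu]_(s in `[-1, T]) (q `|m|%N s * w s) = moment (q `|m|%N) w.
  rewrite /moment Rintegral_mkcond; apply: Rintegral_eq => s.
  rewrite patchE; case: ifPn => // hs; rewrite supp ?mul0r//.
  move: hs; rewrite notin_setE /= in_itv /= => /negP; rewrite negb_and -!ltNge => /orP[h|h].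
    by left; lra.
  by right; lra.
apply: complexP; rewrite (Re_Cintegral, Im_Cintegral).
  under Rintegral_eq do rewrite E /=.
  rewrite ext mom cos0 mulr1; by case: eqP.
under Rintegral_eq do rewrite E /=.
by rewrite ext mom cosN cos_pihalf mulr0; case: eqP.
Qed.

End oscillations.

Section control.
Context {R : realType}.
Notation mu := (@lebesgue_measure R).
Variables (lamn : nat -> R) (T C : R) (q : nat -> R -> R).
Hypothesis Hq : forall k,
    [/\ continuous (q k), forall t, `|q k t| <= C,
      forall t, t <= 0 \/ T <= t -> q k t = 0 &
      forall n f, moment (q k) (fun t => cos ((lamn n - lamn k) * t + f)) =
        (n == k)%:R * cos f].
Variable (omega : set R).
Hypothesis (op : open omega).
Variables (d : int -> R[i]) (M : R).
Hypothesis dM : l2le d M.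
Variable G : R -> R -> R[i].
Hypothesis GL2 : forall s, L2 (G s).
Hypothesis Gfourier : forall s m, fourier (G s) m = osc lamn q m s * d m.

Local Notation osc := (osc lamn q).
Local Notation lamz := (lamz lamn).

(** The time factors are bounded uniformly in the frequency and continuous, so
    dominated convergence applies to the coefficients. *)
Lemma G_energy_near (t e : R) : 0 < e ->
  \forall s \near t, energy (fun x => G s x - G t x) <= e.
Proof.
move=> e0; have p0 := @twopi_gt0 R.
have e1 : 0 < e / (2 * pi) by rewrite divr_gt0.
have C2 : 0 <= 4 * C ^+ 2 by rewrite mulr_ge0 ?sqr_ge0.
have near_l2 : \forall s \near t, l2le (fun n => (osc n s - osc n t) * d n) (e / (2 * pi)).
  apply: (@l2le_mult_near _ _ (nbhs t) _ (fun n s => osc n s - osc n t) d M _ dM C2) => //.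
    move=> n s; apply: le_trans (sqmodB_le _ _) _.
    by have := sqmod_osc Hq n s; have := sqmod_osc Hq n t; lra.
  by move=> n; apply: ccontinuous_cvg; exact: ccontinuous_osc Hq n.
apply: filterS near_l2 => s hs.
have := GL2 s => /L2P[ps ss]; have := GL2 t => /L2P[pt st].
rewrite -[e](divfK (lt0r_neq0 p0)) mulrC; apply: energy_le_of_fourier.
  by apply/L2P; split; [move=> x; rewrite ps pt|exact: sqintB].
move=> l ul; have := hs l ul; under eq_bigr do rewrite mulrBl -!Gfourier -fourierB//.
by [].
Qed.

Lemma G_energy s : energy (G s) <= 2 * pi * (C ^+ 2 * M).
Proof.
apply: energy_le_of_fourier; first exact: GL2.
rewrite (_ : fourier (G s) = fun m => osc m s * d m); last by apply/funext => m.
apply: l2le_ler dM; first exact: sqr_ge0.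
by move=> n; rewrite sqmodM ler_wpM2r ?sqmod_ge0// (sqmod_osc Hq).
Qed.

Lemma C0L2_control T' : C0L2 T' G.
Proof.
split => [t _|t _]; first exact: GL2.
apply: L2norm_cvg0 => e e0; apply: cvg_within.
apply: filterS (G_energy_near t e0) => s hs; split => //.
by apply: sqintB; [have /L2P[] := GL2 s|have /L2P[] := GL2 t].
Qed.

Definition source (n : int) (s : R) : R[i] := fourier (truncate omega (G s)) n.

Let sG s : sqint (G s). Proof. by have /L2P[] := GL2 s. Qed.
Let sTG s : sqint (truncate omega (G s)). Proof. by apply: sqint_truncate. Qed.

Lemma source_bound s : l2le (fun n => source n s) (C ^+ 2 * M).
Proof.
apply: l2leW (bessel (sTG s)); rewrite ler_pdivrMl ?twopi_gt0//.
exact: le_trans (energy_truncate_le op (sG s)) (G_energy s).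
Qed.

Lemma source_near (t e : R) : 0 < e ->
  \forall s \near t, l2le (fun n => source n s - source n t) e.
Proof.
move=> e0; have e1 : 0 < 2 * pi * e by rewrite mulr_gt0 ?twopi_gt0.
apply: filterS (G_energy_near t e1) => s hs.
have sB : sqint (fun x => G s x - G t x) by exact: sqintB.
have E n : source n s - source n t = fourier (truncate omega (fun x => G s x - G t x)) n.
  by rewrite truncateB fourierB.
rewrite (_ : (fun n => _) = fourier (truncate omega (fun x => G s x - G t x))); last first.
  by apply/funext => n; rewrite E.
apply: l2leW (bessel (sqint_truncate op sB)); rewrite ler_pdivrMl ?twopi_gt0//.
exact: le_trans (energy_truncate_le op sB) hs.
Qed.

Lemma ccontinuous_source n : ccontinuous (source n).
Proof.
have key t e : 0 < e -> \forall s \near t, sqmod (source n s - source n t) <= e ^+ 2.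
  move=> e0; have e2 : 0 < e ^+ 2 by rewrite exprn_gt0.
  by apply: filterS (source_near t e2) => s /l2le_term.
have abs_le (x e : R) : 0 < e -> x ^+ 2 <= e ^+ 2 -> `|x| <= e.
  move=> e0; rewrite -(real_normK (num_real x)) ler_sqr ?nnegrE//; exact: ltW.
split => t; apply/cvgrPdist_le => e e0; apply: filterS (key t e e0) => s hs.
  rewrite distrC -cReB; apply: abs_le => //; exact: le_trans (normRe_sqmod _) hs.
rewrite distrC -cImB; apply: abs_le => //; exact: le_trans (normIm_sqmod _) hs.
Qed.

Lemma source_supp n s : s <= 0 \/ T <= s -> source n s = 0.
Proof.
move=> hs; apply/eqP; rewrite -sqmod_eq0 eq_le sqmod_ge0 andbT.
apply: le_trans (sqmod_fourier n (sTG s)) _.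
rewrite ler_pdivrMl ?twopi_gt0// mulr0.
apply: le_trans (energy_truncate_le op (sG s)) _.
rewrite -(mulr0 (2 * pi)); apply: energy_le_of_fourier => // l ul.
rewrite big1// => m _; rewrite Gfourier (osc_supp Hq)// mul0r; exact: sqmod0.
Qed.

Definition forcing n s : R[i] := expi (lamz n * s) * source n s.

Lemma ccontinuous_forcing n : ccontinuous (forcing n).
Proof. by apply: ccontinuousM; [exact: ccontinuous_expi|exact: ccontinuous_source]. Qed.

End control.

(** * Duhamel's formula *)

Section duhamel.
Context {R : realType}.
Notation mu := (@lebesgue_measure R).
Variables (lam : int -> R) (T Lw : R).
Hypothesis T0 : 0 < T.
Hypothesis lam_weight : forall n, Hweight (- (3 / 2)) n * lam n ^+ 2 <= Lw.
Variables (F : int -> R -> R[i]) (MF : R).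
Hypothesis F_cont : forall n, ccontinuous (F n).
Hypothesis F_bound : forall s, l2le (fun n => F n s) MF.
Hypothesis F_near : forall t e, 0 < e ->
  \forall s \near t, l2le (fun n => F n s - F n t) e.
Hypothesis F_supp : forall n s, s <= 0 -> F n s = 0.
Variables (a : int -> R[i]) (Ma : R).
Hypothesis aM : l2le a Ma.

Definition twisted n s : R[i] := expi (lam n * s) * F n s.
(** Duhamel's integral starts at [-1] instead of 0, where the source still
    vanishes, so that it is differentiable on both sides of the initial time. *)
Definition duh n t : R[i] := Cintegral `[-1, t] (twisted n).
Definition sol n t : R[i] := expi (- lam n * t) * (a n + duh n t).

Lemma ccontinuous_twisted n : ccontinuous (twisted n).
Proof. by apply: ccontinuousM => //; exact: ccontinuous_expi. Qed.

Lemma sqmod_twisted n s : sqmod (twisted n s) = sqmod (F n s).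
Proof. by rewrite sqmodM sqmod_expi mul1r. Qed.

Lemma duh0 n : duh n 0 = 0.
Proof.
rewrite /duh (@eq_Cintegral _ _ _ (fun=> 0)); last first.
  by move=> s; rewrite /= in_itv /= => /andP[_ s0]; rewrite /twisted F_supp// mulr0.
apply: complexP; rewrite (Re_Cintegral, Im_Cintegral) /= Rintegral_cst ?mul0r//; exact: measurable_itv.
Qed.

Lemma is_cderive_duh n t : -1 < t -> is_cderive (duh n) t (twisted n t).
Proof.
move=> t1; have tt : t < t + 1 by rewrite ltrDl.
have [c1 c2] := ccontinuous_twisted n.
have [i1 i2] := cint_ccontinuous (-1) (t + 1) (ccontinuous_twisted n).
have [d1 e1] := @continuous_FTC1_closed _ _ _ _ _ tt i1 t1 (c1 t).
have [d2 e2] := @continuous_FTC1_closed _ _ _ _ _ tt i2 t1 (c2 t).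
split; apply: DeriveDef.
- exact: d1.
- by rewrite -derive1E; exact: e1.
- exact: d2.
- by rewrite -derive1E; exact: e2.
Qed.

Lemma sol0 n : sol n 0 = a n.
Proof. by rewrite /sol mulr0 expi0 mul1r duh0 addr0. Qed.

Lemma is_cderive_sol n t : 0 <= t ->
  is_cderive (sol n) t (F n t - 'i%C * ((lam n)%:C%C * sol n t)).
Proof.
move=> t0; have t1 : -1 < t by lra.
have h1 := is_cderive_expi (- lam n) t.
have h2 : is_cderive (fun s => a n + duh n s) t (twisted n t).
  have [d1 d2] := is_cderive_duh n t1; split.
    rewrite (_ : (fun r => _) = cst (complex.Re (a n)) + (fun r => complex.Re (duh n r))).
      by apply: (is_derive_eq (is_deriveD (is_derive_cst _ _ _) d1)); rewrite add0r.
    by apply/funext => r; rewrite cReD.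
  rewrite (_ : (fun r => _) = cst (complex.Im (a n)) + (fun r => complex.Im (duh n r))).
    by apply: (is_derive_eq (is_deriveD (is_derive_cst _ _ _) d2)); rewrite add0r.
  by apply/funext => r; rewrite cImD.
have := is_cderiveM h1 h2.
have E : expi (- lam n * t) * twisted n t = F n t.
  by rewrite /twisted mulrA -expiD mulNr addNr expi0 mul1r.
rewrite E /sol rmorphN /=; congr is_cderive; ring.
Qed.

Lemma duh_diff s t : 0 <= s <= T -> 0 <= t <= T ->
  l2le (fun n => duh n s - duh n t) ((s - t) ^+ 2 * MF).
Proof.
have tw r : l2le (fun n => twisted n r) MF.
  by move=> l ul; under eq_bigr do rewrite sqmod_twisted; exact: F_bound.
wlog st : s t / t <= s.
  move=> H hs ht; have [st|/ltW ts] := leP t s; first exact: H.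
  move=> l ul; have := H t s ts ht hs l ul; rewrite -[(t - s) ^+ 2]sqrrN opprB.
  by under eq_bigr do rewrite sqmodBC.
move=> /andP[s0 sT] /andP[t0 tT]; move: st; rewrite le_eqVlt => /predU1P[->|ts].
  rewrite subrr expr0n mul0r => l ul; rewrite big1// => n _; rewrite subrr; exact: sqmod0.
apply: l2_mean_value ts _ _ => [n r /andP[r1 r2]|r _]; last exact: tw.
by apply: is_cderive_duh; lra.
Qed.

Lemma duh_bound t : 0 <= t <= T -> l2le (fun n => duh n t) (T ^+ 2 * MF).
Proof.
move=> /[dup] ht /andP[t0 tT]; have h0 : 0 <= (0 : R) <= T by rewrite lexx ltW.
have := duh_diff ht h0; rewrite subr0 => h.
have {h} : l2le (fun n => duh n t) (t ^+ 2 * MF).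
  by move=> l ul; have := h l ul; under eq_bigr do rewrite duh0 subr0.
apply: l2leW; rewrite ler_wpM2r ?(l2le_ge0 (F_bound 0))//.
by rewrite ler_sqr ?nnegrE// ltW.
Qed.

Lemma sol_bound t : 0 <= t <= T -> l2le (fun n => sol n t) (2 * Ma + 2 * (T ^+ 2 * MF)).
Proof.
move=> ht l ul; under eq_bigr do rewrite sqmodM sqmod_expi mul1r.
exact: (l2leD aM (duh_bound ht)).
Qed.

(** Two increments are compared in [l^2]: the rotation of a fixed sequence, by
    dominated convergence, and the increment of [duh], by [duh_diff]. *)
Lemma sol_near t e : 0 <= t <= T -> 0 < e ->
  \forall s \near t, 0 <= s <= T -> l2le (fun n => sol n s - sol n t) e.
Proof.
move=> ht e0; have e4 : 0 < e / 4 by rewrite divr_gt0.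
have MF0 := l2le_ge0 (F_bound 0).
pose c n s := expi (- lam n * s) - expi (- lam n * t) : R[i].
have n1 : \forall s \near t, l2le (fun n => c n s * (a n + duh n t)) (e / 4).
  apply: (@l2le_mult_near _ _ (nbhs t) _ c _ _ 4 (l2leD aM (duh_bound ht))) => //.
    by move=> n s; apply: le_trans (sqmodB_le _ _) _; rewrite !sqmod_expi; lra.
  by move=> n; apply: ccontinuous_cvg; exact: ccontinuous_expi.
have n2 : \forall s \near t, (s - t) ^+ 2 * MF <= e / 4.
  have : (s - t) ^+ 2 * MF @[s --> t] --> (t - t) ^+ 2 * MF.
    apply: cvgM; last exact: cvg_cst.
    by apply: cvgM; apply: cvgB; [exact: cvg_id|exact: cvg_cst|exact: cvg_id|exact: cvg_cst].
  rewrite subrr expr0n mul0r => /cvgrPdist_le/(_ _ e4); apply: filterS => s.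
  rewrite sub0r normrN; exact: le_trans (ler_norm _).
apply: filterS2 n1 n2 => s h1 h2 hs.
have h3 : l2le (fun n => expi (- lam n * s) * (duh n s - duh n t)) (e / 4).
  move=> l ul; under eq_bigr do rewrite sqmodM sqmod_expi mul1r.
  exact: (l2leW h2 (duh_diff hs ht)).
have E : 2 * (e / 4) + 2 * (e / 4) = e by field.
rewrite -E => l ul; have := l2leD h1 h3 ul; congr (_ <= _).
apply: eq_bigr => n _; congr sqmod; rewrite /c /sol; ring.
Qed.

(** The equation in [H^(-3/2)]. By [l2_mean_value] applied to [sol] minus its
    linear part at [t], with weights, the error in the difference quotient is
    controlled by the oscillation of the right-hand side near [t], and the weight
    compensates the growth of the eigenvalues. *)
Lemma sol_derive t e : 0 <= t <= T -> 0 < e ->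
  \forall s \near t, 0 <= s <= T -> s != t ->
    l2le (fun n => (Num.sqrt (Hweight (- (3 / 2)) n))%:C%C *
      (((s - t)^-1)%:C%C * (sol n s - sol n t) -
        (F n t - 'i%C * ((lam n)%:C%C * sol n t)))) e.
Proof.
move=> ht e0.
have Lw0 : 0 <= Lw by apply: le_trans (lam_weight 0); rewrite mulr_ge0 ?sqr_ge0 ?(ltW (Hweight_gt0 _ _)).
pose e1 := e / (2 * (1 + Lw)).
have e10 : 0 < e1 by rewrite divr_gt0// mulr_gt0// ltr_pwDl.
have /nbhs_ballP[r1 /= r10 B1] := F_near t e10.
have /nbhs_ballP[r2 /= r20 B2] := sol_near ht e10.
pose w n := Num.sqrt (Hweight (- (3 / 2)) n) : R.
have w2 n : w n ^+ 2 = Hweight (- (3 / 2)) n by rewrite sqr_sqrtr// ltW// Hweight_gt0.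
pose rhs n s := F n s - 'i%C * ((lam n)%:C%C * sol n s).
have rhs_near s : 0 <= s <= T -> `|t - s| < Num.min r1 r2 ->
    l2le (fun n => (w n)%:C%C * (rhs n s - rhs n t)) e.
  rewrite lt_min => hs /andP[s1 s2].
  have h1 : l2le (fun n => (w n)%:C%C * (F n s - F n t)) e1.
    rewrite -[e1]mul1r; apply: l2le_ler (B1 s s1) => // n.
    by rewrite sqmodM sqmodC w2 ler_wpM2r ?sqmod_ge0//; exact: Hweight_le1.
  have h2 : l2le (fun n => (w n)%:C%C * ('i%C * ((lam n)%:C%C * (sol n s - sol n t)))) (Lw * e1).
    apply: l2le_ler (B2 s s2 hs) => // n.
    have i1 : sqmod ('i%C : R[i]) = 1 by rewrite /sqmod /= expr0n expr1n add0r.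
    by rewrite !sqmodM i1 mul1r !sqmodC w2 mulrA ler_wpM2r ?sqmod_ge0.
  have E : 2 * e1 + 2 * (Lw * e1) = e by rewrite /e1; field; rewrite gt_eqF// ltr_pwDl.
  rewrite -E => l ul; have := l2leB h1 h2 ul; congr (_ <= _).
  apply: eq_bigr => n _; congr sqmod; rewrite /rhs; ring.
pose Y n s := (w n)%:C%C * (sol n s - s%:C%C * rhs n t).
have dY n s : 0 <= s -> is_cderive (Y n) s ((w n)%:C%C * (rhs n s - rhs n t)).
  move=> s0; apply: is_cderiveZ; apply: is_cderiveB; last exact: is_cderive_id.
  exact: is_cderive_sol.
have r0 : 0 < Num.min r1 r2 by rewrite lt_min r10.
have Ydiff s : 0 <= s <= T -> `|t - s| < Num.min r1 r2 -> s != t ->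
    l2le (fun n => Y n s - Y n t) ((s - t) ^+ 2 * e).
  move=> /andP[s0 sT] hst; have /andP[t0 tT] := ht.
  rewrite neq_lt => /orP[st|ts].
    have : l2le (fun n => Y n t - Y n s) ((t - s) ^+ 2 * e).
      apply: (l2_mean_value (d := fun n r => (w n)%:C%C * (rhs n r - rhs n t)) st) => [n r /andP[h1 h2]|r /andP[h1 h2]].
        by apply: dY; lra.
      apply: rhs_near; first by apply/andP; split; lra.
      by apply: le_lt_trans hst; rewrite !ger0_norm ?subr_ge0//; lra.
    move=> h l ul; have := h l ul; rewrite -[(t - s) ^+ 2]sqrrN opprB.
    by under eq_bigr do rewrite sqmodBC.
  apply: (l2_mean_value (d := fun n r => (w n)%:C%C * (rhs n r - rhs n t)) ts) => [n r /andP[h1 h2]|r /andP[h1 h2]].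
    by apply: dY; lra.
  apply: rhs_near; first by apply/andP; split; lra.
  apply: le_lt_trans hst; rewrite distrC (distrC t) !ger0_norm ?subr_ge0//; lra.
apply/nbhs_ballP; exists (Num.min r1 r2) => //= s hs hsT st.
have h := Ydiff s hsT hs st.
have st0 : s - t != 0 by rewrite subr_eq0.
have -> : e = ((s - t)^-1) ^+ 2 * ((s - t) ^+ 2 * e).
  by rewrite mulrA -exprMn mulVf// expr1n mul1r.
apply: l2le_ler h; first exact: sqr_ge0.
move=> n; rewrite -sqmodC -sqmodM le_eqVlt; apply/orP; left; apply/eqP; congr sqmod.
rewrite /Y -/(w n) -/(rhs n t).
have Ec : (s - t)^-1%:C%C * (s%:C%C - t%:C%C) = 1 :> R[i].
  by rewrite -rmorphB -rmorphM /= mulVf.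
transitivity ((w n)%:C%C * ((s - t)^-1%:C%C * (sol n s - sol n t) -
   ((s - t)^-1%:C%C * (s%:C%C - t%:C%C)) * rhs n t)); first by rewrite Ec mul1r.
ring.
Qed.

End duhamel.

(** * The moments of the control *)

Section moments.
Context {R : realType}.
Variables (lamn : nat -> R) (T C : R) (q : nat -> R -> R).
Hypothesis T0 : 0 < T.
Hypothesis Hq : forall k,
    [/\ continuous (q k), forall t, `|q k t| <= C,
      forall t, t <= 0 \/ T <= t -> q k t = 0 &
      forall n f, moment (q k) (fun t => cos ((lamn n - lamn k) * t + f)) =
        (n == k)%:R * cos f].
Variable (omega : set R).
Hypothesis (op : open omega).
Variables (d : int -> R[i]) (M : R).
Hypothesis dM : l2le d M.
Variable G : R -> R -> R[i].
Hypothesis GL2 : forall s, L2 (G s).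
Hypothesis Gfourier : forall s m, fourier (G s) m = osc lamn q m s * d m.

Local Notation osc := (osc lamn q).
Local Notation lamz := (lamz lamn).
Local Notation phi := (phi omega).
Local Notation forcing := (forcing lamn omega G).

Let sG s : sqint (G s). Proof. by have /L2P[] := GL2 s. Qed.

Lemma fourier_truncate_trigsum s (a : int -> R[i]) n :
  fourier (truncate omega (trigsum s a)) n = \sum_(m <- s) a m * phi (n - m).
Proof.
transitivity (fourier (fun x => \sum_(m <- s) a m * truncate omega (expz m) x) n).
  apply: eq_fourier => x; rewrite /truncate /trigsum mulr_sumr.
  by apply: eq_bigr => m _; rewrite mulrCA.
have st m : sqint (truncate omega (expz m)) by apply: sqint_truncate => //; exact: sqint_expz.
rewrite fourier_sum; last by move=> m; exact: sqintZ.
by apply: eq_bigr => m _; rewrite fourierZ// fourier_truncate_expz.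
Qed.

(** The time factors are bounded by [C] and the truncation does not increase the
    energy, so the error is controlled by the coefficients outside [s0], at every
    time. *)
Lemma source_approx (s0 : seq int) e n s : uniq s0 ->
  l2le (fun m => if m \in s0 then 0 else d m) e ->
  sqmod (source omega G n s - \sum_(m <- s0) d m * phi (n - m) * osc m s) <= C ^+ 2 * e.
Proof.
move=> us0 te; pose a m := osc m s * d m.
have st : sqint (trigsum s0 a) by exact: sqint_trigsum.
have sB : sqint (fun x => G s x - trigsum s0 a x) by exact: sqintB.
have -> : source omega G n s - \sum_(m <- s0) d m * phi (n - m) * osc m s =
    fourier (truncate omega (fun x => G s x - trigsum s0 a x)) n.
  rewrite truncateB fourierB; [|exact: sqint_truncate|exact: sqint_truncate].
  rewrite fourier_truncate_trigsum; congr (_ - _).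
  by apply: eq_bigr => m _; rewrite /a mulrC mulrA.
have sT := sqint_truncate op sB.
apply: le_trans (sqmod_fourier n sT) _.
rewrite ler_pdivrMl ?twopi_gt0//; apply: le_trans (energy_truncate_le op sB) _.
have /L2P[pG _] := GL2 s.
apply: energy_le_of_fourier.
  by apply/L2P; split=> // x; rewrite pG trigsum_periodic.
apply: l2le_ler te; first exact: sqr_ge0.
move=> m; rewrite fourierB// fourier_trigsum// Gfourier.
case: ifP => _; first by rewrite /a subrr sqmod0 mulr0.
by rewrite subr0 sqmodM ler_wpM2r ?sqmod_ge0// (sqmod_osc Hq).
Qed.

(** Only the frequencies [n] and [- n], which share the eigenvalue, contribute
    to the moment of order [n]. They coincide for [n = 0], whence the second
    case. The infinite sum over frequencies is replaced by a finite one up to an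
    arbitrarily small error, uniformly in time. *)
Lemma Cintegral_forcing n : Cintegral `[-1, T] (forcing n) =
  phi 0 * d n + (if n == 0 then 0 else phi (2 * n) * d (- n)).
Proof.
have mA : measurable (`[-1, T]%classic : set (measurableTypeR R)) by exact: measurable_itv.
set X := Cintegral _ _; set Y := RHS.
suff key e : 0 < e -> sqmod (X - Y) <= 2 * (C ^+ 2 * (T + 1) ^+ 2) * e.
  apply/eqP; rewrite -subr_eq0 -sqmod_eq0 eq_le sqmod_ge0 andbT.
  set K := 2 * (C ^+ 2 * (T + 1) ^+ 2) in key.
  have K0 : 0 <= K by apply: mulr_ge0 => //; apply: mulr_ge0; exact: sqr_ge0.
  apply/ler_addgt0Pl => e e0; rewrite addr0.
  have e1 : 0 < e / (K + 1) by rewrite divr_gt0// ltr_wpDl.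
  apply: le_trans (key _ e1) _; rewrite mulrCA ler_piMr ?(ltW e0)//.
  by rewrite ler_pdivrMr ?mul1r ?ltr_wpDl// lerDl.
move=> e0; have [s0 [us0 te]] := l2le_tail dM e0.
(* The set is enlarged to contain the two resonant frequencies. *)
pose s1 := undup [:: n, - n & s0].
have us1 : uniq s1 by exact: undup_uniq.
have te1 : l2le (fun m => if m \in s1 then 0 else d m) e.
  rewrite -[e]mul1r; apply: l2le_ler te => // m; rewrite mul1r mem_undup !inE.
  by case: (m \in s0); rewrite ?orbT// orbF; case: ifP => // _; rewrite sqmod0 sqmod_ge0.
pose z m s : R[i] := expi (lamz n * s) * osc m s.
have cz m : ccontinuous (z m).
  by apply: ccontinuousM; [exact: ccontinuous_expi|exact: (ccontinuous_osc Hq)].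
pose P s := \sum_(m <- s1) (d m * phi (n - m)) * z m s.
have YP : Y = Cintegral `[-1, T] P.
  rewrite /P Cintegral_sum//.
  under eq_bigr => m _ do rewrite /z (Cintegral_osc Hq).
  have ns1 : n \in s1 by rewrite mem_undup !inE eqxx.
  rewrite (bigD1_seq n)//= eqxx mulr1 subrr mulrC /Y; congr (_ + _).
  have [->|n0] := eqVneq n 0.
    rewrite big1// => m m0; rewrite eq_sym absz_eq0 (negbTE m0) mulr0//.
  have nn : - n != n by lia.
  have ms1 : - n \in s1 by rewrite mem_undup !inE eqxx orbT.
  rewrite -big_filter (bigD1_seq (- n)) ?filter_uniq ?mem_filter ?nn//=.
  rewrite abszN eqxx mulr1 opprK big_filter_cond big1 ?addr0.
    by rewrite mulrC; congr (_ * phi _); ring.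
  move=> m /andP[m1 m2]; case: eqP => [|_]; last by rewrite mulr0.
  by move=> E; exfalso; clear -E m1 m2; lia.
have cP : ccontinuous P by apply: ccontinuous_sum.
have cf := ccontinuous_forcing Hq op dM GL2 Gfourier n.
have -> : X - Y = Cintegral `[-1, T] (fun s => forcing n s - P s).
  by rewrite YP (CintegralB mA) //; exact: cint_ccontinuous.
pose e1 := C * Num.sqrt e.
have e10 : 0 <= e1 by rewrite mulr_ge0 ?(C_ge0 Hq).
have e12 : e1 ^+ 2 = C ^+ 2 * e by rewrite exprMn sqr_sqrtr// ltW.
have -> : 2 * (C ^+ 2 * (T + 1) ^+ 2) * e = 2 * (e1 * (T - -1)) ^+ 2.
  by rewrite exprMn e12 opprK; ring.
apply: sqmod_Cintegral_le => //; first exact: lt_trans (ltrN10 R) T0.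
  rewrite (_ : (fun _ => _) = fun s => forcing n s + -1 * P s).
    by apply: ccontinuousD => //; exact: ccontinuousZ.
  by apply/funext => s; rewrite mulN1r.
move=> s; have := source_approx n s us1 te1; rewrite -e12; apply: le_trans.
rewrite -[X in _ <= X]mul1r -(sqmod_expi (lamz n * s)) -sqmodM le_eqVlt; apply/orP; left.
apply/eqP; congr sqmod; rewrite mulrBr /P mulr_sumr; congr (_ - _).
by apply: eq_bigr => m _; rewrite /z mulrCA.
Qed.

End moments.

(** * Solution of the moment equations, uniqueness *)

Section pairs_of_frequencies.
Context {R : realType}.

(** The system couples only [n] and [- n]. Its determinant
    [r ^+ 2 - sqmod (psi n)] is at least [delta ^+ 2], so Cramer's formulas give
    a square summable solution. *)
Lemma solve_pairs (r delta : R) (psi a : int -> R[i]) Ma : 0 < delta -> delta <= r ->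
  (forall n, psi (- n) = ((psi n)^*)%C) ->
  (forall n, sqmod (psi n) <= (r - delta) ^+ 2) -> l2le a Ma ->
  exists d M, l2le d M /\ forall n, r%:C%C * d n + psi n * d (- n) = - a n.
Proof.
move=> d0 dr psiJ psiM aM.
pose D n := r ^+ 2 - sqmod (psi n).
have D_ge n : delta ^+ 2 <= D n.
  have := psiM n; have : 0 <= delta * (r - delta) by rewrite mulr_ge0 ?subr_ge0// ltW.
  by rewrite /D; nra.
have D_gt0 n : 0 < D n by apply: lt_le_trans (D_ge n); rewrite exprn_gt0.
have psir n : sqmod (psi n) <= r ^+ 2 by have := D_gt0 n; rewrite subr_gt0 => /ltW.
pose c n := r%:C%C * a n - psi n * a (- n).
pose d n := - ((D n)^-1)%:C%C * c n.
exists d, ((delta ^+ 2)^-1 ^+ 2 * (2 * (r ^+ 2 * Ma) + 2 * (r ^+ 2 * Ma))); split.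
  apply: (@l2le_ler _ c); first exact: sqr_ge0.
    move=> n; rewrite sqmodM sqmodN sqmodC ler_wpM2r ?sqmod_ge0//.
    rewrite ler_sqr ?nnegrE ?invr_ge0 ?sqr_ge0 ?(ltW (D_gt0 n))//.
    by rewrite lef_pV2 ?posrE ?exprn_gt0.
  apply: l2leB.
    by apply: l2le_ler aM => [|n]; rewrite ?sqr_ge0// sqmodM sqmodC.
  apply: l2le_ler (l2le_opp aM) => [|n]; rewrite ?sqr_ge0//.
  by rewrite sqmodM ler_wpM2r ?sqmod_ge0.
move=> n; have DN : D (- n) = D n by rewrite /D psiJ sqmodJ.
have E : (r%:C%C * r%:C%C - psi n * (psi n)^*%C) * ((D n)^-1)%:C%C = 1 :> R[i].
  rewrite mulcJ -!rmorphM -rmorphB -rmorphM /= -expr2 -/(D n) divff//.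
  by rewrite gt_eqF.
rewrite /d /c DN psiJ opprK -[RHS]mulr1 -E; ring.
Qed.

End pairs_of_frequencies.

Section uniqueness.
Context {R : realType}.
Notation mu := (@lebesgue_measure R).

Lemma is_derive_of_quotient (f : R -> R) (t l : R) :
  (forall e, 0 < e -> \forall s \near t, s != t -> `|(s - t)^-1 * (f s - f t) - l| <= e) ->
  is_derive t 1 f l.
Proof.
move=> H.
have h : (h^-1 *: ((f \o shift t) (h *: 1) - f t))%R @[h --> (0 : R)^'] --> l.
  apply/cvgrPdist_le => e e0; have /nbhs_ballP[r /= r0 B] := H e e0.
  rewrite near_withinE; apply/nbhs_ballP; exists r => //= k.
  rewrite /ball /= sub0r normrN => kr k0.
  have := B (k + t); rewrite /ball /= opprD addrCA subrr addr0 normrN => /(_ kr).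
  have -> : (k + t != t) by rewrite -subr_eq0 addrK.
  by move=> /(_ isT); rewrite addrK distrC /shift /GRing.scale /= mulr1.
by apply: DeriveDef; [apply/cvg_ex; exists l|exact: cvg_lim].
Qed.

Lemma continuous_of_quotient (A : set R) (f : R -> R) (t l : R) :
  (\forall s \near t, A s -> s != t -> `|(s - t)^-1 * (f s - f t) - l| <= 1) ->
  f s @[s --> within A (nbhs t)] --> f t.
Proof.
move=> /nbhs_ballP[r /= r0 B]; apply/cvgrPdist_le => e e0; rewrite near_withinE.
pose K := 1 + `|l|; have K0 : 0 < K by rewrite ltr_pwDl.
apply/nbhs_ballP; exists (Num.min r (e / K)) => /=; first by rewrite lt_min r0 divr_gt0.
move=> s; rewrite /ball /= lt_min => /andP[sr se] As.
have [->|st] := eqVneq s t; first by rewrite subrr normr0 ltW.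
have h := B s sr As st.
have st0 : s - t != 0 by rewrite subr_eq0.
have -> : f t - f s = (t - s) * ((s - t)^-1 * (f s - f t)).
  by field.
rewrite normrM; apply: le_trans (_ : (e / K) * K <= _); last by rewrite divfK// gt_eqF.
apply: ler_pM => //; first exact: ltW.
rewrite -[X in `|X|](subrK l); apply: le_trans (ler_normD _ _) _.
by rewrite lerD2r.
Qed.

Lemma is_derive_Hs_near (r T : R) (w : R -> int -> R[i]) (t : R) (a : int -> R[i]) n e :
  0 < e -> is_derive_Hs r T w t a ->
  \forall s \near t, 0 <= s <= T -> s != t ->
    sqmod ((s - t)^-1%:C%C * (w s n - w t n) - a n) <= e.
Proof.
move=> e0 H; have W0 := Hweight_gt0 r n.
have e1 : 0 < Num.sqrt (e * Hweight r n) by rewrite sqrtr_gt0 mulr_gt0.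
pose N s := Hnorm r (fun n => ((s - t)^-1)%:C%C * (w s n - w t n) - a n).
have /fine_cvgP[Hfin /cvgrPdist_le/(_ _ e1) Hle] : N s @[s --> within `[0, T] t^'] --> 0%E := H.
have : \forall s \near within `[0, T] t^', (N s <= (Num.sqrt (e * Hweight r n))%:E)%E.
  apply: filterS2 Hfin Hle => s fs; rewrite sub0r normrN => h.
  by rewrite -(fineK fs) lee_fin; exact: le_trans (ler_norm _) h.
rewrite !near_withinE; apply: filterS => s h sT st.
have /Hnorm_ge -/(_ n e1) : (N s <= (Num.sqrt (e * Hweight r n))%:E)%E.
  by apply: h => //=; rewrite in_itv.
by rewrite sqr_sqrtr ?(ltW (mulr_gt0 e0 W0))// mulrC ler_pM2r.
Qed.

(** A complex function with [z' = - i k z] and [k] real has constant modulus. The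
    derivative at the ends of the interval is one-sided; there only continuity
    is retained, which suffices for the mean value theorem. *)
Lemma rotation_unique (k T : R) (z : R -> R[i]) : z 0 = 0 ->
  (forall t e, 0 <= t <= T -> 0 < e -> \forall s \near t, 0 <= s <= T -> s != t ->
    sqmod ((s - t)^-1%:C%C * (z s - z t) - (- 'i%C * (k%:C%C * z t))) <= e) ->
  forall t, 0 <= t <= T -> z t = 0.
Proof.
move=> z0 H t /andP[]; rewrite le_eqVlt => /predU1P[<-//|t0] tT.
pose x s := complex.Re (z s); pose y s := complex.Im (z s).
have sq (p e : R) : 0 < e -> p ^+ 2 <= e ^+ 2 -> `|p| <= e.
  move=> e0; rewrite -(real_normK (num_real p)) ler_sqr ?nnegrE//; exact: ltW.
have Hx s e : 0 <= s <= T -> 0 < e -> \forall r \near s, 0 <= r <= T -> r != s ->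
    `|(r - s)^-1 * (x r - x s) - k * y s| <= e.
  move=> hs e0; have e2 : 0 < e ^+ 2 by rewrite exprn_gt0.
  apply: filterS (H s _ hs e2) => r h hr rs; apply: sq => //.
  apply: le_trans (h hr rs); apply: le_trans (normRe_sqmod _).
  by rewrite le_eqVlt; apply/orP; left; apply/eqP; congr (_ ^+ 2); rewrite !ReImE /x /y /=; ring.
have Hy s e : 0 <= s <= T -> 0 < e -> \forall r \near s, 0 <= r <= T -> r != s ->
    `|(r - s)^-1 * (y r - y s) - - (k * x s)| <= e.
  move=> hs e0; have e2 : 0 < e ^+ 2 by rewrite exprn_gt0.
  apply: filterS (H s _ hs e2) => r h hr rs; apply: sq => //.
  apply: le_trans (h hr rs); apply: le_trans (normIm_sqmod _).
  by rewrite le_eqVlt; apply/orP; left; apply/eqP; congr (_ ^+ 2); rewrite !ReImE /x /y /=; ring.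
have sub s : 0 <= s <= t -> 0 <= s <= T by case/andP => -> /le_trans; apply.
pose E s := x s * x s + y s * y s.
have inner s (P : R -> Prop) : 0 < s < t -> (\forall r \near s, 0 <= r <= T -> P r) -> \forall r \near s, P r.
  move=> /andP[s0 st].
  have : \forall r \near s, 0 < r by exact: lt_nbhsr.
  have : \forall r \near s, r < t by exact: lt_nbhsl.
  apply: filterS3 => r rt r0; apply; rewrite (ltW r0) /=.
  exact: le_trans (ltW rt) tT.
have dE s : s \in `]0, t[ -> is_derive s 1 E 0.
  rewrite in_itv /= => st.
  have hs : 0 <= s <= T by case/andP: st => h1 h2; rewrite (ltW h1) (le_trans (ltW h2)).
  have dx : is_derive s 1 x (k * y s).
    by apply: is_derive_of_quotient => e e0; apply: inner st _; exact: Hx.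
  have dy : is_derive s 1 y (- (k * x s)).
    by apply: is_derive_of_quotient => e e0; apply: inner st _; exact: Hy.
  apply: (is_derive_eq (is_deriveD (is_deriveM dx dx) (is_deriveM dy dy))).
  by rewrite /GRing.scale /=; ring.
have cE : {within `[0, t], continuous E}.
  apply/subspace_continuousP => s; rewrite /= in_itv /= => /sub hs.
  have cx : x r @[r --> within `[0, t] (nbhs s)] --> x s.
    apply: (@continuous_of_quotient _ _ _ (k * y s)); apply: filterS (Hx s 1 hs ltr01) => r h.
    by rewrite /= in_itv /= => /sub; exact: h.
  have cy : y r @[r --> within `[0, t] (nbhs s)] --> y s.
    apply: (@continuous_of_quotient _ _ _ (- (k * x s))); apply: filterS (Hy s 1 hs ltr01) => r h.
    by rewrite /= in_itv /= => /sub; exact: h.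
  by apply: cvgD; apply: cvgM.
have [c _] := MVT t0 dE cE.
rewrite mul0r => /eqP; rewrite subr_eq0 => /eqP Et.
apply/eqP; rewrite -sqmod_eq0 /sqmod !expr2 -/(x t) -/(y t) -/(E t) Et.
by rewrite /E /x /y z0 /= mul0r addr0.
Qed.

Lemma energy_ae0 w : sqint w -> w = (fun=> 0 : R[i]) %[ae mu] -> energy w = 0.
Proof.
move=> [mw _] w0; rewrite -[RHS](@energy0 R) /energy /Rintegral; congr fine.
apply: ae_eq_integral => //.
  by apply/measurable_EFinP; exact: measurable_sqmod.
apply: filterS w0; first exact: (ae_filter_ringOfSetsType mu).
by move=> x /(_ I) h _; rewrite h.
Qed.

Lemma eq_fourier_ae u v n : L2 u -> L2 v -> u = v %[ae mu] -> fourier u n = fourier v n :> R[i].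
Proof.
move=> /L2P[_ su] /L2P[_ sv] uv.
have sB := sqintB su sv.
apply/eqP; rewrite -subr_eq0 -fourierB// -sqmod_eq0 eq_le sqmod_ge0 andbT.
apply: le_trans (sqmod_fourier n sB) _; rewrite energy_ae0 ?mulr0//.
apply: filterS uv; first exact: (ae_filter_ringOfSetsType mu).
by move=> x /(_ I) h _; rewrite h subrr.
Qed.

(** The Fourier coefficients of the difference of two solutions satisfy the
    assumptions of [rotation_unique], and the coefficients determine the
    function. *)
Lemma solution_unique (g b T : R) (omega : set R) (f u v : R -> R -> R[i]) uin : 0 < T ->
  is_solution g b T omega f uin u -> is_solution g b T omega f uin v ->
  forall t, t \in `[0, T] -> v t = u t %[ae mu].
Proof.
move=> T0 [[uL _] du u0] [[vL _] dv v0] t tT.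
apply: fourier_inj; [exact: vL|exact: uL|move=> n].
pose z s := fourier (v s) n - fourier (u s) n.
apply/eqP; rewrite -subr_eq0; apply/eqP; rewrite -/(z t).
apply: (@rotation_unique (ell g b n) T); last by move: tT; rewrite in_itv.
  have i0 : 0 \in `[0, T] by rewrite in_itv /= lexx ltW.
  apply/eqP; rewrite subr_eq0; apply/eqP; apply: eq_fourier_ae; [exact: vL|exact: uL|].
  apply: filterS2 v0 u0; first exact: (ae_filter_ringOfSetsType mu).
  by move=> x h1 h2 _; rewrite h1// h2.
move=> s e hs e0; have e4 : 0 < e / 4 by rewrite divr_gt0.
have hs' : s \in `[0, T] by rewrite in_itv.
have h1 := is_derive_Hs_near n e4 (dv s hs'); have h2 := is_derive_Hs_near n e4 (du s hs').
apply: filterS2 h1 h2 => r h1 h2 hr rs.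
have {h1}h1 := h1 hr rs; have {h2}h2 := h2 hr rs.
have -> : e = 2 * (e / 4) + 2 * (e / 4) by field.
apply: le_trans (lerD (ler_wpM2l _ h1) (ler_wpM2l _ h2)); rewrite ?ler0n//.
apply: le_trans (sqmodB_le _ _); rewrite le_eqVlt; apply/orP; left; apply/eqP; congr sqmod.
rewrite /z /Lop; ring.
Qed.

End uniqueness.

(** * Existence of solutions and null control *)

Section existence.
Context {R : realType}.
Notation mu := (@lebesgue_measure R).
Variables (g b T : R).
Hypotheses (g0 : 0 < g) (b0 : 0 < b) (T0 : 0 < T).
Variables (omega : set R) (f : R -> R -> R[i]) (MF : R).
Let F n s := fourier (truncate omega (f s)) n.
Hypothesis F_cont : forall n, ccontinuous (F n).
Hypothesis F_bound : forall s, l2le (fun n => F n s) MF.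
Hypothesis F_near : forall t e, 0 < e ->
  \forall s \near t, l2le (fun n => F n s - F n t) e.
Hypothesis F_supp : forall n s, s <= 0 -> F n s = 0.
Variable uin : R -> R[i].
Hypothesis uin_L2 : L2 uin.

(** At each time, [riesz_fischer] makes a function of the sequence given by
    Duhamel's formula. Bessel and Parseval turn the estimates on these sequences
    into estimates in [L^2] and [H^(-3/2)]. *)
Lemma duhamel_solution : exists u, is_solution g b T omega f uin u /\
  forall t n, 0 <= t <= T -> fourier (u t) n = sol (ell g b) F (fourier uin) n t.
Proof.
have /L2P[_ su] := uin_L2; have aM := bessel su; set Ma := _ * energy uin in aM.
pose U := sol (ell g b) F (fourier uin).
have bd := sol_bound (ell g b) T0 F_cont F_bound F_supp aM.
have [u Hu] : {u : R -> R -> R[i] & forall t, L2 (u t) /\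
    (0 <= t <= T -> forall n, fourier (u t) n = U n t)}.
  apply: (@choice _ _ (fun t w => L2 w /\
    (0 <= t <= T -> forall n, fourier w n = U n t))) => t.
  have [ht|ht] := boolP (0 <= t <= T).
    by have [w [Lw wU _]] := riesz_fischer (bd t ht); exists w; split.
  have [w [Lw _ _]] := riesz_fischer aM.
  by exists w; split.
have uL t : L2 (u t) := (Hu t).1.
have uU t n : 0 <= t <= T -> fourier (u t) n = U n t by move=> ht; exact: (Hu t).2.
have us t : sqint (u t) by have /L2P[] := uL t.
exists u; split => //; split.
- split => [t _ //|t]; rewrite in_itv /= => ht.
  apply: L2norm_cvg0 => e e0; rewrite near_withinE.
  have p0 := @twopi_gt0 R; have e1 : 0 < e / (2 * pi) by rewrite divr_gt0.
  apply: filterS (sol_near (ell g b) T0 F_cont F_bound F_supp aM ht e1) => s h.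
  rewrite /= in_itv /= => hs; split; first exact: sqintB.
  rewrite -[e](divfK (lt0r_neq0 p0)) mulrC; apply: energy_le_of_fourier.
    have /L2P[ps _] := uL s; have /L2P[pt _] := uL t.
    by apply/L2P; split; [move=> x; rewrite ps pt|exact: sqintB].
  move=> l ul; under eq_bigr do rewrite fourierB// !uU//.
  exact: h.
- move=> t; rewrite in_itv /= => ht; apply: cvge0P => [s|e e0]; first exact: poweR_ge0.
  have e2 : 0 < e ^+ 2 by rewrite exprn_gt0.
  have lw n : Hweight (- (3 / 2)) n * ell g b n ^+ 2 <= g + 1 by exact: ell_weight.
  rewrite !near_withinE.
  apply: filterS (sol_derive T0 lw F_cont F_bound F_near F_supp aM ht e2) => s h st.
  rewrite /= in_itv /= => hs; apply: Hnorm_le => // l ul.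
  under eq_bigr do rewrite /Lop !uU//.
  exact: h.
- have h0 : 0 <= (0 : R) <= T by rewrite lexx ltW.
  by apply: fourier_inj => // n; rewrite uU// /U sol0.
Qed.

End existence.

Theorem proposition1p3 (R : realType) (g b : R) (g_gt0 : 0 < g) (b_gt0 : 0 < b)
    (uin : R -> R[i]) (uin_L2 : L2 uin) (T : R) (T_gt0 : 0 < T)
    (omega : set R) (omega_periodic : periodic_set omega)
    (omega_open : open omega) (omega_neq0 : omega !=set0) :
  exists f : R -> R -> R[i], C0L2 T f /\
  exists u : R -> R -> R[i],
    [/\ is_solution g b T omega f uin u,
        forall v : R -> R -> R[i], is_solution g b T omega f uin v ->
          forall t : R, t \in `[0, T] -> v t = u t %[ae lebesgue_measure] &
        u T = cst 0 %[ae lebesgue_measure]].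
Proof.
pose lam (k : nat) := ell g b k.
have [c c0 gap] := ell_gap g_gt0 b_gt0.
have [q [C Hq]] := biorthogonal_profiles c0 T_gt0 gap.
have [delta [d0 dr phiM]] := phi_gap omega_open omega_periodic omega_neq0.
(* For n = 0 the system is the single equation phi 0 * d 0 = - a 0. *)
pose psi n := if n == 0 then 0 else phi omega (2 * n).
have /L2P[_ su] := uin_L2; have aM := bessel su.
have [d [M [dM dE]]] : exists d M, l2le d M /\
    forall n, (complex.Re (phi omega 0))%:C%C * d n + psi n * d (- n) = - fourier uin n.
  apply: solve_pairs d0 dr _ _ aM => n; rewrite /psi ?oppr_eq0.
    by case: eqP => _; rewrite ?conjc0// mulrN phiN.
  by case: eqVneq => [_|/phiM//]; rewrite sqmod0 sqr_ge0.
have dl2 s : l2le (fun m => osc lam q m s * d m) (C ^+ 2 * M).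
  apply: l2le_ler dM; first exact: sqr_ge0.
  by move=> m; rewrite sqmodM ler_wpM2r ?sqmod_ge0// (sqmod_osc Hq).
have [G HG] : {G : R -> R -> R[i] & forall s, L2 (G s) /\
    forall m, fourier (G s) m = osc lam q m s * d m}.
  apply: (@choice _ _ (fun s w => L2 w /\ forall m, fourier w m = osc lam q m s * d m)) => s.
  by have [w [Lw wE _]] := riesz_fischer (dl2 s); exists w.
have GL2 s : L2 (G s) := (HG s).1.
have GE s m : fourier (G s) m = osc lam q m s * d m := (HG s).2 m.
have [u [uS uE]] := duhamel_solution g_gt0 b_gt0 T_gt0
  (ccontinuous_source Hq omega_open dM GL2 GE) (source_bound Hq omega_open dM GL2 GE)
  (source_near Hq omega_open dM GL2 GE)
  (fun n s h => source_supp Hq omega_open GL2 GE n (or_introl h)) uin_L2.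
exists G; split; first exact: (C0L2_control Hq dM GL2 GE).
exists u; split => //.
  by move=> v vS; exact: solution_unique T_gt0 uS vS.
have TT : 0 <= T <= T by rewrite lexx ltW.
have [[uL _] _ _] := uS.
have L0 : L2 (cst 0 : R -> R[i]) by apply/L2P; split => //; exact: sqint0.
apply: fourier_inj => //; first by apply: uL; rewrite in_itv.
move=> n; rewrite uE// fourier0.
have -> : sol (ell g b) (source omega G) (fourier uin) n T =
    expi (- ell g b n * T) * (fourier uin n + duh (ell g b) (source omega G) n T) by [].
have -> : duh (ell g b) (source omega G) n T = Cintegral `[-1, T] (forcing lam omega G n).
  by apply: eq_Cintegral => s _; rewrite /twisted /forcing /lamz /lam -ell_abs.
rewrite (Cintegral_forcing T_gt0 Hq omega_open dM GL2 GE) phi0E//.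
have -> : (if n == 0 then 0 else phi omega (2 * n) * d (- n)) = psi n * d (- n).
  by rewrite /psi; case: eqP; rewrite ?mul0r.
by rewrite dE addrN mulr0.
Qed.
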